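(* Let $K_1,K_2$ be oriented knots with diagrams $D_1,D_2$, let $\rho_1,\rho_2$ be boundary-parabolic representations of $\pi_1(K_1),\pi_1(K_2)$ into $\mathrm{PSL}(2,\mathbb{C})$, and let $\rho_1\#\rho_2$ be a connected sum of them, given by an arc-coloring of $D_1\#D_2$. Consider a shadow-coloring of $D_1\#D_2$ induced by $\rho_1\#\rho_2$, with region-colors $s_1,\dots,s_m\in\mathbb{C}^2\setminus\{0\}$ indexed so that $s_1,\dots,s_l,s_{l+1}$ are the colors of the regions of $D_1$, and $s_l,s_{l+1},\dots,s_m$ are those of the regions of $D_2$, where $s_l$ is the color of the unbounded region of $D_1\#D_2$. Let $p$ be as in the definition of $\mathbf{w}^{(0)}$, and let $\mathbf{w}^{(0)}=(w_1^{(0)},\dots,w_m^{(0)})$ with $w_k^{(0)}=\det(p,s_k)$ be the corresponding solution of the equations $\mathcal{I}$ of $D_1\#D_2$. Let $W_1(w_1,\dots,w_{l+1})$ and $W_2(w_l,\dots,w_m)$ be the potential functions of $D_1$ and $D_2$, and put $\mathbf{w}_1^{(0)}=(w_1^{(0)},\dots,w_l^{(0)},w_{l+1}^{(0)})$, $\mathbf{w}_2^{(0)}=(w_l^{(0)},w_{l+1}^{(0)},\dots,w_m^{(0)})$. Then $\mathbf{w}_1^{(0)}$ and $\mathbf{w}_2^{(0)}$ are solutions of $$\mathcal{I}_1=\Bigl\{\exp\bigl(w_k\tfrac{\partial W_1}{\partial w_k}\bigr)=1\ \Big|\ k=1,\dots,l+1\Bigr\},\qquad \mathcal{I}_2=\Bigl\{\exp\bigl(w_k\tfrac{\partial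 W_2}{\partial w_k}\bigr)=1\ \Big|\ k=l,\dots,m\Bigr\},$$ respectively. Furthermore, for $j=1,2$, $\rho_{\mathbf{w}_j^{(0)}}=\rho_j$ up to conjugation, and $$(W_j)_0(\mathbf{w}_j^{(0)})\equiv i\bigl(\mathrm{vol}(\rho_j)+i\,\mathrm{cs}(\rho_j)\bigr)\pmod{\pi^2}.$$
   Context: Basics. All representations are up to conjugation in $\mathrm{PSL}(2,\mathbb{C})$; $\pi_1(K)=\pi_1(\mathbb{S}^3\setminus K)$; $\rho$ is boundary-parabolic if meridians go to parabolic (non-trivial) elements; $\mathcal{P}$ is the set of parabolic elements of $\mathrm{PSL}(2,\mathbb{C})$. Let $D$ be an oriented diagram (at least one crossing) with arcs $\alpha_k$, viewed as Wirtinger generators; at a crossing with over-arc $\alpha_k$, under-arc $\alpha_l$ to the right of the oriented over-arc and under-arc $\alpha_{l'}$ to its left, the relation is $\alpha_{l'}=\alpha_k\alpha_l\alpha_k^{-1}$. The arc-coloring induced by $\rho$ is $a_k=\rho(\alpha_k)\in\mathcal{P}$; it determines $\rho$. Connected sum. $D_1\#D_2$ is formed by cutting an arc $\alpha$ of $D_1$ and an arc $\beta$ of $D_2$ and joining compatibly with orientations by two connecting arcs. Conjugate $\rho_1,\rho_2$ so that $\rho_1(\alpha)=\rho_2(\beta)=a$, color the connecting arcs by $a$ and keep all other colors; the resulting representation is a connected sum $\rho_1\#\rho_2$. The two connecting arcs separate the regions colored $s_l$ and $s_{l+1}$, which are the two regions common to $D_1$ and $D_2$. The diagrams $D_1,D_2$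 inherit their arc- and region-colorings from $D_1\#D_2$. Shadow-coloring. Identify $(\mathbb{C}^2\setminus\{0\})/\pm$ with $\mathcal{P}$ by $\binom{\alpha}{\beta}\leftrightarrow\begin{pmatrix}1+\alpha\beta&-\alpha^2\\ \beta^2&1-\alpha\beta\end{pmatrix}$. For $v,b=\binom{\gamma}{\delta}$ put $v*b=\begin{pmatrix}1+\gamma\delta&-\gamma^2\\ \delta^2&1-\gamma\delta\end{pmatrix}v$ (this corresponds to $bvb^{-1}$ in $\mathcal{P}$, and does not depend on the sign of $b$). Let $h\binom{\alpha}{\beta}=\alpha/\beta\in\mathbb{CP}^1$. Region-colors are vectors in $\mathbb{C}^2\setminus\{0\}$ assigned to the regions such that if $s$ is the color of the region to the right of an oriented arc with color $a_k$, the region to its left has color $s*a_k$ (arc-colors matter only up to sign). A shadow-coloring induced by $\rho$ is the arc-coloring induced by $\rho$ together with a region-coloring such that $h(a_k),h(s),h(s*a_k)$ are pairwise distinct for every arc color $a_k$ with adjacent region-colors $s,s*a_k$. Choose $p\in\mathbb{C}^2\setminus\{0\}$ with $h(p)\notin\{h(a_1),\dots,h(a_n),h(s_1),\dots,h(s_m)\}$. $\det(a,b)$ is the determinant of the matrix with columns $a,b$. Potential function. Assign variables $w_1,\dots,w_m$ to the regions of $D$. At a crossing $j$ let $w_a$ be the variable of the region between the two outgoing strands, $w_c$ that of the region between the two incoming strands, and $w_b,w_d$ those of the regions to the left, respectively right, of both strands. For a positive crossing $$W_j=-\mathrm{Li}_2(\tfrac{w_c}{w_b})-\mathrm{Li}_2(\tfrac{w_c}{w_d})+\mathrm{Li}_2(\tfrac{w_aw_c}{w_bw_d})+\mathrm{Li}_2(\tfrac{w_b}{w_a})+\mathrm{Li}_2(\tfrac{w_d}{w_a})-\tfrac{\pi^2}{6}+\log\tfrac{w_b}{w_a}\log\tfrac{w_d}{w_a},$$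 and for a negative crossing $W_j$ is the negative of this expression; $\mathrm{Li}_2(z)=-\int_0^z\frac{\log(1-t)}{t}dt$. The potential function of $D$ is $W=\sum_jW_j$ over all crossings; $W_0:=W-\sum_{k}\bigl(w_k\frac{\partial W}{\partial w_k}\bigr)\log w_k$, and $\mathcal{I}=\{\exp(w_k\frac{\partial W}{\partial w_k})=1\mid k=1,\dots,m\}$. $(W_j)_0$ is obtained from the potential function $W_j$ of $D_j$ ($j=1,2$) in the same way as $W_0$ from $W$. The representation $\rho_{\mathbf{w}}$. The five-term triangulation of $\mathbb{S}^3\setminus(K\cup\{\text{two points}\})$: put at each crossing an ideal octahedron with opposite vertex pairs $\{O,U\},\{P,P'\},\{S,S'\}$, where $O$ lies on the over-strand, $U$ on the under-strand. Let $q_1$ be the region at the crossing right of both strands, $q_2$ right of the over-strand and left of the under-strand, $q_3$ left of the over-strand and right of the under-strand, $q_4$ left of both. The edges $PS,PS',P'S,P'S'$ correspond to $q_1,q_2,q_3,q_4$. Edge $OP$ is identified with $OP'$, and $US$ with $US'$. The face spanned by $O$ (resp. $U$) and the edge corresponding to $q_i$ corresponds to the half-edge of the over- (resp. under-) strand at the crossing adjacent to $q_i$; for each edge $e$ of the diagram between consecutive crossings and each region on a side of $e$, the two corresponding faces at the two ends of $e$ are glued, matching the vertices of type $O/U$, of type $P/P'$ and of type $S/S'$. Each octahedron is divided into the tetrahedra $PP'SS',OPP'S,OPP'S',UPSS',UP'SS'$. With $\mathrm{cr}(A,B;C,D)=\frac{(A-C)(B-D)}{(A-D)(B-C)}$ and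 $w_{(i)}$ the variable of $q_i$, the shapes are given by $\mathrm{cr}(P,P';S,S')=\frac{w_{(1)}w_{(4)}}{w_{(2)}w_{(3)}}$, $\mathrm{cr}(P,P';S,O)=\frac{w_{(1)}}{w_{(3)}}$, $\mathrm{cr}(P,P';S',O)=\frac{w_{(2)}}{w_{(4)}}$, $\mathrm{cr}(S,S';P,U)=\frac{w_{(1)}}{w_{(2)}}$, $\mathrm{cr}(S,S';P',U)=\frac{w_{(3)}}{w_{(4)}}$. The set $\mathcal{I}$ is the set of hyperbolicity equations (edge gluing equations and completeness conditions) of this triangulation. For a solution $\mathbf{w}$ of $\mathcal{I}$, there is a developing map sending ideal vertices of the lifted triangulation of the universal cover to $\mathbb{CP}^1$ so that every tetrahedron has the prescribed cross-ratio; $\rho_{\mathbf{w}}:\pi_1(\mathbb{S}^3\setminus K)\to\mathrm{PSL}(2,\mathbb{C})$ is its holonomy representation, boundary-parabolic and well-defined up to conjugation. It is known that $\mathbf{w}^{(0)}$ given by $w_k^{(0)}=\det(p,s_k)$ is a solution of $\mathcal{I}$. Complex volume (Zickert's definition). For boundary-parabolic $\rho$, take an ordered ideal triangulation of $\mathbb{S}^3\setminus(K\cup F)$, $F$ finite (possibly empty), and a $\rho$-equivariant assignment of elements of $(\mathbb{C}^2\setminus\{0\})/\pm$ to the ideal vertices of the lifted triangulation such that $c_{ij}=\det(v_i,v_j)\neq0$ along every edge. Choose $\tilde c_{ij}=\frac12\log(c_{ij}^2)$ consistently for identified edges. For each tetrahedron, put $z=\frac{c_{03}c_{12}}{c_{02}c_{13}}$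 (representatives $v_i\in\mathbb{C}^2$ fixed for that tetrahedron), define $u,q\in\mathbb{Z}$ by $\tilde c_{03}+\tilde c_{12}-\tilde c_{02}-\tilde c_{13}=\log z+u\pi i$, $\tilde c_{02}+\tilde c_{13}-\tilde c_{01}-\tilde c_{23}=-\log(1-z)+q\pi i$, and let $L(z;u,q)=\mathrm{Li}_2(z)+\frac12\log z\log(1-z)+\frac{\pi i}{2}(q\log z+u\log(1-z))-\frac{\pi^2}{6}$. Then $i(\mathrm{vol}(\rho)+i\,\mathrm{cs}(\rho))\equiv\sum_T\varepsilon_TL(z_T;u_T,q_T)\pmod{\pi^2}$, $\varepsilon_T=\pm1$ according to whether the vertex ordering of $T$ agrees with the orientation; this is independent of choices. *)

(* Defs.v *)
From mathcomp Require Import all_boot all_order all_algebra.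
From mathcomp Require Import all_classical all_reals all_analysis.
From mathcomp Require Import complex.

Set Implicit Arguments.
Unset Strict Implicit.
Unset Printing Implicit Defensive.

Import Order.TTheory GRing.Theory Num.Theory numFieldNormedType.Exports.
Local Open Scope classical_set_scope.
Local Open Scope ring_scope.

(* R[i] with its structure of numClosedFieldType, from which its topology and
   complex differentiability ([derivable], [is_derive], ['D_1]) are inherited. *)
Definition Cplx (R : realType) : numClosedFieldType := R[i].

Section ComplexFunctions.
Variable R : realType.
Local Notation C := (Cplx R).
Implicit Types z : C.

Definition ofR (x : R) : C := Complex x 0.
Definition Ci : C := Complex 0 1.
Definition cRe z : R := complex.Re z.
Definition cIm z : R := complex.Im z.
Definition cmod z : R := Num.sqrt (cRe z ^+ 2 + cIm z ^+ 2).

Definition expC z : C :=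
  ofR (expR (cRe z)) * Complex (cos (cIm z)) (sin (cIm z)).

(* principal argument, in ]-pi, pi] *)
Definition arg z : R :=
  if 0 <= cIm z then acos (cRe z / cmod z) else - acos (cRe z / cmod z).

Definition logC z : C := Complex (ln (cmod z)) (arg z).

(* Li_2(z) = - \int_0^z log(1-t)/t dt along the segment [0, z], i.e.
   - \int_0^1 log(1 - tz)/t dt.  The integral is a Lebesgue integral, so that
   the formula is also meaningful on the branch cut z >= 1, where the integrand
   has an integrable singularity. *)
Definition Li2 z : C :=
  let f (t : R) : C := logC (1 - ofR t * z) / ofR t in
  - Complex (\int[@lebesgue_measure R]_(t in `[0%R, 1%R]) cRe (f t))
            (\int[@lebesgue_measure R]_(t in `[0%R, 1%R]) cIm (f t)).

Definition piC : C := ofR pi.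

Definition congr_pi2 (a b : C) : Prop := exists k : int, a - b = k%:~R * piC ^+ 2.

(* The potential function is multivalued, and the values at which it is
   evaluated may lie on the principal branch cuts, where the principal functions
   are not differentiable.  It is therefore considered as a germ built from
   arbitrary holomorphic branches of log and Li_2.  The branches of Li_2 over
   z <> 0, 1 are Li_2(z) + 2 pi i n log z + 4 pi^2 m, with derivative
   - (log(1 - z) - 2 pi i n) / z. *)
Definition log_branch (z0 : C) (f : C -> C) : Prop :=
  \forall z \near z0, expC (f z) = z /\ derivable f (z : C) 1.

Definition Li2_branch (z0 : C) (g : C -> C) : Prop :=
  z0 != 0 /\
  exists (f : C -> C) (n m : int),
    [/\ log_branch (1 - z0) f,
        f (1 - z0) = logC (1 - z0) - 2%:R * piC * Ci * n%:~R,
        g z0 = Li2 z0 + 2%:R * piC * Ci * n%:~R * logC z0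
               + 4%:R * piC ^+ 2 * m%:~R
      & \forall z \near z0, is_derive (z : C) 1 g (- f (1 - z) / z)].

End ComplexFunctions.

(* A diagram on the sphere, as a signed Gauss code.  A passage (x, o) is the
   passage of the knot through the crossing x along the over-strand (o = true)
   or the under-strand (o = false); [nxt] maps a passage to the following one.
   An edge, i.e. a piece of the diagram between two consecutive crossings, is
   identified with the passage it comes out of; it ends at the passage
   [nxt e]. *)
Record diagram := Diagram {
  crossing : finType;
  positive : crossing -> bool;
  nxt : crossing * bool -> crossing * bool }.

Definition edge (D : diagram) : finType := (crossing D * bool)%type.

(* The corner (x, ro, ru) is the part of a neighbourhood of the crossing x
   lying to the right (ro = true) or left (ro = false) of the over-strand and
   to the right (ru = true) or left (ru = false) of the under-strand: the
   regions q_1, q_2, q_3, q_4 at x are those of the corners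
   (true, true), (true, false), (false, true), (false, false). *)
Definition corner (D : diagram) : finType := (crossing D * bool * bool)%type.

Definition crn D (x : crossing D) (ro ru : bool) : corner D := (x, ro, ru).

(* The corner at x which is on the left (left = true) or right side of the
   outgoing (out = true) or incoming half-edge of the over- (o = true) or
   under-strand.  At a positive crossing the outgoing over-half-edge is to the
   right of the under-strand and the outgoing under-half-edge to the left of
   the over-strand; at a negative crossing it is the opposite. *)
Definition half_corner D (x : crossing D) (o out left : bool) : corner D :=
  if o then crn x (~~ left) (out == positive x)
  else crn x (out != positive x) (~~ left).

(* the corners on a given side of an edge, at its two ends *)
Definition tail_corner D (e : edge D) (left : bool) : corner D :=
  half_corner e.1 e.2 true left.
Definition head_corner D (e : edge D) (left : bool) : corner D :=
  half_corner (nxt e).1 (nxt e).2 false left.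

Definition corner_adj D : rel (corner D) := fun c c' =>
  [exists e : edge D, exists left : bool,
     (c == tail_corner e left) && (c' == head_corner e left)
  || (c' == tail_corner e left) && (c == head_corner e left)].

Lemma corner_adj_sym D : connect_sym (@corner_adj D).
Proof.
apply: sym_connect_sym => c c'; apply/existsP/existsP => -[e /existsP[l h]];
  exists e; apply/existsP; exists l; by rewrite orbC.
Qed.

(* The regions of D are the classes of corners connected along the edges; a
   class is represented by its canonical element. *)
Definition region (D : diagram) : finType :=
  {c : corner D | fingraph.roots (@corner_adj D) c}.

Definition reg D (c : corner D) : region D :=
  exist _ (fingraph.root (@corner_adj D) c) (roots_root (@corner_adj_sym D) c).

Definition left_region D (e : edge D) : region D := reg (tail_corner e true).
Definition right_region D (e : edge D) : region D := reg (tail_corner e false).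

(* At least one crossing, one component, and planarity: by Euler's formula a
   connected 4-valent graph with n vertices embeds in the sphere with the
   prescribed cyclic orders at the vertices iff it has n + 2 faces. *)
Definition knot_diagram (D : diagram) : Prop :=
  [/\ (0 < #|crossing D|)%N,
      forall e e' : edge D, fconnect (@nxt D) e e'
    & n_comp (@corner_adj D) predT = (#|crossing D| + 2)%N].

(* D1 # D2, obtained by cutting D1 along its edge e1 and D2 along its edge e2.
   The connecting arcs are the edges inl e1 and inr e2 of the result. *)
Section ConnectedSum.
Variables (D1 D2 : diagram) (e1 : edge D1) (e2 : edge D2).

Definition lpass (e : edge D1) : (crossing D1 + crossing D2) * bool :=
  (inl e.1, e.2).
Definition rpass (e : edge D2) : (crossing D1 + crossing D2) * bool :=
  (inr e.1, e.2).

Definition connected_sum : diagram :=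
  @Diagram (crossing D1 + crossing D2)%type
    (fun x => match x with inl x1 => positive x1 | inr x2 => positive x2 end)
    (fun p => match p.1 with
       | inl x1 => if (x1, p.2) == e1 then rpass (nxt e2)
                   else lpass (nxt (x1, p.2))
       | inr x2 => if (x2, p.2) == e2 then lpass (nxt e1)
                   else rpass (nxt (x2, p.2))
       end).

Definition ledge (e : edge D1) : edge connected_sum := lpass e.
Definition redge (e : edge D2) : edge connected_sum := rpass e.

(* the region of D1 # D2 which a region of D1, resp. D2, becomes *)
Definition lregion (r : region D1) : region connected_sum :=
  let: (x, ro, ru) := val r in reg (@crn connected_sum (inl x) ro ru).
Definition rregion (r : region D2) : region connected_sum :=
  let: (x, ro, ru) := val r in reg (@crn connected_sum (inr x) ro ru).

End ConnectedSum.

Section Representations.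
Variable R : realType.
Local Notation C := (Cplx R).
Local Notation M2 := 'M[C]_2.
Local Notation V2 := 'cV[C]_2.

(* equality in PSL(2,C), or in (C^2 \ 0)/+- *)
Definition pm_eq (U : zmodType) (u v : U) : Prop := u = v \/ u = - v.

(* A homomorphism from the knot group, given by the Wirtinger presentation, to
   PSL(2,C): to each edge is associated the image (a matrix up to sign) of the
   Wirtinger generator of the arc which contains it.  The arc goes on through
   over-passages; at an under-passage x the relation is
   alpha_{l'} = alpha_k alpha_l alpha_k^{-1}, alpha_k being the over-arc,
   alpha_l the under-arc on its right and alpha_{l'} the one on its left. *)
Definition representation (D : diagram) (rho : edge D -> M2) : Prop :=
  [/\ forall e, \det (rho e) = 1,
      forall e, (nxt e).2 -> pm_eq (rho (nxt e)) (rho e)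
    & forall e, ~~ (nxt e).2 ->
        let k := rho ((nxt e).1, true) in
        if positive (nxt e).1
        then pm_eq (rho (nxt e)) (k *m rho e *m invmx k)
        else pm_eq (rho e) (k *m rho (nxt e) *m invmx k)].

Definition parabolic (A : M2) : Prop := \tr A ^+ 2 = 4%:R /\ ~ pm_eq A 1%:M.

Definition boundary_parabolic (D : diagram) (rho : edge D -> M2) : Prop :=
  representation rho /\ forall e, parabolic (rho e).

Definition conjugate (D : diagram) (rho rho' : edge D -> M2) : Prop :=
  exists g : M2, \det g = 1 /\
    forall e, pm_eq (rho' e) (g *m rho e *m invmx g).

Definition is_connected_sum D1 D2 (e1 : edge D1) (e2 : edge D2)
    (rho1 : edge D1 -> M2) (rho2 : edge D2 -> M2)
    (rho : edge (connected_sum e1 e2) -> M2) : Prop :=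
  exists (rho1' : edge D1 -> M2) (rho2' : edge D2 -> M2),
    [/\ conjugate rho1 rho1', conjugate rho2 rho2',
        pm_eq (rho1' e1) (rho2' e2),
        forall e, pm_eq (rho (ledge e1 e2 e)) (rho1' e)
      & forall e, pm_eq (rho (redge e1 e2 e)) (rho2' e)].

(* the parabolic element corresponding to +- (alpha, beta)^T *)
Definition pmat (v : V2) : M2 :=
  let al := v 0 0 in let be := v 1 0 in
  \matrix_(i < 2, j < 2)
    if i == 0 then (if j == 0 then 1 + al * be else - al ^+ 2)
    else (if j == 0 then be ^+ 2 else 1 - al * be).

Definition star (v b : V2) : V2 := pmat b *m v.

(* CP^1 = C + {infinity}, with None for infinity *)
Definition hopf (v : V2) : option C :=
  if v 1 0 == 0 then None else Some (v 0 0 / v 1 0).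

Definition det2 (a b : V2) : C := \det (row_mx a b : M2).

Definition arc_coloring (D : diagram) (rho : edge D -> M2) (a : edge D -> V2) :
    Prop :=
  forall e, a e != 0 /\ pm_eq (rho e) (pmat (a e)).

Definition region_coloring (D : diagram) (a : edge D -> V2)
    (s : region D -> V2) : Prop :=
  (forall r, s r != 0) /\
  forall e, s (left_region e) = star (s (right_region e)) (a e).

Definition shadow_coloring (D : diagram) (rho : edge D -> M2)
    (a : edge D -> V2) (s : region D -> V2) : Prop :=
  [/\ arc_coloring rho a, region_coloring a s
    & forall e, uniq [:: hopf (a e); hopf (s (right_region e));
                         hopf (star (s (right_region e)) (a e))]].

Definition generic_vector (D : diagram) (a : edge D -> V2)
    (s : region D -> V2) (p : V2) : Prop :=
  [/\ p != 0, forall e, hopf p != hopf (a e) & forall r, hopf p != hopf (s r)].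

(* the branches used in the term of one crossing; the subscripts are the
   arguments, e.g. acbd stands for (w_a w_c) / (w_b w_d) *)
Record branches := Branches {
  li_cb : C -> C; li_cd : C -> C; li_acbd : C -> C;
  li_ba : C -> C; li_da : C -> C; log_ba : C -> C; log_da : C -> C }.

Definition branches_at (B : branches) (wa wb wc wd : C) : Prop :=
  [/\ [/\ Li2_branch (wc / wb) (li_cb B), Li2_branch (wc / wd) (li_cd B)
        & Li2_branch ((wa * wc) / (wb * wd)) (li_acbd B)],
      Li2_branch (wb / wa) (li_ba B), Li2_branch (wd / wa) (li_da B),
      log_branch (wb / wa) (log_ba B) & log_branch (wd / wa) (log_da B)].

Definition crossing_potential (pos : bool) (B : branches) (wa wb wc wd : C) :
    C :=
  (if pos then 1 else -1) *
  (- li_cb B (wc / wb) - li_cd B (wc / wd) + li_acbd B ((wa * wc) / (wb * wd))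
   + li_ba B (wb / wa) + li_da B (wd / wa) - piC R ^+ 2 / 6%:R
   + log_ba B (wb / wa) * log_da B (wd / wa)).

(* The corners between the two outgoing strands, to the left of both strands,
   between the two incoming strands, to the right of both strands. *)
Definition corner_a D (x : crossing D) := crn x (~~ positive x) (positive x).
Definition corner_b D (x : crossing D) := crn x false false.
Definition corner_c D (x : crossing D) := crn x (positive x) (~~ positive x).
Definition corner_d D (x : crossing D) := crn x true true.

(* W is a branch, near w, of the potential function of D *)
Definition potential (D : diagram) (w : region D -> C)
    (W : (region D -> C) -> C) : Prop :=
  exists B : crossing D -> branches,
    (forall x, branches_at (B x)
       (w (reg (corner_a x))) (w (reg (corner_b x)))
       (w (reg (corner_c x))) (w (reg (corner_d x)))) /\
    forall v, W v = \sum_(x : crossing D) crossing_potential (positive x) (B x)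
       (v (reg (corner_a x))) (v (reg (corner_b x)))
       (v (reg (corner_c x))) (v (reg (corner_d x))).

Definition wdiff (D : diagram) (W : (region D -> C) -> C) (w : region D -> C)
    (k : region D) : C :=
  w k * 'D_1 (fun t : C => W (fun r => if r == k then t else w r)) (w k).

(* The existence clause says that the potential function is defined at w, so that
   the second one is not vacuous; it does not depend on the branch W. *)
Definition solution (D : diagram) (w : region D -> C) : Prop :=
  (exists W, potential w W) /\
  forall W, potential w W -> forall k, expC (wdiff W w k) = 1.

(* W_0(w), with lw k the value of log w_k *)
Definition potential0 (D : diagram) (W : (region D -> C) -> C)
    (w lw : region D -> C) : C :=
  W w - \sum_(k : region D) wdiff W w k * lw k.

(* the vertices of the octahedron at a crossing: O = vK true, U = vK false,
   P = vP true, P' = vP false, S = vS true, S' = vS false; in this way the edge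
   corresponding to the corner (x, ro, ru) joins vP ro and vS ru *)
Definition octv : finType := (bool + (bool + bool))%type.
Definition vK (o : bool) : octv := inl o.
Definition vP (ro : bool) : octv := inr (inl ro).
Definition vS (ru : bool) : octv := inr (inr ru).

Definition tetrahedra : seq (seq octv) :=
  [:: [:: vP true; vP false; vS true; vS false];
      [:: vK true; vP true; vP false; vS true];
      [:: vK true; vP true; vP false; vS false];
      [:: vK false; vP true; vS true; vS false];
      [:: vK false; vP false; vS true; vS false]].

Definition tet_edge (nu mu : octv) : bool :=
  (nu != mu) && has (fun t => (nu \in t) && (mu \in t)) tetrahedra.

(* The gluing of the two faces corresponding to a side of the edge e, one in
   the octahedron at e.1 and the other in the octahedron at (nxt e).1, as the
   list of the pairs of identified vertices.  The identifications OP = OP' and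
   US = US' are consequences of these gluings, along the strand and around its
   next (resp. previous) passage of the other kind. *)
Definition face_gluing D (e : edge D) (left : bool) : seq (octv * octv) :=
  let: (_, ro, ru) := tail_corner e left in
  let: (_, ro', ru') := head_corner e left in
  [:: (vK e.2, vK (nxt e).2); (vP ro, vP ro'); (vS ru, vS ru')].

(* The lifted triangulation of the universal cover.  All the vertices P, P' lie
   above the projection plane, and are identified to one point, from which the
   Wirtinger loops start; let v be a lift of this point.  The faces which are
   incident to v form a copy of the set of all faces, since the link of this
   point is a sphere.  For each crossing x, with over-arc alpha_k, let Oct_x be
   the lift of the octahedron at x with P = v; then P' = alpha_k^{-1} v in
   Oct_x, and all the lifts are the translates of the Oct_x by the knot group.
   The faces at x incident to v thus belong to Oct_x when they contain P, and
   to alpha_k Oct_x when they contain P'.  Hence a pi_1-equivariant map is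
   given by its restrictions to the Oct_x; [chart] moves the values on the
   faces of Oct_x to those on the faces incident to v, which have to agree
   under the gluings. *)
Definition chart D (rho : edge D -> M2) (c : corner D) (u : V2) : V2 :=
  let: (x, ro, _) := c in if ro then u else rho (x, true) *m u.

Definition cross_ratio (a b c d : V2) : C :=
  (det2 a c * det2 b d) / (det2 a d * det2 b c).

(* [dev x nu] is a vector of homogeneous coordinates of the image in CP^1 of
   the vertex nu of Oct_x under a rho-equivariant developing map *)
Definition developing_map (D : diagram) (w : region D -> C)
    (rho : edge D -> M2) (dev : crossing D -> octv -> V2) : Prop :=
  [/\ forall x nu, dev x nu != 0,
      forall x nu mu, tet_edge nu mu -> hopf (dev x nu) != hopf (dev x mu),
      forall (e : edge D) (left : bool) nu nu',
        (nu, nu') \in face_gluing e left ->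
        hopf (chart rho (tail_corner e left) (dev e.1 nu)) =
        hopf (chart rho (head_corner e left) (dev (nxt e).1 nu'))
    & forall x,
        let w1 := w (reg (crn x true true)) in
        let w2 := w (reg (crn x true false)) in
        let w3 := w (reg (crn x false true)) in
        let w4 := w (reg (crn x false false)) in
        let O := dev x (vK true) in let U := dev x (vK false) in
        let P := dev x (vP true) in let P' := dev x (vP false) in
        let S := dev x (vS true) in let S' := dev x (vS false) in
        [/\ cross_ratio P P' S S' = (w1 * w4) / (w2 * w3),
            cross_ratio P P' S O = w1 / w3,
            cross_ratio P P' S' O = w2 / w4,
            cross_ratio S S' P U = w1 / w2
          & cross_ratio S S' P' U = w3 / w4]].

(* rho is the representation rho_w, which is defined up to conjugation *)
Definition holonomy (D : diagram) (w : region D -> C) (rho : edge D -> M2) :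
    Prop :=
  representation rho /\ exists dev, developing_map w rho dev.

(* Positions of the vertices of the octahedron at a crossing in oriented
   3-space, the over-strand going in the direction of the second axis, so that
   P is at its right, and the under-strand in the opposite direction to the
   first axis if the crossing is positive, in its direction otherwise.  The
   vertices P, P' are pulled up and S, S' are pulled down. *)
Definition position (pos : bool) (nu : octv) : int * int * int :=
  let sg (b : bool) : int := if b then 1 else -1 in
  match nu with
  | inl o => (0, 0, 2%:Z * sg o)
  | inr (inl ro) => (sg ro, 0, 1)
  | inr (inr ru) => (0, sg pos * sg ru, -1)
  end.

Definition orientation (pos : bool) (t : seq octv) : int :=
  let q i := position pos (nth (vK true) t i) in
  let X i := (q i).1.1 - (q 0%N).1.1 in
  let Y i := (q i).1.2 - (q 0%N).1.2 in
  let Z i := (q i).2 - (q 0%N).2 in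
  sgz (X 1%N * (Y 2%N * Z 3%N - Y 3%N * Z 2%N)
       - Y 1%N * (X 2%N * Z 3%N - X 3%N * Z 2%N)
       + Z 1%N * (X 2%N * Y 3%N - X 3%N * Y 2%N)).

Definition extended_rogers (z : C) (u q : int) : C :=
  Li2 z + logC z * logC (1 - z) / 2%:R
  + piC R * Ci R / 2%:R * (q%:~R * logC z + u%:~R * logC (1 - z))
  - piC R ^+ 2 / 6%:R.

(* The choices in Zickert's formula, for the five-term triangulation: an
   ordering of the vertices of each tetrahedron compatible with the gluings,
   given by an orientation zlt of the edges, the vertices of t sorted
   accordingly being zord x t; representatives zvec of the elements of
   (C^2 \ 0)/+- assigned equivariantly to the lifted vertices; logarithms zlog
   of the edge parameters. *)
Record zickert_data (D : diagram) (rho : edge D -> M2) := ZickertData {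
  zlt : crossing D -> rel octv;
  zord : crossing D -> seq octv -> seq octv;
  zvec : crossing D -> octv -> V2;
  zlog : crossing D -> octv -> octv -> C;
  zu : crossing D -> seq octv -> int;
  zq : crossing D -> seq octv -> int;
  zlt_asym : forall x nu mu, zlt x nu mu -> ~~ zlt x mu nu;
  zlt_glue : forall (e : edge D) left nu nu' mu mu',
    (nu, nu') \in face_gluing e left -> (mu, mu') \in face_gluing e left ->
    zlt e.1 nu mu = zlt (nxt e).1 nu' mu';
  zord_sorted : forall x t, t \in tetrahedra ->
    perm_eq (zord x t) t && pairwise (zlt x) (zord x t);
  zvec_neq0 : forall x nu, zvec x nu != 0;
  zvec_glue : forall (e : edge D) left nu nu',
    (nu, nu') \in face_gluing e left ->
    pm_eq (chart rho (tail_corner e left) (zvec e.1 nu))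
          (chart rho (head_corner e left) (zvec (nxt e).1 nu'));
  zvec_edge : forall x nu mu, tet_edge nu mu ->
    det2 (zvec x nu) (zvec x mu) != 0;
  zlogE : forall x nu mu, tet_edge nu mu ->
    expC (2%:R * zlog x nu mu) = det2 (zvec x nu) (zvec x mu) ^+ 2;
  zlog_sym : forall x nu mu, zlog x nu mu = zlog x mu nu;
  zlog_glue : forall (e : edge D) left nu nu' mu mu',
    (nu, nu') \in face_gluing e left -> (mu, mu') \in face_gluing e left ->
    nu != mu -> zlog e.1 nu mu = zlog (nxt e).1 nu' mu';
  zshape := fun x t =>
    let c i j := det2 (zvec x (nth (vK true) (zord x t) i))
                      (zvec x (nth (vK true) (zord x t) j)) in
    (c 0%N 3%N * c 1%N 2%N) / (c 0%N 2%N * c 1%N 3%N);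
  zuE : forall x t, t \in tetrahedra ->
    let l i j := zlog x (nth (vK true) (zord x t) i)
                        (nth (vK true) (zord x t) j) in
    l 0%N 3%N + l 1%N 2%N - l 0%N 2%N - l 1%N 3%N
    = logC (zshape x t) + (zu x t)%:~R * piC R * Ci R;
  zqE : forall x t, t \in tetrahedra ->
    let l i j := zlog x (nth (vK true) (zord x t) i)
                        (nth (vK true) (zord x t) j) in
    l 0%N 2%N + l 1%N 3%N - l 0%N 1%N - l 2%N 3%N
    = - logC (1 - zshape x t) + (zq x t)%:~R * piC R * Ci R }.

Definition zickert_sum (D : diagram) (rho : edge D -> M2)
    (Z : zickert_data rho) : C :=
  \sum_(x : crossing D) \sum_(t <- tetrahedra)
    (orientation (positive x) (zord Z x t))%:~R
    * extended_rogers (zshape Z x t) (zu Z x t) (zq Z x t).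

(* i (vol + i cs), modulo pi^2 *)
Definition complex_volume (vol cs : R) : C := Ci R * (ofR vol + Ci R * ofR cs).

(* vol and cs are the volume and the Chern-Simons invariant of rho: by
   Zickert's theorem, the class of the sum modulo pi^2 is independent of the
   choices. *)
Definition is_vol_cs (D : diagram) (rho : edge D -> M2) (vol cs : R) : Prop :=
  exists Z : zickert_data rho,
    congr_pi2 (complex_volume vol cs) (zickert_sum Z).

End Representations.

(* Main.v *)
(* The shadow-coloring contains a developing map of the octahedral triangulation.
   At a crossing with over-color a_k and under-color a_l send O to a_k, U to a_l,
   P to p, P' to a_k^{-1} p, and S, S' to region colors. The images under h have the
   cross-ratios prescribed by w_k = det(p, s_k), and the vectors themselves are
   Zickert's equivariant assignment.

   The product exp(w_k dW/dw_k) has one factor for each end of each edge on the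
   boundary of the region k, and the two factors of an edge are inverse to each
   other, being powers of det(p, a) / det(a, s). In Zickert's sum the dilogarithms
   are those of W_0, and what is left of the difference is, modulo pi^2, half of a
   coboundary along the knot.

   This holds for every shadow-colored diagram, so it suffices to restrict the
   coloring of D_1 # D_2 to D_j. Closing up D_j joins the two ends of each side of
   its cut edge. These belong to the same region of D_1 # D_2 already: otherwise one
   region would lie on both sides of a connecting arc, giving s = s * a against
   h(s) <> h(s * a). *)

Require Import Defs.
From mathcomp Require Import all_boot all_order all_algebra.
From mathcomp Require Import all_classical all_reals all_analysis.
From mathcomp Require Import complex ring lra.

Set Implicit Arguments.
Unset Strict Implicit.
Unset Printing Implicit Defensive.

Import Order.TTheory GRing.Theory Num.Theory numFieldNormedType.Exports.
Local Open Scope ring_scope.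

(** * Complex numbers, exponential and logarithm *)

(** The potential is quantified over all local branches, so no value may depend on a choice of
    branch. Of a dilogarithm only its value and its derivative, a logarithm of 1 - z, enter, and
    these change together: for a fixed logarithm Z of z, the class of Li_2(z) + log(1 - z) Z modulo
    pi^2 is the same for all branches, because a product of two periods 2 pi i k is a multiple of 4
    pi^2. Branches must also be shown to exist, and since the arguments may lie on the principal
    cuts, they are built from power series.

    The match between W_0 and Zickert's sum rests on the freedom in the choice of the edge
    logarithms. The edges between P, P' and S, S' carry log w_k itself, not half the logarithm of a
    square. In every tetrahedron the combination of edge logarithms attached to z is then the
    difference of the log w_k that also occurs in W_0, and it exponentiates to z exactly, which
    makes u even. Half the product of the two logarithmic combinations of each tetrahedron supplies
    the product of logarithms in W_j and the coboundary. *)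

Section ComplexNumbers.
Variable R : realType.
Local Notation C := (Cplx R).

Lemma mulCE (a b c d : R) :
  (Complex a b : C) * (Complex c d : C) = Complex (a * c - b * d) (a * d + b * c).
Proof. by []. Qed.

Lemma addCE (a b c d : R) :
  (Complex a b : C) + (Complex c d : C) = Complex (a + c) (b + d).
Proof. by []. Qed.

Lemma cReD (z1 z2 : C) : cRe (z1 + z2) = cRe z1 + cRe z2.
Proof. by case: z1 z2 => [? ?] [? ?]. Qed.

Lemma cImD (z1 z2 : C) : cIm (z1 + z2) = cIm z1 + cIm z2.
Proof. by case: z1 z2 => [? ?] [? ?]. Qed.

Lemma expCE (x y : R) : expC (Complex x y) = Complex (expR x * cos y) (expR x * sin y).
Proof. by rewrite /expC /ofR mulCE /= !mul0r subr0 addr0. Qed.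

Lemma expCD (z1 z2 : C) : expC (z1 + z2) = expC z1 * expC z2.
Proof.
case: z1 z2 => [x y] [x' y']; rewrite addCE !expCE mulCE expRD cosD sinD.
by congr Complex; ring.
Qed.

Lemma expC0 : expC (0 : C) = 1.
Proof. by rewrite -[0 : C]/(Complex (0 : R) 0 : C) expCE expR0 cos0 sin0 mulr1 mulr0. Qed.

Lemma expC_neq0 (z : C) : expC z != 0.
Proof.
apply/eqP => h; have := expCD z (- z).
by rewrite subrr expC0 h mul0r => /eqP; rewrite oner_eq0.
Qed.

Lemma expCN (z : C) : expC (- z) = (expC z)^-1.
Proof.
by apply: (mulfI (expC_neq0 z)); rewrite -expCD subrr expC0 mulfV // expC_neq0.
Qed.

Lemma expCB (z1 z2 : C) : expC (z1 - z2) = expC z1 / expC z2.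
Proof. by rewrite expCD expCN. Qed.

Lemma expC_sum (I : Type) (r : seq I) (P : pred I) (F : I -> C) :
  expC (\sum_(i <- r | P i) F i) = \prod_(i <- r | P i) expC (F i).
Proof. exact: (big_morph (@expC R) expCD expC0). Qed.

(** Subtracting the multiple of 2 pi given by the floor brings y into [0, 2 pi[. Cosine is injective
    on [0, pi], and an argument u beyond pi is reflected to 2 pi - u. *)
Lemma cos_eq1 (y : R) : cos y = 1 -> exists k : int, y = pi *+ 2 * k%:~R.
Proof.
move=> cy; pose T : R := pi *+ 2.
have T0 : 0 < T by rewrite /T mulrn_wgt0 // pi_gt0.
pose k := Num.floor (y / T); exists k; rewrite -/T.
have per (n : nat) (x : R) : cos (x + T * n%:R) = cos x.
  by rewrite mulr_natr; apply: periodicn; exact: cosD2pi.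
have perz (m : int) (x : R) : cos (x + T * m%:~R) = cos x.
  case: m => n; first exact: per.
  by rewrite -(per n.+1 (x + _)) NegzE rmorphN /= mulrN subrK.
have := cy; rewrite -(perz (- k)) rmorphN mulrN.
set u := y - _ => cu.
have hu0 : 0 <= u.
  by rewrite subr_ge0 mulrC -ler_pdivlMr // floor_le.
have hu1 : u < T.
  have := floorD1_gt (y / T); rewrite -/k ltr_pdivrMr // rmorphD /= => h.
  by rewrite /u; lra.
suff u0 : u = 0 by apply/eqP; rewrite -subr_eq0 -/u u0.
case: (lerP u pi) => hu.
  by apply: cos_inj; rewrite ?in_itv /= ?hu0 ?lexx ?pi_ge0 ?cu ?cos0.
have : T - u = 0.
  apply: cos_inj; rewrite ?in_itv /= ?lexx ?pi_ge0 //.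
    rewrite subr_ge0 (ltW hu1) /= /T mulr2n; lra.
  rewrite cos0 -cu -[RHS]cosN.
  by rewrite -[RHS](perz 1) /= mulr1 addrC.
move/eqP; rewrite subr_eq0 => /eqP h; by rewrite h ltxx in hu1.
Qed.

Lemma expC_eq1 (z : C) : expC z = 1 -> exists k : int, z = 2%:R * piC R * Ci R * k%:~R.
Proof.
case: z => x y; rewrite expCE => -[h1 h2].
have sy : sin y = 0 by move/eqP: h2; rewrite mulf_eq0 expR_eq0 /= => /eqP.
have cy1 : `|cos y| = 1 by apply/eqP; rewrite norm_cos_eq1 sy.
have cy : cos y = 1.
  have := expR_gt0 x; move: h1 cy1; case: (ger0P (cos y)) => // h3 h4 _ h5.
  by move: h3; rewrite -(pmulr_rlt0 _ h5) h4 ltr10.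
move: h1; rewrite cy mulr1 -expR0 => /expR_inj ->.
have [k ->] := cos_eq1 cy; exists k.
have -> : (k%:~R : C) = Complex (k%:~R) 0.
  by rewrite -[RHS]/((k%:~R : R)%:C)%C rmorph_int.
rewrite (_ : 2%:R = Complex 2%:R 0); last first.
  by rewrite -[RHS]/((2%:R : R)%:C)%C rmorph_nat.
by rewrite /piC /ofR /Ci !mulCE /=; congr Complex; ring.
Qed.

Lemma expC_inj (z1 z2 : C) : expC z1 = expC z2 ->
  exists k : int, z1 = z2 + 2%:R * piC R * Ci R * k%:~R.
Proof.
move=> h; have [|k hk] := @expC_eq1 (z1 - z2).
  by rewrite expCB h divff // expC_neq0.
by exists k; rewrite -hk addrC subrK.
Qed.

Lemma cmod_gt0 (z : C) : z != 0 -> 0 < cmod z.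
Proof.
case: z => x y /negP h; rewrite /cmod /= sqrtr_gt0 lt0r addr_ge0 ?sqr_ge0 // andbT.
rewrite paddr_eq0 ?sqr_ge0 // !sqrf_eq0; apply/negP => /andP[/eqP a /eqP b].
by apply: h; rewrite a b.
Qed.

Lemma expC_logC (z : C) : z != 0 -> expC (logC z) = z.
Proof.
move=> z0; have m0 := cmod_gt0 z0.
rewrite /logC expCE lnK ?posrE // /arg.
have mm : cmod z ^+ 2 = cRe z ^+ 2 + cIm z ^+ 2.
  by rewrite sqr_sqrtr // addr_ge0 ?sqr_ge0.
set q := cRe z / cmod z.
have q1 : 1 - q ^+ 2 = (cIm z / cmod z) ^+ 2.
  by rewrite /q !expr_div_n mm; field; rewrite -mm sqrf_eq0 gt_eqF.
have hq : -1 <= q <= 1.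
  rewrite -ler_norml -(@ler_pXn2r _ 2) ?nnegrE // expr1n real_normK ?num_real //.
  by rewrite -subr_ge0 q1 sqr_ge0.
have ca : cos (acos q) = q by rewrite acosK // in_itv.
have sa : sin (acos q) = `|cIm z| / cmod z.
  by rewrite sin_acos // q1 sqrtr_sqr normrM normfV (gtr0_norm m0).
rewrite [RHS](_ : z = Complex (cRe z) (cIm z)); last by case: (z).
have kk (t : R) : cmod z * (t / cmod z) = t by field; rewrite gt_eqF.
case: ifPn => h; first by rewrite ca sa ger0_norm // !kk.
by rewrite cosN sinN ca sa ltr0_norm ?ltNge // mulNr opprK !kk.
Qed.

End ComplexNumbers.

(** * Derivatives as linear approximations *)

Section DerivativeEstimates.
Variable K : numFieldType.
Local Open Scope classical_set_scope.
Local Open Scope ring_scope.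

(** The form without quotient frees the later estimates from the division by h and the exclusion of
    h = 0. *)
Lemma is_derive_nearP (f : K -> K) (z d : K) :
  (forall e, 0 < e -> \forall h \near (0 : K), `|f (z + h) - f z - h * d| <= e * `|h|)
  <-> is_derive z 1 f d.
Proof.
have key (h : K) : h != 0 -> `|d - h^-1 *: ((f \o shift z) (h *: 1) - f z)| * `|h| =
    `|f (z + h) - f z - h * d|.
  move=> h0; rewrite -normrM -[RHS]normrN /= [h%:A]mulr1 [h + z]addrC; congr `|_|.
  by rewrite -[_ *: _]/(_ * _); field.
split=> H.
  have cv : (h^-1 *: ((f \o shift z) (h *: 1) - f z)) @[h --> (0:K)^'] --> d.
    apply/cvgrPdist_le => e e0; near=> h.
    have h0 : h != 0 by near: h; exact: nbhs_dnbhs_neq.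
    rewrite -(@ler_pM2r _ `|h|) ?normr_gt0 // key //.
    by near: h; apply: nbhs_dnbhs; exact: H.
  apply: DeriveDef; [apply/cvg_ex; exists d; exact: cv | exact: (cvg_lim (@norm_hausdorff _ _) cv)].
case: H => /cvg_ex[l cv] dl.
have ld : l = d by rewrite -dl; apply/esym/(cvg_lim (@norm_hausdorff _ _) cv).
move: cv; rewrite ld => /cvgrPdist_le H e e0.
have := H e e0; rewrite !near_withinE => {}H; near=> h.
have [->|h0] := eqVneq h 0; first by rewrite addr0 subrr mul0r subr0 normr0 mulr0.
rewrite -key // ler_pM2r ?normr_gt0 //.
by move: h0; near: h; exact: H.
Unshelve. all: by end_near. Qed.

Lemma is_derive1_compK (f g : K -> K) (x a b : K) :
  is_derive (g x) 1 f a -> is_derive x 1 g b -> is_derive x 1 (f \o g) (a * b).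
Proof.
move=> [fg <-{a}] [gx <-{b}].
have dg : differentiable g x by apply/derivable1_diffP.
have df : differentiable f (g x) by apply/derivable1_diffP.
apply: DeriveDef; first exact/derivable1_diffP/differentiable_comp.
rewrite deriveE; last exact: differentiable_comp.
rewrite diff_comp //= (deriveE _ df) (deriveE _ dg).
by rewrite -[X in 'd f (g x) X]mulr1 -[X in 'd f (g x) X]/(_ *: _) linearZ mulrC.
Qed.

End DerivativeEstimates.

Section ComplexModulus.
Variable R : realType.
Local Notation C := (Cplx R).
Implicit Types z : C.

Lemma normCE z : `|z| = ofR (cmod z).
Proof. by rewrite normc_def. Qed.

Lemma ler_ofR (x y : R) : (ofR x <= ofR y) = (x <= y).
Proof. exact: lecR. Qed.

Lemma ltr_ofR (x y : R) : (ofR x < ofR y) = (x < y).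
Proof. exact: ltcR. Qed.

Lemma ofRM (x y : R) : ofR (x * y) = ofR x * ofR y.
Proof. by rewrite /ofR mulCE; congr Complex; ring. Qed.

Lemma ofRD (x y : R) : ofR (x + y) = ofR x + ofR y.
Proof. by rewrite /ofR addCE addr0. Qed.

Lemma gt0_ofR (e : C) : 0 < e -> e = ofR (cRe e) /\ 0 < cRe e.
Proof. by case: e => x y; rewrite ltcE /= => /andP[/eqP -> ?]. Qed.

Lemma cmod_ge0 z : 0 <= cmod z.
Proof. exact: sqrtr_ge0. Qed.

Lemma cmodM z1 z2 : cmod (z1 * z2) = cmod z1 * cmod z2.
Proof.
by have := normrM z1 z2; rewrite !normCE -ofRM => -[].
Qed.

Lemma cmodD z1 z2 : cmod (z1 + z2) <= cmod z1 + cmod z2.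
Proof. by have := ler_normD z1 z2; rewrite !normCE -ofRD ler_ofR. Qed.

Lemma cmodN z : cmod (- z) = cmod z.
Proof. by have := normrN z; rewrite !normCE => -[]. Qed.

Lemma cmodB z1 z2 : cmod (z1 - z2) <= cmod z1 + cmod z2.
Proof. by rewrite -(cmodN z2) cmodD. Qed.

Lemma cmod0 : cmod (0 : C) = 0.
Proof. by have := normr0 C; rewrite normCE => -[]. Qed.

Lemma cmod1 : cmod (1 : C) = 1.
Proof. by have := normr1 C; rewrite normCE => -[]. Qed.

Lemma cmod_ofR (x : R) : cmod (ofR x) = `|x|.
Proof. by rewrite /cmod /ofR /= expr0n addr0 sqrtr_sqr. Qed.

Lemma cmodX z n : cmod (z ^+ n) = cmod z ^+ n.
Proof. by elim: n => [|n IH]; rewrite ?cmod1 // !exprS cmodM IH. Qed.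

Lemma cmod_eq0 z : (cmod z == 0) = (z == 0).
Proof.
apply/eqP/eqP => [h|->]; last exact: cmod0.
by apply/eqP; rewrite -normr_eq0 normCE h.
Qed.

Lemma cmodV z : cmod z^-1 = (cmod z)^-1.
Proof.
have [->|z0] := eqVneq z 0; first by rewrite invr0 cmod0 invr0.
have m0 : cmod z != 0 by rewrite cmod_eq0.
by apply: (mulfI m0); rewrite -cmodM !mulfV // cmod1.
Qed.

Lemma cmod_nat n : cmod (n%:R : C) = n%:R.
Proof. by have := @normr_nat C n; rewrite normCE => /(congr1 (@cRe R)) /= ->; rewrite -(rmorph_nat (real_complex R)). Qed.

Lemma normRe z : `|cRe z| <= cmod z.
Proof. by rewrite -sqrtr_sqr ler_wsqrtr // lerDl sqr_ge0. Qed.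

Lemma normIm z : `|cIm z| <= cmod z.
Proof. by rewrite -sqrtr_sqr ler_wsqrtr // lerDr sqr_ge0. Qed.

Lemma cmod_le z : cmod z <= `|cRe z| + `|cIm z|.
Proof.
rewrite -[leRHS]ger0_norm ?addr_ge0 // -sqrtr_sqr ler_wsqrtr //.
rewrite sqrrD !real_normK ?num_real // -addrA lerD2l lerDr.
by rewrite mulrn_wge0 // mulr_ge0.
Qed.

Lemma nearCP (P : C -> Prop) (z : C) :
  (\forall x \near z, P x) <->
  exists2 d : R, 0 < d & forall h, cmod h < d -> P (z + h).
Proof.
split.
  move/nbhs_ballP => [e /= e0 H]; have [ee e1] := gt0_ofR e0.
  exists (cRe e) => // h hd; apply: H.
  by rewrite /ball /= opprD addNKr normrN normCE ee ltr_ofR.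
move=> [d d0 H]; apply/nbhs_ballP; exists (ofR d); first by rewrite /= ltr_ofR.
move=> x; rewrite /ball /= distrC normCE ltr_ofR => /H.
by rewrite addrC subrK.
Qed.

Lemma is_derive_cmodP (f : C -> C) (z d : C) :
  (forall e : R, 0 < e -> exists2 dl : R, 0 < dl &
     forall h, cmod h < dl -> cmod (f (z + h) - f z - h * d) <= e * cmod h)
  <-> is_derive z (1 : C) f d.
Proof.
split=> [H|/is_derive_nearP H e e0].
  apply/is_derive_nearP => e /gt0_ofR[-> /H[dl dl0 {}H]].
  apply/nearCP; exists dl => // h; rewrite add0r => /H.
  by rewrite !normCE -ofRM ler_ofR.
have /H /nearCP[dl dl0 {}H] : (0 : C) < ofR e by rewrite ltr_ofR.
by exists dl => // h /H; rewrite add0r !normCE -ofRM ler_ofR.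
Qed.

Lemma is_derive_quad (f : C -> C) (z d : C) (K r : R) : 0 < r ->
  (forall h, cmod h < r -> cmod (f (z + h) - f z - h * d) <= K * cmod h ^+ 2) ->
  is_derive z (1 : C) f d.
Proof.
move=> r0 H; apply/is_derive_cmodP => e e0.
have K0 : 0 < `|K| + 1 by rewrite ltr_pwDr.
exists (Num.min r (e / (`|K| + 1))); first by rewrite lt_min r0 divr_gt0.
move=> h; rewrite lt_min => /andP[/H h1 h2]; apply: (le_trans h1).
rewrite expr2 mulrA ler_wpM2r ?cmod_ge0 //.
apply: (@le_trans _ _ ((`|K| + 1) * cmod h)).
  by rewrite ler_wpM2r ?cmod_ge0 // (le_trans (ler_norm _)) // lerDl ler01.
by rewrite mulrC -ler_pdivlMr // ltW.
Qed.

Lemma is_derive_realP (f : R -> R) (x d : R) :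
  (forall e : R, 0 < e -> exists2 dl : R, 0 < dl &
     forall h, `|h| < dl -> `|f (x + h) - f x - h * d| <= e * `|h|)
  <-> is_derive x (1 : R) f d.
Proof.
split=> [H|/is_derive_nearP H e e0].
  apply/is_derive_nearP => e /H[dl dl0 {}H].
  apply/nbhs_ballP; exists dl => // h; rewrite /ball /= sub0r normrN; exact: H.
have /nbhs_ballP[dl dl0 {}H] := H _ e0.
by exists dl => // h hd; apply: H; rewrite /ball /= sub0r normrN.
Qed.

Lemma is_derive_expC z : is_derive z (1 : C) (@expC R) (expC z).
Proof.
suff H0 : is_derive (0 : C) (1 : C) (@expC R) 1.
  apply/is_derive_cmodP => e e0; have m0 := cmod_gt0 (expC_neq0 z).
  have /is_derive_cmodP/(_ (e / cmod (expC z))) := H0.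
  rewrite divr_gt0 // => /(_ isT)[dl dl0 H]; exists dl => // h /H.
  rewrite add0r expC0 expCD mulr1 => {}H.
  rewrite (_ : _ - _ - _ = expC z * (expC h - 1 - h)); last by ring.
  by rewrite cmodM mulrC -ler_pdivlMr // mulrAC.
apply/is_derive_cmodP => e e0.
(* The real part of the remainder is at most 3 k m with m = |h|, hence e / 8; the bound 1 / 8 turns
   k m + m into at most 9/8 m in the imaginary part. *)
pose k := Num.min (e / 8) (1 / 8).
have e8 : 0 < k by rewrite lt_min; apply/andP; split; lra.
have [k1 k2] : k <= e / 8 /\ k <= 1 / 8 by rewrite !ge_min !lexx orbT.
have /is_derive_realP/(_ _ e8)[d1 d10 H1] := is_derive_expR (0 : R).
have /is_derive_realP/(_ _ e8)[d2 d20 H2] := is_derive_sin (0 : R).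
have /is_derive_realP/(_ _ e8)[d3 d30 H3] := is_derive_cos (0 : R).
(* The bound 1 gives |1 + x| <= 2, and e / 16 absorbs the quadratic term (k m + m)^2. *)
pose dl := Num.min (Num.min d1 d2) (Num.min d3 (Num.min 1 (e / 16))).
exists dl; first by rewrite /dl !lt_min d10 d20 d30 ltr01 /=; lra.
case=> x y; rewrite /dl !lt_min => /andP[/andP[h1 h2] /and3P[h3 h4 h5]].
set h : C := Complex x y.
have hx : `|x| <= cmod h := normRe h.
have hy : `|y| <= cmod h := normIm h.
have {H1} := H1 x (le_lt_trans hx h1); rewrite add0r expR0 mulr1 => H1.
have {H2} := H2 y (le_lt_trans hy h2); rewrite add0r sin0 cos0 mulr1 subr0 => H2.
have {H3} := H3 y (le_lt_trans hy h3); rewrite add0r sin0 cos0 oppr0 mulr0 subr0 => H3.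
rewrite add0r expC0 mulr1 expCE.
apply: (le_trans (cmod_le _)).
rewrite -[cRe _]/(expR x * cos y - 1 - x) -[cIm _]/(expR x * sin y - 0 - y).
have := cmod_ge0 h; move: (cmod h) hx hy h4 h5 => m hx hy h4 h5 m0.
have c1 := cos_max y; have s1 := sin_max y.
have A : `|expR x * cos y - 1 - x| <= e * m / 2.
  rewrite (_ : _ - x = (expR x - 1 - x) * cos y + (1 + x) * (cos y - 1)); last by ring.
  apply: (le_trans (ler_normD _ _)); rewrite !normrM.
  have a1 : `|expR x - 1 - x| * `|cos y| <= k * m.
    rewrite -[leRHS]mulr1; apply: ler_pM => //; apply: (le_trans H1).
    by rewrite ler_pM2l // ?divr_gt0.
  have a2 : `|1 + x| * `|cos y - 1| <= 2 * (k * m).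
    apply: ler_pM => //; last by apply: (le_trans H3); rewrite ler_pM2l // ?divr_gt0.
    by apply: (le_trans (ler_normD _ _)); rewrite normr1; lra.
  have a8 : k * m <= e / 8 * m by rewrite ler_wpM2r.
  nra.
have B : `|expR x * sin y - 0 - y| <= e * m / 2.
  rewrite (_ : _ - y = (expR x - 1) * sin y + (sin y - y)); last by ring.
  apply: (le_trans (ler_normD _ _)); rewrite normrM.
  have a1 : `|sin y - y| <= k * m by apply: (le_trans H2); rewrite ler_pM2l // ?divr_gt0.
  have a2 : `|expR x - 1| <= k * m + m.
    rewrite (_ : expR x - 1 = (expR x - 1 - x) + x); last by ring.
    apply: (le_trans (ler_normD _ _)); apply: lerD => //.
    by apply: (le_trans H1); rewrite ler_pM2l // ?divr_gt0.
  have a3 : `|sin y| <= k * m + m.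
    rewrite (_ : sin y = (sin y - y) + y); last by ring.
    by apply: (le_trans (ler_normD _ _)); apply: lerD.
  have a5 : `|expR x - 1| * `|sin y| <= (k * m + m) * (k * m + m).
    by apply: ler_pM.
  have a6 : (k * m + m) * (k * m + m) <= 9 / 8 * m * (9 / 8 * m).
    by apply: ler_pM; nra.
  have a7 : m * m <= e / 16 * m by rewrite ler_wpM2r // ltW.
  have a8 : k * m <= e / 8 * m by rewrite ler_wpM2r.
  nra.
nra.
Qed.

End ComplexModulus.

(** * Power series *)

Section PowerSeries.
Variable R : realType.
Local Notation C := (Cplx R).
Implicit Types (c : nat -> C) (z h : C).
Local Open Scope classical_set_scope.
Local Open Scope ring_scope.

Definition rsum (u : nat -> R) : R := limn (series u).
Definition csum c : C :=
  Complex (rsum (fun k => cRe (c k))) (rsum (fun k => cIm (c k))).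

(** Domination by a fixed geometric series is the convergence criterion for all series below. With
    ratio 1/2 the constant A also bounds the sum, by 2 A. *)
Definition rgeo (A : R) (u : nat -> R) := forall k, `|u k| <= A * (1 / 2) ^+ k.
Definition cgeo (A : R) c := forall k, cmod (c k) <= A * (1 / 2) ^+ k.

Lemma half_lt1 : `|1 / 2 : R| < 1.
Proof. by rewrite ger0_norm; lra. Qed.

Lemma rgeo_cvg A u : rgeo A u -> cvgn [normed series u].
Proof.
move=> H; have A0 : 0 <= A by have := H 0%N; rewrite expr0 mulr1; apply: le_trans.
apply: (@series_le_cvg _ _ (geometric A (1 / 2))) => //.
- by move=> n; exact: normr_ge0.
- by move=> n; apply: mulr_ge0 => //; apply: exprn_ge0; lra.
- exact: is_cvg_geometric_series half_lt1.
Qed.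

Lemma rgeo_cvgs A u : rgeo A u -> cvgn (series u).
Proof. by move=> /rgeo_cvg; exact: normed_cvg. Qed.

Lemma rsum_le A u : rgeo A u -> `|rsum u| <= 2 * A.
Proof.
move=> H; have cn := rgeo_cvg H; apply: (le_trans (lim_series_norm cn)).
have := lim_series_le cn (@is_cvg_geometric_series _ A _ half_lt1) H.
move/le_trans; apply; rewrite (cvg_lim (@Rhausdorff R) (@cvg_geometric_series _ A _ half_lt1)).
by rewrite le_eqVlt; apply/orP; left; apply/eqP; field.
Qed.

Lemma cgeo_Re A c : cgeo A c -> rgeo A (fun k => cRe (c k)).
Proof. by move=> H k; apply: (le_trans (normRe _)). Qed.

Lemma cgeo_Im A c : cgeo A c -> rgeo A (fun k => cIm (c k)).
Proof. by move=> H k; apply: (le_trans (normIm _)). Qed.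

Lemma csum_le A c : cgeo A c -> cmod (csum c) <= 4 * A.
Proof.
move=> H; apply: (le_trans (cmod_le _)).
have h1 := rsum_le (cgeo_Re H); have h2 := rsum_le (cgeo_Im H).
by rewrite /csum /=; lra.
Qed.

Lemma csum0 : csum (fun=> 0) = 0.
Proof.
apply/eqP; rewrite -cmod_eq0 eq_le cmod_ge0 andbT -[X in _ <= X](mulr0 4).
by apply: csum_le => k; rewrite cmod0 mul0r.
Qed.

Lemma rsumD A B u v : rgeo A u -> rgeo B v ->
  rsum (fun k => u k + v k) = rsum u + rsum v.
Proof. by move=> /rgeo_cvgs h1 /rgeo_cvgs h2; rewrite -lim_seriesD. Qed.

Lemma rsumZ A a u : rgeo A u -> rsum (fun k => a * u k) = a * rsum u.
Proof. by move=> /rgeo_cvgs h1; rewrite -[RHS]/(a *: _) -lim_seriesZ. Qed.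

Lemma cgeoZ A a c : cgeo A c -> cgeo (cmod a * A) (fun k => a * c k).
Proof. by move=> H k; rewrite cmodM -mulrA ler_wpM2l ?cmod_ge0. Qed.

Lemma cgeoD A B c d : cgeo A c -> cgeo B d -> cgeo (A + B) (fun k => c k + d k).
Proof.
by move=> h1 h2 k; rewrite mulrDl (le_trans (cmodD _ _)) // lerD.
Qed.

Lemma csumD A B c d : cgeo A c -> cgeo B d ->
  csum (fun k => c k + d k) = csum c + csum d.
Proof.
move=> h1 h2; rewrite /csum addCE -(rsumD (cgeo_Re h1) (cgeo_Re h2)).
rewrite -(rsumD (cgeo_Im h1) (cgeo_Im h2)).
by congr Complex; congr rsum; apply/funext => k; rewrite ?cReD ?cImD.
Qed.

Lemma rgeoZ A (a : R) u : rgeo A u -> rgeo (`|a| * A) (fun k => a * u k).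
Proof. by move=> H k; rewrite normrM -mulrA ler_wpM2l. Qed.

Lemma csumZ A a c : cgeo A c -> csum (fun k => a * c k) = a * csum c.
Proof.
case: a => x y h; rewrite /csum mulCE.
have hR := cgeo_Re h; have hI := cgeo_Im h.
rewrite -(rsumZ x hR) -(rsumZ x hI) -(rsumZ y hR) -mulNr -(rsumZ (- y) hI).
rewrite -(rsumD (rgeoZ x hR) (rgeoZ (- y) hI)) -(rsumD (rgeoZ x hI) (rgeoZ y hR)).
congr Complex; congr rsum; apply/funext => k; case: (c k) => u v.
  by rewrite mulCE /= mulNr.
by rewrite mulCE.
Qed.

Lemma rsum_recl A u : rgeo A u -> rsum u = u 0%N + rsum (fun k => u k.+1).
Proof.
move=> h; have cu := rgeo_cvgs h.
have cv : series u @ \oo --> rsum u by [].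
move: cv; rewrite -cvg_shiftS => cv.
have e : [sequence series u n.+1]_n = (fun n => u 0%N + series (fun k => u k.+1) n).
  by apply/funext => n; rewrite /series /= big_nat_recl //.
have A0 : 0 <= A by have := h 0%N; rewrite expr0 mulr1; apply: le_trans.
have cw : cvgn (series (fun k => u k.+1)).
  apply: (@rgeo_cvgs A) => k; apply: (le_trans (h _)); rewrite exprS ler_wpM2l //.
  by rewrite ler_piMl ?exprn_ge0 //; lra.
have : (fun n => u 0%N + series (fun k => u k.+1) n) @ \oo --> u 0%N + rsum (fun k => u k.+1).
  by apply: cvgD => //; exact: cvg_cst.
by rewrite -e => cv'; exact: (cvg_unique (@Rhausdorff R) cv cv').
Qed.

Lemma csum_recl A c : cgeo A c -> csum c = c 0%N + csum (fun k => c k.+1).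
Proof.
move=> h; rewrite /csum (rsum_recl (cgeo_Re h)) (rsum_recl (cgeo_Im h)).
by case: (c 0%N) => x y; rewrite addCE.
Qed.

Lemma cgeoS A c : cgeo A c -> cgeo A (fun k => c k.+1).
Proof.
move=> h k; apply: (le_trans (h _)).
have A0 : 0 <= A by have := h 0%N; rewrite expr0 mulr1; apply: le_trans; exact: cmod_ge0.
rewrite exprS ler_wpM2l // ler_piMl ?exprn_ge0 //; lra.
Qed.

(* Both sides carry a factor r so that the exponent k - 1 does not occur. *)
Lemma pow_taylor (h d : C) (r : R) k : cmod h <= r -> cmod (h + d) <= r ->
  r * cmod ((h + d) ^+ k.+1 - h ^+ k.+1 - k.+1%:R * d * h ^+ k)
    <= k%:R ^+ 2 * cmod d ^+ 2 * r ^+ k.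
Proof.
move=> h1 h2; have r0 : 0 <= r by apply: le_trans h1; exact: cmod_ge0.
elim: k => [|k IH].
  rewrite !expr1 expr0 mulr1 mul1r (_ : _ - _ - _ = 0); last by ring.
  by rewrite cmod0 mulr0 expr0n /= !mul0r.
set T := (X in cmod X) in IH.
rewrite (_ : _ - _ - _ = (h + d) * T + k.+1%:R * d ^+ 2 * h ^+ k); last first.
  by rewrite /T !exprS -[k.+2%:R]natr1; ring.
have hd : cmod ((h + d) * T + k.+1%:R * d ^+ 2 * h ^+ k) <=
   r * cmod T + k.+1%:R * cmod d ^+ 2 * r ^+ k.
  apply: (le_trans (cmodD _ _)); rewrite [cmod (_ * T)]cmodM.
  rewrite [cmod (_ * h ^+ k)]cmodM [cmod (_ * d ^+ 2)]cmodM !cmodX cmod_nat; apply: lerD.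
    by rewrite ler_wpM2r ?cmod_ge0.
  rewrite ler_wpM2l ?mulr_ge0 ?exprn_ge0 ?cmod_ge0 //.
  by rewrite lerXn2r ?nnegrE ?cmod_ge0.
apply: (@le_trans _ _ (r * (k%:R ^+ 2 * cmod d ^+ 2 * r ^+ k + k.+1%:R * cmod d ^+ 2 * r ^+ k))).
  by rewrite ler_wpM2l // (le_trans hd) // lerD2r.
rewrite -mulrDl -mulrDl mulrCA -exprS ler_wpM2r ?exprn_ge0 // ler_wpM2r ?exprn_ge0 ?cmod_ge0 //.
rewrite -[k.+1%:R]natr1; have : 0 <= k%:R :> R by []. 
nra.
Qed.

Section Antiderivative.
Variables (c : nat -> C) (A M : R).
Hypothesis M0 : 0 < M.
Hypothesis cM : forall k, cmod (c k) <= A * M ^+ k.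

Let A0 : 0 <= A.
Proof. by have := cM 0; rewrite expr0 mulr1; apply: le_trans; exact: cmod_ge0. Qed.

Definition psum z := csum (fun k => c k * z ^+ k).
Definition pint z := csum (fun k => c k / k.+1%:R * z ^+ k.+1).

Let small h := cmod h <= 1 / 4 / M.

Lemma psum_quarter h k : small h -> cmod (c k * h ^+ k) <= A * (1 / 4) ^+ k.
Proof.
move=> hs; rewrite cmodM cmodX.
apply: (@le_trans _ _ (A * M ^+ k * (1 / 4 / M) ^+ k)).
  apply: ler_pM; rewrite ?exprn_ge0 ?cmod_ge0 //.
  by rewrite lerXn2r ?nnegrE ?cmod_ge0 // divr_ge0 // ltW.
by rewrite -mulrA -exprMn (_ : M * _ = 1 / 4) //; field; rewrite gt_eqF.
Qed.

Let quarter_half k : (1 / 4 : R) ^+ k <= (1 / 2) ^+ k.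
Proof. by apply: lerXn2r; rewrite ?nnegrE; lra. Qed.

Lemma psum_geo h : small h -> cgeo A (fun k => c k * h ^+ k).
Proof.
by move=> hs k; apply: (le_trans (psum_quarter k hs)); rewrite ler_wpM2l.
Qed.

Let inv_le1 k : (k.+1%:R^-1 : R) <= 1.
Proof. by rewrite invf_le1 ?ltr0n // ler1n. Qed.

Lemma pint_geo h : small h ->
  cgeo (cmod h * A) (fun k => c k / k.+1%:R * h ^+ k.+1).
Proof.
move=> hs k; rewrite exprS (_ : _ * _ = h * (k.+1%:R^-1 * (c k * h ^+ k))); last by ring.
rewrite cmodM -mulrA ler_wpM2l ?cmod_ge0 // cmodM -[leRHS]mul1r.
apply: ler_pM; rewrite ?cmod_ge0 //; last exact: psum_geo.
by rewrite cmodV cmod_nat.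
Qed.

(** Each term has a quadratic remainder by [pow_taylor], with a coefficient that grows like k^2 / (k
    + 1) <= k. On a radius r with M r = 1/4 = 1/2 * 1/2, one factor (1/2)^k absorbs this growth by k
    <= 2^k and the other keeps the sum geometric. *)
Lemma is_derive_pint h : cmod h < 1 / 4 / M -> is_derive h (1 : C) pint (psum h).
Proof.
set r := 1 / 4 / M => hr.
have r0 : 0 < r by apply: le_lt_trans hr; exact: cmod_ge0.
apply: (@is_derive_quad _ _ _ _ (4 * (A / r)) (r - cmod h)); first by rewrite subr_gt0.
move=> d hd; have hdr : cmod (h + d) <= r.
  by apply: (le_trans (cmodD _ _)); lra.
have g1 := pint_geo hdr; have g2 := pint_geo (ltW hr); have g3 := psum_geo (ltW hr).
rewrite -mulNr -[- pint h]mulN1r /pint /psum -(csumZ (-1) g2) -(csumZ (- d) g3).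
rewrite -(csumD g1 (cgeoZ (-1) g2)).
rewrite -(csumD (cgeoD g1 (cgeoZ (-1) g2)) (cgeoZ (- d) g3)).
rewrite -mulrA; apply: csum_le => k.
rewrite (_ : _ + _ = c k / k.+1%:R *
   ((h + d) ^+ k.+1 - h ^+ k.+1 - k.+1%:R * d * h ^+ k)); last first.
  by field; rewrite ?natr1 ?nat1r ?pnatr_eq0.
rewrite !cmodM cmodV cmod_nat -(ler_pM2l r0).
set T := cmod (_ - _).
have hT : r * T <= k%:R ^+ 2 * cmod d ^+ 2 * r ^+ k by apply: pow_taylor => //; exact: ltW.
rewrite (_ : r * _ = cmod (c k) * k.+1%:R^-1 * (r * T)); last by ring.
apply: (@le_trans _ _ (A * M ^+ k * k.+1%:R^-1 * (k%:R ^+ 2 * cmod d ^+ 2 * r ^+ k))).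
  have r0' := ltW r0; have M0' := ltW M0.
  apply: ler_pM => //; rewrite ?mulr_ge0 ?cmod_ge0 ?invr_ge0 //.
  by rewrite ler_wpM2r ?invr_ge0.
rewrite (_ : _ * _ = A * cmod d ^+ 2 * ((M * r) ^+ k * (k%:R * (k%:R / k.+1%:R)))); last first.
  by rewrite [(M * r) ^+ k]exprMn;  field; rewrite ?natr1 ?nat1r ?pnatr_eq0.
rewrite (_ : r * _ = A * cmod d ^+ 2 * (1 / 2) ^+ k); last by field; rewrite gt_eqF.
rewrite ler_wpM2l ?mulr_ge0 ?exprn_ge0 ?cmod_ge0 //.
rewrite (_ : M * r = (1 / 2) * (1 / 2)); last by rewrite /r; field; rewrite gt_eqF.
rewrite exprMn -mulrA ler_piMr ?exprn_ge0 //.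
apply: (@le_trans _ _ ((1 / 2) ^+ k * k%:R)).
  rewrite ler_wpM2l ?exprn_ge0 // ler_piMr //.
  by rewrite ler_pdivrMr ?ltr0n // mul1r ler_nat.
rewrite expr_div_n expr1n mul1r mulrC ler_pdivrMr ?exprn_gt0 // mul1r.
by rewrite -natrX ler_nat ltnW // ltn_expl.
Qed.

End Antiderivative.

End PowerSeries.

(** * Local branches of log and Li_2 *)

Section Branches.
Variable R : realType.
Local Notation C := (Cplx R).
Local Open Scope classical_set_scope.
Local Open Scope ring_scope.

(** [L] stands for the real or the imaginary part. Along a segment the real mean value theorem then
    applies, which yields [derive0_cst]. *)
Lemma is_derive_line (F : C -> C) (h d : C) (L : C -> R) (t : R) :
  (forall z1 z2 : C, L (z1 - z2) = L z1 - L z2) ->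
  (forall z, `|L z| <= cmod z) ->
  (forall (x : R) z, L (ofR x * z) = x * L z) ->
  is_derive (ofR t * h) (1 : C) F d ->
  is_derive t (1 : R) (fun t => L (F (ofR t * h))) (L (h * d)).
Proof.
move=> LB LN LZ /is_derive_cmodP H; apply/is_derive_realP => e e0.
have m0 : 0 < cmod h + 1 by rewrite ltr_pwDr ?cmod_ge0.
have [|dl dl0 {}H] := H (e / (cmod h + 1)); first by rewrite divr_gt0.
exists (dl / (cmod h + 1)); first by rewrite divr_gt0.
move=> u; rewrite ltr_pdivlMr // => hu.
have mu : cmod (ofR u * h) <= `|u| * (cmod h + 1).
  by rewrite cmodM cmod_ofR ler_wpM2l // lerDl ler01.
have {H} := H (ofR u * h) (le_lt_trans mu hu).
rewrite -mulrDl -ofRD -mulrA -LZ -!LB => H.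
apply: (le_trans (LN _)); apply: (le_trans H).
rewrite -mulrA ler_pM2l // mulrC ler_pdivrMr //.
Qed.

Lemma derive0_cst (F : C -> C) (r : R) :
  (forall h, cmod h < r -> is_derive h (1 : C) F 0) ->
  forall h, cmod h < r -> F h = F 0.
Proof.
move=> H h hr.
have key (L : C -> R) : (forall z1 z2 : C, L (z1 - z2) = L z1 - L z2) ->
  (forall z, `|L z| <= cmod z) -> (forall (x : R) z, L (ofR x * z) = x * L z) ->
  L (F h) = L (F 0).
  move=> LB LN LZ; pose f (t : R) := L (F (ofR t * h)).
  have df (t : R) : t \in `[0, 1] -> is_derive t (1 : R) f 0.
    rewrite in_itv /= => /andP[t0 t1].
    have tr : cmod (ofR t * h) < r.
      by apply: le_lt_trans hr; rewrite cmodM cmod_ofR ger0_norm // ler_piMl // cmod_ge0.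
    have := is_derive_line LB LN LZ (H _ tr).
    by rewrite mulr0 -[X in L X](subrr (0 : C)) LB subrr.
  have d1 (x : R) : x \in `]0, 1[ -> is_derive x (1 : R) f 0.
    by move=> xi; apply: df; apply: subset_itv_oo_cc xi.
  have d2 : {within `[0, 1], continuous f}.
    by apply: derivable_within_continuous => x /df [].
  have [x _] := MVT_segment (ler01 : (0 : R) <= 1) d1 d2.
  move=> /eqP; rewrite mul0r subr_eq0 => /eqP; rewrite /f.
  have -> : ofR (1 : R) = 1 :> C by [].
  have -> : ofR (0 : R) = 0 :> C by [].
  by rewrite mul1r mul0r.
have e1 : cRe (F h) = cRe (F 0).
  apply: (key (@cRe R)) => [[? ?] [? ?] //||x [a b]]; first exact: normRe.
  by rewrite /ofR mulCE /= mul0r subr0.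
have e2 : cIm (F h) = cIm (F 0).
  apply: (key (@cIm R)) => [[? ?] [? ?] //||x [a b]]; first exact: normIm.
  by rewrite /ofR mulCE /= mul0r addr0.
by move: e1 e2; case: (F h) (F 0) => [? ?] [? ?] /= -> ->.
Qed.

Definition log1p : C -> C := pint (fun k => (-1) ^+ k).

Lemma log1p_coef k : cmod ((-1 : C) ^+ k) <= 1 * (1 : R) ^+ k.
Proof. by rewrite cmodX cmodN cmod1 mul1r. Qed.

Lemma pint0 (c : nat -> C) : pint c 0 = 0.
Proof.
rewrite /pint -[RHS](csum0 R); congr csum; apply/funext => k.
by rewrite exprS mul0r mulr0.
Qed.

Lemma neq0_1D (h : C) : cmod h < 1 / 4 -> 1 + h != 0.
Proof.
move=> hr; rewrite -cmod_eq0 gt_eqF //.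
have := cmodB (1 + h) h; rewrite addrK cmod1; lra.
Qed.

(** The termwise derivative p satisfies p = 1 - h p by splitting off its first term, and this
    determines it. *)
Lemma is_derive_log1p (h : C) : cmod h < 1 / 4 -> is_derive h (1 : C) log1p (1 + h)^-1.
Proof.
move=> hr; have h1 := neq0_1D hr.
have hr' : cmod h < 1 / 4 / 1 by rewrite divr1.
have := is_derive_pint ltr01 log1p_coef hr'.
set p := psum _ _; suff -> : p = (1 + h)^-1 by [].
have g := psum_geo ltr01 log1p_coef (ltW hr').
have : p = 1 - h * p.
  rewrite {1}/p /psum (csum_recl g) expr0 expr0 mulr1 -mulNr -(csumZ (- h) g).
  by congr (_ + csum _); apply/funext => k; rewrite !exprS; ring.
move=> e; apply: (mulfI h1); rewrite mulfV // mulrDl mul1r [in X in X + _]e; ring.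
Qed.

(** The quotient of 1 + z by [expC (log1p z)] has derivative 0 and equals 1 at 0. *)
Lemma expC_log1p (h : C) : cmod h < 1 / 4 -> expC (log1p h) = 1 + h.
Proof.
move=> hr; pose F (z : C) := expC (- log1p z) * (1 + z).
have : F h = F 0.
  apply: (derive0_cst _ hr) => z zr; have z1 := neq0_1D zr.
  have d1 := is_derive_log1p zr.
  have d2 : is_derive z (1 : C) (fun z => expC (- log1p z)) (expC (- log1p z) * - (1 + z)^-1).
    exact: (is_derive1_compK (is_derive_expC _) (is_deriveN d1)).
  have d3 : is_derive z (1 : C) (fun z : C => 1 + z) 1.
    by apply: is_derive_eq; rewrite add0r.
  apply: (is_derive_eq (is_deriveM d2 d3)).
  by rewrite -![_ *: _]/(_ * _); field.
have l0 : log1p 0 = 0 := pint0 _.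
rewrite /F l0 oppr0 expC0 mul1r addr0 expCN => e.
by apply: (mulfI (invr_neq0 (expC_neq0 (log1p h)))); rewrite e mulVf // expC_neq0.
Qed.

(** The branch near z0 with prescribed value c0 at z0. It is holomorphic there even if z0 lies on
    the cut of [logC]. *)
Definition local_log (z0 c0 : C) (z : C) : C := c0 + log1p (z / z0 - 1).

Lemma local_log0 (z0 c0 : C) : z0 != 0 -> local_log z0 c0 z0 = c0.
Proof. by move=> z00; rewrite /local_log divff // subrr [log1p 0]pint0 addr0. Qed.

Lemma local_log_branch (z0 c0 : C) : expC c0 = z0 -> log_branch z0 (local_log z0 c0).
Proof.
move=> e0; have z00 : z0 != 0 by rewrite -e0 expC_neq0.
apply/nearCP; exists (1 / 4 * cmod z0).
  by rewrite mulr_gt0 ?cmod_gt0 //; lra.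
move=> h hr; set z := z0 + h.
have zr : cmod (z / z0 - 1) < 1 / 4.
  rewrite (_ : _ - 1 = h / z0); last by rewrite /z; field.
  by rewrite cmodM cmodV ltr_pdivrMr // cmod_gt0.
split.
  rewrite /local_log expCD e0 expC_log1p //; field => //.
have d1 : is_derive z (1 : C) (fun z : C => z / z0 - 1) z0^-1.
  have d2 := is_deriveM (is_derive_id z (1 : C)) (is_derive_cst z0^-1 z (1 : C)).
  apply: (is_derive_eq (is_deriveB d2 (is_derive_cst (1 : C) z (1 : C)))).
  by rewrite -![_ *: _]/(_ * _) /cst; ring.
have d3 := @is_derive1_compK _ (@log1p) (fun z : C => z / z0 - 1) z _ _ (is_derive_log1p zr) d1.
by have [] := is_deriveD (is_derive_cst c0 z (1 : C)) d3.
Qed.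

(* A power series solution of (z0 + h) phi(h) = - c0 - log1p(- h / (1 - z0)). *)
Fixpoint li_coef (z0 c0 : C) (k : nat) : C :=
  if k is k'.+1 then (k'.+1%:R^-1 * (1 - z0)^-1 ^+ k'.+1 - li_coef z0 c0 k') / z0
  else - c0 / z0.

(** A primitive of - log(1 - z) / z near z0 is obtained by integrating termwise the series with
    coefficients [li_coef]; the point is that these grow at most geometrically. *)
Lemma Li2_branch_exists (z0 : C) : z0 != 0 -> 1 - z0 != 0 ->
  exists g, Li2_branch z0 g.
Proof.
move=> z00 z01; set c0 := logC (1 - z0).
have e0 : expC c0 = 1 - z0 by rewrite expC_logC.
pose c := li_coef z0 c0.
pose N := (cmod (1 - z0))^-1; pose Z := (cmod z0)^-1.
have N0 : 0 < N by rewrite invr_gt0 cmod_gt0.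
have Z0 : 0 < Z by rewrite invr_gt0 cmod_gt0.
(* The induction step needs (M + A) Z <= A M, which follows from 2 Z <= A and 2 Z <= M. Moreover N
   <= M controls the inhomogeneous term and |c0| Z <= A the initial one. *)
pose M := N + 2 * Z + 1; pose A := cmod c0 * Z + 1 + 2 * Z.
have M0 : 0 < M by rewrite /M; lra.
have c00 := cmod_ge0 c0.
have c0Z : 0 <= cmod c0 * Z by rewrite mulr_ge0 // ltW.
have cM k : cmod (c k) <= A * M ^+ k.
  elim: k => [|k IH].
    by rewrite /c /= cmodM cmodN cmodV expr0 mulr1 /A -/Z; lra.
  rewrite /c /= -/c cmodM cmodV -/Z.
  have h1 : cmod (k.+1%:R^-1 * (1 - z0)^-1 ^+ k.+1) <= M ^+ k.+1.
    rewrite cmodM cmodX !cmodV cmod_nat -[leRHS]mul1r.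
    apply: ler_pM; rewrite ?invr_ge0 ?exprn_ge0 ?invr_ge0 ?cmod_ge0 //.
      by rewrite invf_le1 ?ltr0n // ler1n.
    by apply: lerXn2r; rewrite ?nnegrE; rewrite -/N /M; lra.
  have M' : 0 <= M ^+ k by rewrite exprn_ge0 // ltW.
  apply: (@le_trans _ _ ((M * M ^+ k + A * M ^+ k) * Z)).
    by rewrite ler_wpM2r ?(ltW Z0) // (le_trans (cmodB _ _)) // lerD -?exprS.
  rewrite exprS (_ : (_ + _) * Z = (M + A) * Z * M ^+ k); last by ring.
  rewrite [A * _]mulrA ler_wpM2r //.
  have hA : 2 * Z <= A by rewrite /A; lra.
  have hM : 2 * Z <= M by rewrite /M; lra.
  nra.
pose f := local_log (1 - z0) c0.
have f0 : f (1 - z0) = c0 by rewrite /f local_log0.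
(* The constant of integration is the value [Li2 z0] itself, so both integers of the branch are
   0. *)
exists (fun z => Li2 z0 + pint c (z - z0)); split=> //; exists f, 0, 0; split.
- exact: local_log_branch.
- by rewrite f0 mulr0 subr0.
- by rewrite subrr pint0 !mulr0 mul0r !addr0.
have MV : 0 < 1 / 4 / M by rewrite divr_gt0 //; lra.
apply/nearCP; exists (1 / 4 / M) => // h hr.
have cV (x : C) : x != 0 -> (cmod x)^-1 <= M -> cmod (h / x) < 1 / 4.
  move=> x0 xM; rewrite cmodM cmodV.
  apply: (@le_lt_trans _ _ (cmod h * M)); first by rewrite ler_wpM2l ?cmod_ge0.
  by rewrite -ltr_pdivlMr.
have z0h : z0 + h != 0.
  rewrite (_ : z0 + h = z0 * (1 + h / z0)); last by field.
  by rewrite mulf_neq0 // neq0_1D // cV // -/Z /M; lra.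
set u := - (h / (1 - z0)).
have uN : cmod u <= 1 / 4 / 1 by rewrite cmodN divr1 ltW // cV // -/N /M; lra.
have -> : f (1 - (z0 + h)) = c0 + log1p u.
  by rewrite /f /local_log; congr (_ + log1p _); rewrite /u; field.
have gl := pint_geo ltr01 (@log1p_coef) uN.
have gc := psum_geo M0 cM (ltW hr).
have e1 : (z0 + h) * psum c h = - (c0 + log1p u).
  rewrite mulrDl {1}/psum (csum_recl gc) expr0 mulr1 mulrDr {1}/c /=.
  rewrite mulrCA mulfV // mulr1 -addrA opprD; congr (_ + _).
  rewrite /psum -(csumZ z0 (cgeoS gc)) -(csumZ h gc).
  rewrite -(csumD (cgeoZ z0 (cgeoS gc)) (cgeoZ h gc)).
  rewrite -mulN1r /log1p /pint -(csumZ (-1) gl); congr csum; apply/funext => k.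
  have -> : c k.+1 = (k.+1%:R^-1 * (1 - z0)^-1 ^+ k.+1 - c k) / z0 by [].
  have -> : u ^+ k.+1 = - (-1) ^+ k * ((1 - z0)^-1 ^+ k.+1 * h ^+ k.+1).
    by rewrite /u -[- (h / (1 - z0))]mulN1r !exprMn [(-1) ^+ k.+1]exprS; ring.
  have sq : (-1) ^+ k * (-1) ^+ k = 1 :> C by rewrite -exprMn mulrNN mulr1 expr1n.
  transitivity (((-1) ^+ k * (-1) ^+ k) * (k.+1%:R^-1 * (1 - z0)^-1 ^+ k.+1 * h ^+ k.+1)).
    by rewrite sq mul1r [h ^+ k.+1]exprS; move: (_ ^+ k.+1) => X; field; rewrite z00 nat1r pnatr_eq0.
  by rewrite mulN1r; ring.
have -> : - (c0 + log1p u) / (z0 + h) = psum c h.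
  by rewrite -e1 mulrAC mulfV // mul1r.
have d1 : is_derive (z0 + h) (1 : C) (fun z : C => z - z0) 1.
  apply: (is_derive_eq (is_deriveB (is_derive_id (z0 + h) (1 : C)) (is_derive_cst z0 (z0 + h) (1 : C)))).
  by rewrite subr0.
have hz : z0 + h - z0 = h by ring.
have d2 : is_derive (z0 + h - z0) (1 : C) (pint c) (psum c h).
  by rewrite hz; exact: (is_derive_pint M0 cM hr).
have d3 := @is_derive1_compK _ (pint c) (fun z : C => z - z0) (z0 + h) _ _ d2 d1.
apply: (is_derive_eq (is_deriveD (is_derive_cst (Li2 z0) (z0 + h) (1 : C)) d3)).
by rewrite add0r mulr1.
Qed.

Lemma log_branch_exists (z0 : C) : z0 != 0 -> exists f, log_branch z0 f.
Proof.
by move=> z00; exists (local_log z0 (logC z0)); apply/local_log_branch/expC_logC.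
Qed.

Lemma log_branch_expC (z0 : C) f : log_branch z0 f -> expC (f z0) = z0.
Proof. by move=> /nearCP[d d0 /(_ 0)]; rewrite cmod0 addr0 => /(_ d0)[]. Qed.

(** A branch is only assumed differentiable; the value of its derivative comes from differentiating
    expC (f z) = z. *)
Lemma log_branch_derive (z0 : C) f : log_branch z0 f -> is_derive z0 (1 : C) f z0^-1.
Proof.
move=> h; have e0 := log_branch_expC h.
have z00 : z0 != 0 by rewrite -e0 expC_neq0.
have [d d0 H] := (nearCP _ _).1 h.
have df : derivable f z0 1 by have := H 0; rewrite cmod0 addr0 => /(_ d0)[].
have d1 := derivableP df; have d2 := is_derive1_compK (is_derive_expC (f z0)) d1.
have d3 : is_derive z0 (1 : C) (@expC R \o f) 1.
  apply: (near_eq_is_derive _ (is_derive_id z0 (1 : C))).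
  by apply/nearCP; exists d => // u /H[].
have := @derive_val _ _ _ _ _ _ _ d2; rewrite (@derive_val _ _ _ _ _ _ _ d3) e0 => e.
suff <- : 'D_1 f z0 = z0^-1 by [].
by apply: (mulfI z00); rewrite -e mulfV.
Qed.

End Branches.

(** * Logarithmic derivatives *)

Section LogarithmicDerivatives.
Variable R : realType.
Local Notation C := (Cplx R).
Local Open Scope classical_set_scope.
Local Open Scope ring_scope.

(** The value of log(1 - z0) carried by the branch g. Reading it off from the derivative avoids the
    function and the integers hidden in [Li2_branch]. *)
Definition Li2_log (z0 : C) (g : C -> C) : C := - (z0 * 'D_1 g z0).

(** The same n occurs in the logarithm and in the value of g; on this [Li2_branch_congr] relies. *)
Lemma Li2_branchP (z0 : C) g : Li2_branch z0 g ->
  [/\ z0 != 0, 1 - z0 != 0, is_derive z0 (1 : C) g (- Li2_log z0 g / z0),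
      expC (Li2_log z0 g) = 1 - z0
    & exists n m : int, Li2_log z0 g = logC (1 - z0) - 2%:R * piC R * Ci R * n%:~R
        /\ g z0 = Li2 z0 + 2%:R * piC R * Ci R * n%:~R * logC z0
               + 4%:R * piC R ^+ 2 * m%:~R].
Proof.
move=> [z00 [f [n [m [lf f0 g0 /nearCP[d d0 /(_ 0)]]]]]].
rewrite cmod0 addr0 => /(_ d0) dg.
have e1 := log_branch_expC lf.
have e2 : Li2_log z0 g = f (1 - z0).
  rewrite /Li2_log (@derive_val _ _ _ _ _ _ _ dg) mulrCA mulfV // mulr1 opprK //.
split=> //.
- by rewrite -e1 expC_neq0.
- by rewrite e2.
- by rewrite e2.
- by exists n, m; rewrite e2.
Qed.

(** That is, t v' = e v at t0: for a Laurent monomial v in t, e is the exponent of t. *)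
Definition log_derive (t0 : C) (v : C -> C) (e : C) :=
  v t0 != 0 /\ is_derive t0 (1 : C) v (v t0 * e / t0).

Variable t0 : C.
Hypothesis t00 : t0 != 0.

Lemma log_derive_upd (b : bool) (u : C) : u != 0 -> (b -> u = t0) ->
  log_derive t0 (fun t => if b then t else u) b%:R.
Proof.
case: b => u0 h; split=> //.
  by apply: (is_derive_eq (is_derive_id t0 (1 : C))); rewrite mulr1 mulfV.
by apply: (is_derive_eq (is_derive_cst u t0 (1 : C))); rewrite mulr0 mul0r.
Qed.

Lemma log_deriveM v1 v2 e1 e2 : log_derive t0 v1 e1 -> log_derive t0 v2 e2 ->
  log_derive t0 (fun t => v1 t * v2 t) (e1 + e2).
Proof.
move=> [h1 d1] [h2 d2]; split; first by rewrite mulf_neq0.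
by apply: (is_derive_eq (is_deriveM d1 d2)); rewrite -![_ *: _]/(_ * _); ring.
Qed.

Lemma log_deriveV v e : log_derive t0 v e -> log_derive t0 (fun t => (v t)^-1) (- e).
Proof.
move=> [h [d1 d2]]; split; first by rewrite invr_neq0.
apply: DeriveDef; first exact: derivableV.
rewrite deriveV // d2 -![_ *: _]/(_ * _).
by field; rewrite ?h ?t00 ?andbT.
Qed.

Lemma is_derive_Li2_comp g q e : Li2_branch (q t0) g -> log_derive t0 q e ->
  is_derive t0 (1 : C) (fun t => g (q t)) (- Li2_log (q t0) g * e / t0).
Proof.
move=> /Li2_branchP[h1 _ dg _ _] [h2 dq].
by apply: (is_derive_eq (is_derive1_compK dg dq)); field; rewrite ?h1 ?t00.
Qed.

Lemma is_derive_log_comp f q e : log_branch (q t0) f -> log_derive t0 q e ->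
  is_derive t0 (1 : C) (fun t => f (q t)) (e / t0).
Proof.
move=> /log_branch_derive df [h2 dq].
by apply: (is_derive_eq (is_derive1_compK df dq)); field; rewrite ?h2 ?t00.
Qed.

Lemma is_derive_bigsum (I : Type) (r : seq I) (F : I -> C -> C) (dF : I -> C) :
  (forall i, is_derive t0 (1 : C) (F i) (dF i)) ->
  is_derive t0 (1 : C) (fun t => \sum_(i <- r) F i t) (\sum_(i <- r) dF i).
Proof.
move=> H; elim: r => [|i r IH].
  rewrite (_ : (fun t => _) = cst 0); last by apply/funext => t; rewrite big_nil.
  by rewrite big_nil; exact: is_derive_cst.
rewrite (_ : (fun t => _) = (fun t => F i t + \sum_(j <- r) F j t)); last first.
  by apply/funext => t; rewrite big_cons.
by rewrite big_cons; exact: (is_deriveD (H i) IH).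
Qed.

End LogarithmicDerivatives.

(** * The derivatives of the potential function *)

Section CrossingPotential.
Variable R : realType.
Local Notation C := (Cplx R).

Definition sgC (b : bool) : C := if b then 1 else -1.

(* The derivatives of a crossing potential with respect to log w_a, ..., log w_d. *)
Definition pot_a (B : branches R) (wa wb wc wd : C) : C :=
  - Li2_log ((wa * wc) / (wb * wd)) (li_acbd B) + Li2_log (wb / wa) (li_ba B)
  + Li2_log (wd / wa) (li_da B) - log_ba B (wb / wa) - log_da B (wd / wa).
Definition pot_b (B : branches R) (wa wb wc wd : C) : C :=
  - Li2_log (wc / wb) (li_cb B) + Li2_log ((wa * wc) / (wb * wd)) (li_acbd B)
  - Li2_log (wb / wa) (li_ba B) + log_da B (wd / wa).
Definition pot_c (B : branches R) (wa wb wc wd : C) : C :=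
  Li2_log (wc / wb) (li_cb B) + Li2_log (wc / wd) (li_cd B)
  - Li2_log ((wa * wc) / (wb * wd)) (li_acbd B).
Definition pot_d (B : branches R) (wa wb wc wd : C) : C :=
  - Li2_log (wc / wd) (li_cd B) + Li2_log ((wa * wc) / (wb * wd)) (li_acbd B)
  - Li2_log (wd / wa) (li_da B) + log_ba B (wb / wa).

(** The F_i stand for the logarithms [Li2_log] of the five dilogarithms, A and B for the two
    logarithms, and ea, ..., ed for the exponents of t in w_a, ..., w_d. The right side collects the
    coefficients of these exponents. *)
Lemma potential_derivative_identity (F1 F2 F3 F4 F5 A B ea eb ec ed s t : C) :
  s * (- (- F1 * (ec - eb) / t) - (- F2 * (ec - ed) / t)
       + (- F3 * (ea + ec - (eb + ed)) / t) + (- F4 * (eb - ea) / t)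
       + (- F5 * (ed - ea) / t) - 0 + (A * ((ed - ea) / t) + B * ((eb - ea) / t)))
  = (s * (- F3 + F4 + F5 - A - B) * ea + s * (- F1 + F3 - F4 + B) * eb
       + s * (F1 + F2 - F3) * ec + s * (- F2 + F3 - F5 + A) * ed) / t.
Proof. by ring. Qed.

Lemma is_derive_crossing_potential (t0 : C) pos B (va vb vc vd : C -> C) (ea eb ec ed : C) :
  t0 != 0 -> branches_at B (va t0) (vb t0) (vc t0) (vd t0) ->
  log_derive t0 va ea -> log_derive t0 vb eb -> log_derive t0 vc ec -> log_derive t0 vd ed ->
  is_derive t0 (1 : C) (fun t => crossing_potential pos B (va t) (vb t) (vc t) (vd t))
    ((sgC pos * pot_a B (va t0) (vb t0) (vc t0) (vd t0) * ea
      + sgC pos * pot_b B (va t0) (vb t0) (vc t0) (vd t0) * eb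
      + sgC pos * pot_c B (va t0) (vb t0) (vc t0) (vd t0) * ec
      + sgC pos * pot_d B (va t0) (vb t0) (vc t0) (vd t0) * ed) / t0).
Proof.
move=> t00 [[h1 h2 h3] h4 h5 h6 h7] da db dc dd.
have qcb := log_deriveM dc (log_deriveV t00 db).
have qcd := log_deriveM dc (log_deriveV t00 dd).
have qac := log_deriveM (log_deriveM da dc) (log_deriveV t00 (log_deriveM db dd)).
have qba := log_deriveM db (log_deriveV t00 da).
have qda := log_deriveM dd (log_deriveV t00 da).
have d1 := is_derive_Li2_comp t00 h1 qcb.
have d2 := is_derive_Li2_comp t00 h2 qcd.
have d3 := is_derive_Li2_comp t00 h3 qac.
have d4 := is_derive_Li2_comp t00 h4 qba.
have d5 := is_derive_Li2_comp t00 h5 qda.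
have d6 := is_derive_log_comp t00 h6 qba.
have d7 := is_derive_log_comp t00 h7 qda.
have D := is_deriveD (is_deriveB (is_deriveD (is_deriveD (is_deriveD (is_deriveB (is_deriveN d1) d2) d3) d4) d5)
  (is_derive_cst (piC R ^+ 2 / 6%:R) t0 (1 : C))) (is_deriveM d6 d7).
have D' := is_deriveZ (if pos then 1 else -1 : C) D.
apply: (is_derive_eq D'); exact: potential_derivative_identity.
Qed.

Variables (D : diagram) (w : region D -> C).
Hypothesis w0 : forall k, w k != 0.

Definition coef_at (pot : branches R -> C -> C -> C -> C -> C) (B : crossing D -> branches R) x :=
  sgC (positive x) * pot (B x) (w (reg (corner_a x))) (w (reg (corner_b x)))
     (w (reg (corner_c x))) (w (reg (corner_d x))).

(** A region may occupy several corners of a crossing, so the contribution of each corner is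
    weighted by an indicator. *)
Definition wdiff_at (B : crossing D -> branches R) (k : region D) x : C :=
  coef_at pot_a B x * (reg (corner_a x) == k)%:R
  + coef_at pot_b B x * (reg (corner_b x) == k)%:R
  + coef_at pot_c B x * (reg (corner_c x) == k)%:R
  + coef_at pot_d B x * (reg (corner_d x) == k)%:R.

Lemma wdiffE W B k :
  (forall x, branches_at (B x)
       (w (reg (corner_a x))) (w (reg (corner_b x)))
       (w (reg (corner_c x))) (w (reg (corner_d x)))) ->
  (forall v, W v = \sum_(x : crossing D) crossing_potential (positive x) (B x)
       (v (reg (corner_a x))) (v (reg (corner_b x)))
       (v (reg (corner_c x))) (v (reg (corner_d x)))) ->
  wdiff W w k = \sum_(x : crossing D) wdiff_at B k x.
Proof.
move=> hB hW; rewrite /wdiff; have t00 := w0 k.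
have ld (r : region D) : log_derive (w k) (fun t => if r == k then t else w r) (r == k)%:R.
  by apply: log_derive_upd => // /eqP ->.
have ev (r : region D) : (if r == k then w k else w r) = w r by case: eqP => [->|].
rewrite (_ : (fun t : C => W _) = (fun t : C => \sum_(x : crossing D) crossing_potential (positive x) (B x)
   (if reg (corner_a x) == k then t else w (reg (corner_a x)))
   (if reg (corner_b x) == k then t else w (reg (corner_b x)))
   (if reg (corner_c x) == k then t else w (reg (corner_c x)))
   (if reg (corner_d x) == k then t else w (reg (corner_d x))))); last first.
  by apply/funext => t; rewrite hW.
pose dF x := wdiff_at B k x / w k.
have H : is_derive (w k) (1 : C) (fun t : C => \sum_(x : crossing D) crossing_potential (positive x) (B x)
   (if reg (corner_a x) == k then t else w (reg (corner_a x)))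
   (if reg (corner_b x) == k then t else w (reg (corner_b x)))
   (if reg (corner_c x) == k then t else w (reg (corner_c x)))
   (if reg (corner_d x) == k then t else w (reg (corner_d x)))) (\sum_(x : crossing D) dF x).
  apply: is_derive_bigsum => x.
  have hx := is_derive_crossing_potential (positive x) t00 (B := B x)
    (va := fun t => if reg (corner_a x) == k then t else w (reg (corner_a x)))
    (vb := fun t => if reg (corner_b x) == k then t else w (reg (corner_b x)))
    (vc := fun t => if reg (corner_c x) == k then t else w (reg (corner_c x)))
    (vd := fun t => if reg (corner_d x) == k then t else w (reg (corner_d x))).
  rewrite /= !ev in hx.
  exact: (hx _ _ _ _ (hB x) (ld _) (ld _) (ld _) (ld _)).
rewrite (@derive_val _ _ _ _ _ _ _ H) mulr_sumr; apply: eq_bigr => x _.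
by rewrite /dF mulrC mulfVK.
Qed.

End CrossingPotential.

(** * Vectors and parabolic matrices *)

Section PlaneVectors.
Variable R : realType.
Local Notation C := (Cplx R).
Local Notation M2 := 'M[C]_2.
Local Notation V2 := 'cV[C]_2.
Implicit Types (u v p k : V2) (g : M2).

Lemma cV2P u v : u 0 0 = v 0 0 -> u 1 0 = v 1 0 -> u = v.
Proof.
move=> h0 h1; apply/matrixP => i j; rewrite (ord1 j).
by case: i => [[|[|//]] hi]; [move: h0 | move: h1]; congr (u _ _ = v _ _); apply/val_inj.
Qed.

Lemma mulmx2E (A : M2) u i : (A *m u) i 0 = A i 0 * u 0 0 + A i 1 * u 1 0.
Proof. by rewrite mxE big_ord_recl big_ord1 /=; congr (_ + A _ _ * u _ _); apply/val_inj. Qed.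

Lemma det_mx2 (A : M2) : \det A = A 0 0 * A 1 1 - A 0 1 * A 1 0.
Proof.
rewrite (expand_det_row _ 0) big_ord_recl big_ord1 /cofactor !det_mx11 !mxE /=.
rewrite addn0 expr0 mul1r addn1 expr1 mulN1r mulrN.
by congr (_ * A _ _ - A _ _ * A _ _); apply/val_inj.
Qed.

Lemma pmatE v : [/\ pmat v 0 0 = 1 + v 0 0 * v 1 0, pmat v 0 1 = - v 0 0 ^+ 2,
  pmat v 1 0 = v 1 0 ^+ 2 & pmat v 1 1 = 1 - v 0 0 * v 1 0].
Proof. by split; rewrite mxE. Qed.

Lemma det2E u v : det2 u v = u 0 0 * v 1 0 - u 1 0 * v 0 0.
Proof.
have i0 : 0 = lshift 1 0 :> 'I_(1 + 1) by apply/val_inj.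
have i1 : 1 = rshift 1 0 :> 'I_(1 + 1) by apply/val_inj.
rewrite /det2 det_mx2 [X in row_mx u v _ X * _ - _]i0 [X in _ * row_mx u v _ X - _]i1.
rewrite [X in _ - row_mx u v _ X * _]i1 [X in _ - _ * row_mx u v _ X]i0.
by rewrite !row_mxEl !row_mxEr; ring.
Qed.

Lemma det2_mul g u v : \det g = 1 -> det2 (g *m u) (g *m v) = det2 u v.
Proof. by move=> h; rewrite /det2 -mul_mx_row det_mulmx h mul1r. Qed.

(** A parabolic element acts as the transvection along its fixed vector; the later computations with
    colors use this form. *)
Lemma starE v k : star v k = v + det2 v k *: k.
Proof. by apply: cV2P; rewrite mulmx2E !mxE /= det2E; ring. Qed.

Lemma det2C u v : det2 u v = - det2 v u.
Proof. by rewrite !det2E; ring. Qed.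

Lemma det2vv u : det2 u u = 0.
Proof. by rewrite det2E; ring. Qed.

Lemma det2Dr u v1 v2 : det2 u (v1 + v2) = det2 u v1 + det2 u v2.
Proof. by rewrite !det2E !mxE; ring. Qed.

Lemma det2Zr u c v : det2 u (c *: v) = c * det2 u v.
Proof. by rewrite !det2E !mxE; ring. Qed.

Lemma det2Nr u v : det2 u (- v) = - det2 u v.
Proof. by rewrite !det2E !mxE; ring. Qed.

Lemma det2Nl u v : det2 (- u) v = - det2 u v.
Proof. by rewrite !det2E !mxE; ring. Qed.

Lemma starN v k : star v (- k) = star v k.
Proof. by rewrite !starE det2Nr scaleNr scalerN opprK. Qed.

Lemma plucker (v0 v1 v2 v3 : V2) :
  det2 v0 v2 * det2 v1 v3 - det2 v0 v3 * det2 v1 v2 = det2 v0 v1 * det2 v2 v3.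
Proof. by rewrite !det2E; ring. Qed.

Lemma det_pmat k : \det (pmat k) = 1.
Proof. by rewrite det_mx2 !mxE /=; ring. Qed.

Lemma det2_star u v k : det2 (star u k) (star v k) = det2 u v.
Proof. exact/det2_mul/det_pmat. Qed.

Lemma star_id k : star k k = k.
Proof. by rewrite starE det2vv scale0r addr0. Qed.

(** With v a region color and k an arc color, the change of w across an arc is a product of two
    determinants that the genericity conditions make nonzero. *)
Lemma det2_sub_star p v k : det2 p v - det2 p (star v k) = det2 k v * det2 p k.
Proof. by rewrite starE det2Dr det2Zr opprD addNKr [det2 v k]det2C mulNr opprK. Qed.

Lemma hopf_neq u v : u != 0 -> v != 0 -> (hopf u != hopf v) = (det2 u v != 0).
Proof.
move=> u0 v0.
have nz (w : V2) : w != 0 -> w 1 0 = 0 -> w 0 0 != 0.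
  by move=> w0 h; apply: contraNneq w0 => h'; apply/eqP; apply: cV2P; rewrite mxE.
rewrite /hopf det2E; congr negb.
have [hu|hu] := eqVneq (u 1 0) 0; have [hv|hv] := eqVneq (v 1 0) 0.
- by rewrite eqxx hu hv !(mulr0, mul0r) subrr eqxx.
- by rewrite hu mul0r subr0 mulf_eq0 (negPf hv) (negPf (nz _ u0 hu)).
- by rewrite hv mulr0 sub0r oppr_eq0 mulf_eq0 (negPf hu) (negPf (nz _ v0 hv)).
apply/eqP/eqP => [[]|].
  by move/eqP; rewrite eqr_div // => /eqP ->; rewrite mulrC subrr.
move=> h; congr Some; apply/eqP; rewrite eqr_div //; apply/eqP.
by apply/eqP; rewrite -subr_eq0 [v 0 0 * _]mulrC h.
Qed.

(** Both matrices have trace 2, which excludes a relative sign -1. Their entries give the squares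
    and the product of the coordinates, hence the vector up to a common sign. *)
Lemma pmat_inj_pm u v : pm_eq (pmat u) (pmat v) -> pm_eq u v.
Proof.
move=> H; have tr2 (w : V2) : pmat w 0 0 + pmat w 1 1 = 2%:R by rewrite !mxE /=; ring.
have {H} H : pmat u = pmat v.
  case: H => // H; have := tr2 u; rewrite H !mxE -opprD => /eqP.
  have := tr2 v; rewrite !mxE => ->; rewrite eq_sym -subr_eq0 opprK -natrD.
  by rewrite pnatr_eq0.
have e00 := congr1 (fun A : M2 => A 0 0) H; have e01 := congr1 (fun A : M2 => A 0 1) H.
have e10 := congr1 (fun A : M2 => A 1 0) H.
move: e00 e01 e10; rewrite !mxE /= => /addrI e1 /oppr_inj e2 e3.
move/eqP: e2; move/eqP: e3; rewrite !eqf_sqr => /orP[]/eqP h1 /orP[]/eqP h0.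
- by left; apply: cV2P.
- have [z|nz] := eqVneq (v 1 0) 0.
    by right; apply: cV2P; rewrite !mxE ?h0 // h1 z oppr0.
  left; apply: cV2P => //; apply: (mulIf nz); by rewrite -{1}h1.
- have [z|nz] := eqVneq (v 1 0) 0.
    by left; apply: cV2P; rewrite // h1 z oppr0.
  right; apply: cV2P; rewrite !mxE //; apply: (mulIf nz).
  by rewrite mulNr -e1 h1 mulrN opprK.
- by right; apply: cV2P; rewrite mxE.
Qed.

Lemma pmat_conj g u : \det g = 1 -> pmat (g *m u) = g *m pmat u *m invmx g.
Proof.
move=> dg; have gu : g \in unitmx by rewrite unitmxE dg unitr1.
apply: (canRL (mulmxK gu)); apply/matrixP => i j.
have dE := det_mx2 g; rewrite dg in dE.
have mE (A B : M2) : (A *m B) i j = A i 0 * B 0 j + A i 1 * B 1 j.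
  by rewrite mxE big_ord_recl big_ord1 /=; congr (_ + A _ _ * B _ _); apply/val_inj.
have H0 := mulmx2E g u 0; have H1 := mulmx2E g u 1.
rewrite !mE.
have ij (k : 'I_2) : k = 0 \/ k = 1.
  by case: k => [[|[|//]] hk]; [left|right]; apply/val_inj.
have one : g 0 0 * g 1 1 = 1 + g 0 1 * g 1 0 by rewrite dE subrK.
have [h1 h2 h3 h4] := pmatE (g *m u); have [k1 k2 k3 k4] := pmatE u.
by case: (ij i) => ->; case: (ij j) => ->;
  rewrite ?h1 ?h2 ?h3 ?h4 ?k1 ?k2 ?k3 ?k4 H0 H1; ring: one.
Qed.

End PlaneVectors.

(** * Shadow-colored diagrams *)

Section Diagrams.
Variable D : diagram.

Lemma region_inj (r r' : region D) : sval r = sval r' -> r = r'.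
Proof.
case: r r' => [c hc] [c' hc'] /= e; rewrite -e in hc' *.
by rewrite (bool_irrelevance hc hc').
Qed.

Lemma reg_connect (c c' : corner D) : connect (@corner_adj D) c c' -> reg c = reg c'.
Proof. by move=> h; apply: region_inj; apply/(fingraph.rootP (@corner_adj_sym D)). Qed.

Lemma reg_root (c : corner D) : connect (@corner_adj D) c (sval (reg c)).
Proof. exact: connect_root. Qed.

Lemma reg_tail_head (e : edge D) l : reg (tail_corner e l) = reg (head_corner e l).
Proof.
apply/reg_connect/connect1; apply/existsP; exists e; apply/existsP; exists l.
by rewrite !eqxx.
Qed.

Lemma knot_nxt_inj : knot_diagram D -> injective (@nxt D).
Proof.
move=> [_ conn _].
have surj (e : edge D) : e \in codom (@nxt D).
  (* Any starting point other than e serves: the walk from it to e has at least one step, and its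
     last step exhibits a predecessor of e. *)
  pose e' : edge D := (e.1, ~~ e.2).
  have ne : e' != e by rewrite /e'; case: (e) => x o; rewrite xpair_eqE eqxx /=; case: o.
  have := iter_findex (conn e' e); case: (findex _ _ _) => [/= h|n /= <-].
    by rewrite h eqxx in ne.
  exact: codom_f.
apply/injectiveP/card_uniqP; rewrite size_codom.
by apply: eq_card => e; rewrite surj.
Qed.

Hypothesis inj : injective (@nxt D).

Definition prv : edge D -> edge D := locked (invF inj).

Lemma nxt_prv e : nxt (prv e) = e.
Proof. by rewrite /prv -lock f_invF. Qed.

Lemma prv_nxt e : prv (nxt e) = e.
Proof. by rewrite /prv -lock invF_f. Qed.

Lemma left_region_prv x o : left_region (prv (x, o)) = reg (@half_corner D x o false true).
Proof. by rewrite /left_region reg_tail_head /head_corner nxt_prv. Qed.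

Lemma right_region_prv x o : right_region (prv (x, o)) = reg (@half_corner D x o false false).
Proof. by rewrite /right_region reg_tail_head /head_corner nxt_prv. Qed.

Lemma big_prv (T : Type) (idx : T) (op : Monoid.com_law idx) (F : edge D -> T) :
  \big[op/idx]_(e : edge D) F (prv e) = \big[op/idx]_(e : edge D) F e.
Proof. by rewrite [LHS](reindex_inj inj); apply: eq_bigr => e _; rewrite prv_nxt. Qed.

(** Edges are named by the passage they leave, so each crossing accounts for exactly two. Together
    with [big_prv] this makes differences between outgoing and incoming edges telescope. *)
Lemma big_edge (T : Type) (idx : T) (op : Monoid.com_law idx) (F : edge D -> T) :
  \big[op/idx]_(x : crossing D) op (F (x, true)) (F (x, false)) =
  \big[op/idx]_(e : edge D) F e.
Proof.
transitivity (\big[op/idx]_(x : crossing D) \big[op/idx]_(o : bool) F (x, o)).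
  by apply: eq_bigr => x _; rewrite big_bool.
by rewrite pair_bigA; apply: eq_bigr => -[x o].
Qed.

End Diagrams.

Section UpToSign.

Lemma pm_refl (U : zmodType) (u : U) : pm_eq u u.
Proof. by left. Qed.

Lemma pm_sym (U : zmodType) (u v : U) : pm_eq u v -> pm_eq v u.
Proof. by case=> ->; [left | right; rewrite opprK]. Qed.

Lemma pm_trans (U : zmodType) (u v w : U) : pm_eq u v -> pm_eq v w -> pm_eq u w.
Proof.
by case=> -> [->|->]; rewrite ?opprK; [left|right|right|left].
Qed.

Lemma pm_mulmx (F : pzRingType) m n q (A A' : 'M[F]_(m, n)) (B B' : 'M[F]_(n, q)) :
  pm_eq A A' -> pm_eq B B' -> pm_eq (A *m B) (A' *m B').
Proof.
by move=> [->|->] [->|->]; rewrite ?mulNmx ?mulmxN ?opprK; [left|right|right|left].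
Qed.

Lemma pm_invmx (F : comUnitRingType) n (A A' : 'M[F]_n) :
  pm_eq A A' -> pm_eq (invmx A) (invmx A').
Proof.
case=> [->|->]; first by left.
right; have u1 : (-1 : F) \is a GRing.unit by rewrite unitrN unitr1.
have e : - A' = -1 *: A' by rewrite scaleN1r.
have [h|h] := boolP (A' \in unitmx); last first.
  by rewrite [in LHS]invmx_out ?invmx_out // inE /= e unitmxZ.
by rewrite e invmxZ ?unitmxZ // invrN invr1 scaleN1r.
Qed.

Lemma pm_conj (F : comUnitRingType) n (K K' A A' : 'M[F]_n) :
  pm_eq K K' -> pm_eq A A' -> pm_eq (K *m A *m invmx K) (K' *m A' *m invmx K').
Proof.
by move=> hK hA; apply: pm_mulmx; [exact: pm_mulmx | exact: pm_invmx].
Qed.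

Variable R : realType.
Local Notation C := (Cplx R).
Local Notation V2 := 'cV[C]_2.
Implicit Types u v b : V2.

Lemma pm_star v b b' : pm_eq b b' -> star v b = star v b'.
Proof. by case=> ->; rewrite ?starN. Qed.

Lemma pm_det2_sqr u u' v v' : pm_eq u u' -> pm_eq v v' -> det2 u v ^+ 2 = det2 u' v' ^+ 2.
Proof. by move=> [->|->] [->|->]; rewrite ?det2Nl ?det2Nr ?sqrrN. Qed.

Lemma pm_det2_neq0 u u' v v' : pm_eq u u' -> pm_eq v v' ->
  (det2 u v != 0) = (det2 u' v' != 0).
Proof. by move=> [->|->] [->|->]; rewrite ?det2Nl ?det2Nr ?oppr_eq0. Qed.

End UpToSign.

Section ShadowGeometry.
Variables (R : realType) (D : diagram).
Local Notation C := (Cplx R).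
Local Notation M2 := 'M[C]_2.
Local Notation V2 := 'cV[C]_2.
Hypothesis inj : injective (@nxt D).
Variables (rho : edge D -> M2) (a : edge D -> V2) (s : region D -> V2) (p : V2).
Hypothesis hrep : representation rho.
Hypothesis hs : shadow_coloring rho a s.
Hypothesis hp : generic_vector a s p.
Local Notation prv := (prv inj).

(* Locked because conversion between two region colors would otherwise compute
   the search hidden in [fingraph.root]. *)
Definition corner_color : crossing D -> bool -> bool -> V2 :=
  locked (fun x ro ru => s (reg (@crn D x ro ru))).
Definition over_color : crossing D -> V2 := locked (fun x => a (x, true)).
(* The color of the part of the under-strand on the right of the over-strand. *)
Definition under_color : crossing D -> V2 :=
  locked (fun x => if positive x then invmx (pmat (over_color x)) *m a (x, false)
                   else a (x, false)).
(** The sign chosen on the right of the over-strand fixes the one on the left, so that [det2_star]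
    relates determinants of the two colors exactly and not only up to sign. *)
Definition under_color' : crossing D -> V2 :=
  locked (fun x => star (under_color x) (over_color x)).

Lemma corner_colorE x ro ru : corner_color x ro ru = s (reg (@crn D x ro ru)).
Proof. by rewrite /corner_color -lock. Qed.

Lemma over_colorE x : over_color x = a (x, true).
Proof. by rewrite /over_color -lock. Qed.

Lemma under_colorE x : under_color x =
  if positive x then invmx (pmat (over_color x)) *m a (x, false) else a (x, false).
Proof. by rewrite /under_color -lock. Qed.

Lemma under_colorE' x : under_color' x = star (under_color x) (over_color x).
Proof. by rewrite /under_color' -lock. Qed.

Let hcol : forall e, a e != 0 /\ pm_eq (rho e) (pmat (a e)).
Proof. by case: hs. Qed.

Lemma pmat_unit (v : V2) : pmat v \in unitmx.
Proof. by rewrite unitmxE det_pmat unitr1. Qed.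

Lemma a_over_prv x : pm_eq (a (prv (x, true))) (over_color x).
Proof.
have [_ h _] := hrep; have := h (prv (x, true)); rewrite nxt_prv => /(_ isT) h1.
have [_ h2] := hcol (x, true); have [_ h3] := hcol (prv (x, true)).
rewrite over_colorE; apply: pmat_inj_pm; apply: pm_trans (pm_sym h3) _; apply: pm_trans _ h2; exact: pm_sym.
Qed.

(** The Wirtinger relation transferred to vectors: conjugation of parabolic matrices is [star] by
    [pmat_conj], and a parabolic matrix determines its vector up to sign. *)
Let under_rel x : 
  if positive x then pm_eq (a (x, false)) (star (a (prv (x, false))) (over_color x))
  else pm_eq (a (prv (x, false))) (star (a (x, false)) (over_color x)).
Proof.
have [_ _ h] := hrep; have := h (prv (x, false)); rewrite nxt_prv => /(_ isT) /=.
have [_ h0] := hcol (x, true); rewrite -over_colorE in h0.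
have [_ h2] := hcol (x, false).
have [_ h3] := hcol (prv (x, false)).
have cj u : pmat (star u (over_color x)) =
  pmat (over_color x) *m pmat u *m invmx (pmat (over_color x)) := pmat_conj u (det_pmat _).
case: (positive x) => h1; apply: pmat_inj_pm.
  by rewrite (cj (a (prv (x, false)))); apply: pm_trans (pm_sym h2) _; apply: pm_trans h1 _; exact: pm_conj.
by rewrite (cj (a (x, false))); apply: pm_trans (pm_sym h3) _; apply: pm_trans h1 _; exact: pm_conj.
Qed.

Lemma a_under x : pm_eq (a (x, false)) (if positive x then under_color' x else under_color x).
Proof.
rewrite under_colorE' under_colorE; case: (positive x); last exact: pm_refl.
by rewrite /star (mulKVmx (pmat_unit _)); exact: pm_refl.
Qed.

Lemma a_under_prv x :
  pm_eq (a (prv (x, false))) (if positive x then under_color x else under_color' x).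
Proof.
have := under_rel x; rewrite under_colorE' under_colorE; case: (positive x) => h; last exact: h.
apply: pm_sym; rewrite -[X in pm_eq _ X](mulKmx (pmat_unit (over_color x))).
exact: pm_mulmx (pm_refl _) h.
Qed.

Let hreg e : s (left_region e) = star (s (right_region e)) (a e).
Proof. by case: hs => _ [_ h] _. Qed.

(** The outgoing half of the over-strand gives the rule on one side of the under-strand, the
    incoming half on the other; the sign of the crossing decides which is which. *)
Lemma color_over x ru : corner_color x false ru = star (corner_color x true ru) (over_color x).
Proof.
have h1 := hreg (x, true); have := hreg (prv (x, true)).
rewrite left_region_prv right_region_prv (pm_star _ (a_over_prv x)) => h2.
rewrite -over_colorE in h1; rewrite !corner_colorE.
rewrite /left_region /right_region /tail_corner /half_corner /= in h1 h2.
by case: (positive x) h1 h2 => h1 h2; case: ru; [exact: h1 | exact: h2 | exact: h2 | exact: h1].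
Qed.

Lemma color_under x : corner_color x true false = star (corner_color x true true) (under_color x).
Proof.
have h1 := hreg (x, false); have := hreg (prv (x, false)).
rewrite left_region_prv right_region_prv (pm_star _ (a_under_prv x)) => h2.
rewrite !corner_colorE.
rewrite (pm_star _ (a_under x)) in h1.
rewrite /left_region /right_region /tail_corner /half_corner /= in h1 h2.
by case: (positive x) h1 h2 => h1 h2; [exact: h2 | exact: h1].
Qed.

Lemma color_under' x : corner_color x false false = star (corner_color x false true) (under_color' x).
Proof.
have h1 := hreg (x, false); have := hreg (prv (x, false)).
rewrite left_region_prv right_region_prv (pm_star _ (a_under_prv x)) => h2.
rewrite !corner_colorE.
rewrite (pm_star _ (a_under x)) in h1.
rewrite /left_region /right_region /tail_corner /half_corner /= in h1 h2.
by case: (positive x) h1 h2 => h1 h2; [exact: h1 | exact: h2].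
Qed.

Let s0 r : s r != 0.
Proof. by case: hs => _ [h _] _. Qed.

Lemma p_neq0 : p != 0.
Proof. by case: hp. Qed.

Lemma det_p_arc e : det2 p (a e) != 0.
Proof.
by have [_ h _] := hp; rewrite -hopf_neq ?p_neq0 //; case: (hcol e).
Qed.

Lemma det_p_region r : det2 p (s r) != 0.
Proof. by have [_ _ h] := hp; rewrite -hopf_neq ?p_neq0. Qed.

Lemma det_arc_region e : det2 (a e) (s (right_region e)) != 0.
Proof.
have [_ _ /(_ e)] := hs; rewrite /= !inE negb_or => /andP[/andP[h _] _].
by rewrite -hopf_neq //; case: (hcol e).
Qed.

Let det_arc_region_prv e u : pm_eq (a (prv e)) u ->
  det2 u (s (right_region (prv e))) != 0.
Proof. by move=> h; rewrite -(pm_det2_neq0 h (pm_refl _)); exact: det_arc_region. Qed.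

Lemma det_over x ru : det2 (over_color x) (corner_color x true ru) != 0.
Proof.
have h1 := det_arc_region (x, true); have := det_arc_region_prv (a_over_prv x).
rewrite right_region_prv => h2; rewrite -over_colorE in h1; rewrite corner_colorE.
rewrite /right_region /tail_corner /half_corner /= in h1 h2.
by case: (positive x) h1 h2 => h1 h2; case: ru; [exact: h1 | exact: h2 | exact: h2 | exact: h1].
Qed.

Lemma det_under x : det2 (under_color x) (corner_color x true true) != 0.
Proof.
have h1 := det_arc_region (x, false); have := det_arc_region_prv (a_under_prv x).
rewrite (pm_det2_neq0 (a_under x) (pm_refl _)) in h1.
rewrite right_region_prv => h2; rewrite corner_colorE.
rewrite /right_region /tail_corner /half_corner /= in h1 h2.
by case: (positive x) h1 h2 => h1 h2; [exact: h2 | exact: h1].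
Qed.

Lemma det_p_over x : det2 p (over_color x) != 0.
Proof. by rewrite over_colorE; exact: det_p_arc. Qed.

Lemma det_p_under x : det2 p (under_color x) != 0 /\ det2 p (under_color' x) != 0.
Proof.
have h1 := det_p_arc (x, false); have h2 := det_p_arc (prv (x, false)).
rewrite (pm_det2_neq0 (pm_refl p) (a_under x)) in h1.
rewrite (pm_det2_neq0 (pm_refl p) (a_under_prv x)) in h2.
by case: (positive x) h1 h2 => h1 h2; [exact: conj h2 h1 | exact: conj h1 h2].
Qed.

End ShadowGeometry.

(** * Exponentials of the derivatives, and the equations of the diagram *)

Section PotentialExponentials.
Variable R : realType.
Local Notation C := (Cplx R).

(** After exponentiation a dilogarithm contributes 1 - z and a logarithm z, whatever the branch. The
    denominators are nonzero because a branch of Li_2 exists only away from z = 1. *)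
Lemma expC_pot (B : branches R) (wa wb wc wd : C) :
  wa != 0 -> wb != 0 -> wc != 0 -> wd != 0 ->
  branches_at B wa wb wc wd ->
  [/\ expC (pot_a B wa wb wc wd) = (wa - wb) * (wd - wa) / (wa * wc - wb * wd),
      expC (pot_b B wa wb wc wd) = (wa * wc - wb * wd) / ((wc - wb) * (wa - wb)),
      expC (pot_c B wa wb wc wd) = (wc - wb) * (wd - wc) / (wa * wc - wb * wd)
    & expC (pot_d B wa wb wc wd) = (wa * wc - wb * wd) / ((wd - wc) * (wd - wa))].
Proof.
move=> a0 b0 c0 d0 [[/Li2_branchP[_ h1 _ e1 _] /Li2_branchP[_ h2 _ e2 _]
  /Li2_branchP[_ h3 _ e3 _]] /Li2_branchP[_ h4 _ e4 _] /Li2_branchP[_ h5 _ e5 _]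
  /log_branch_expC e6 /log_branch_expC e7].
have n1 : wc - wb != 0 by apply: contraNneq h1 => /eqP; rewrite subr_eq0 => /eqP ->; rewrite divff // subrr.
have n2 : wd - wc != 0 by apply: contraNneq h2 => /eqP; rewrite subr_eq0 => /eqP ->; rewrite divff // subrr.
have n3 : wa * wc - wb * wd != 0.
  apply: contraNneq h3 => /eqP; rewrite subr_eq0 => /eqP ->.
  by rewrite divff ?subrr // mulf_neq0.
have n4 : wa - wb != 0 by apply: contraNneq h4 => /eqP; rewrite subr_eq0 => /eqP ->; rewrite divff // subrr.
have n5 : wd - wa != 0 by apply: contraNneq h5 => /eqP; rewrite subr_eq0 => /eqP ->; rewrite divff // subrr.
have f1 : 1 - wc / wb = (wb - wc) / wb by field.
have f2 : 1 - wc / wd = (wd - wc) / wd by field.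
have f3 : 1 - wa * wc / (wb * wd) = (wb * wd - wa * wc) / (wb * wd) by field; rewrite ?b0 ?d0.
have f4 : 1 - wb / wa = (wa - wb) / wa by field.
have f5 : 1 - wd / wa = (wa - wd) / wa by field.
have m1 : wb - wc != 0 by rewrite -opprB oppr_eq0.
have m3 : wb * wd - wa * wc != 0 by rewrite -opprB oppr_eq0.
have m5 : wa - wd != 0 by rewrite -opprB oppr_eq0.
rewrite /pot_a /pot_b /pot_c /pot_d.
move: e1 e2 e3 e4 e5 e6 e7; rewrite f1 f2 f3 f4 f5.
move: (Li2_log _ (li_cb B)) (Li2_log _ (li_cd B)) (Li2_log _ (li_acbd B)).
move: (Li2_log _ (li_ba B)) (Li2_log _ (li_da B)) (log_ba B _) (log_da B _).
move=> L4 L5 L6 L7 L1 L2 L3 e1 e2 e3 e4 e5 e6 e7.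
rewrite !(expCD, expCN) e1 e2 e3 e4 e5 e6 e7.
by split; field; rewrite ?a0 ?b0 ?c0 ?d0 ?n1 ?n2 ?n3 ?n4 ?n5 ?m1 ?m3 ?m5.
Qed.

Lemma branches_exist (wa wb wc wd : C) :
  wa != 0 -> wb != 0 -> wc != 0 -> wd != 0 -> wc != wb -> wd != wc ->
  wa * wc != wb * wd -> wa != wb -> wd != wa ->
  exists B, branches_at B wa wb wc wd.
Proof.
move=> a0 b0 c0 d0 n1 n2 n3 n4 n5.
have L (x y : C) : x != 0 -> y != 0 -> x != y -> exists g, Li2_branch (x / y) g.
  move=> x0 y0 xy; apply: Li2_branch_exists; first by rewrite mulf_neq0 ?invr_eq0.
  by rewrite subr_eq0 eq_sym; apply: contraNneq xy => h; rewrite -(divfK y0 x) h mul1r.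
have [g1 h1] := L wc wb c0 b0 n1.
have [g2 h2] : exists g, Li2_branch (wc / wd) g by apply: L; rewrite // eq_sym.
have [g3 h3] := L (wa * wc) (wb * wd) (mulf_neq0 a0 c0) (mulf_neq0 b0 d0) n3.
have [g4 h4] : exists g, Li2_branch (wb / wa) g by apply: L; rewrite // eq_sym.
have [g5 h5] := L wd wa d0 a0 n5.
have [g6 h6] := log_branch_exists (mulf_neq0 b0 (invr_neq0 a0)).
have [g7 h7] := log_branch_exists (mulf_neq0 d0 (invr_neq0 a0)).
exists (Branches g1 g2 g3 g4 g5 g6 g7).
exact: (And5 (And3 h1 h2 h3) h4 h5 h6 h7).
Qed.

Lemma expC_indicator (z : C) (b : bool) : expC (z * b%:R) = if b then expC z else 1.
Proof. by case: b; rewrite ?mulr1 // mulr0 expC0. Qed.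

Lemma expC_sgC (z : C) (b : bool) : expC (sgC R b * z) = if b then expC z else (expC z)^-1.
Proof. by rewrite /sgC; case: b; rewrite ?mul1r // mulN1r expCN. Qed.

Lemma expC_signed_sum (pos b1 b2 b3 b4 : bool) (z1 z2 z3 z4 : C) :
  expC (sgC R pos * z1 * b1%:R + sgC R pos * z2 * b2%:R + sgC R pos * z3 * b3%:R
        + sgC R pos * z4 * b4%:R) =
  (if b1 then if pos then expC z1 else (expC z1)^-1 else 1)
  * (if b2 then if pos then expC z2 else (expC z2)^-1 else 1)
  * (if b3 then if pos then expC z3 else (expC z3)^-1 else 1)
  * (if b4 then if pos then expC z4 else (expC z4)^-1 else 1).
Proof. by rewrite !expCD !expC_indicator !expC_sgC. Qed.

End PotentialExponentials.

Section Solution.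
Variables (R : realType) (D : diagram).
Local Notation C := (Cplx R).
Local Notation M2 := 'M[C]_2.
Local Notation V2 := 'cV[C]_2.
Hypothesis inj : injective (@nxt D).
Variables (rho : edge D -> M2) (a : edge D -> V2) (s : region D -> V2) (p : V2).
Hypothesis hrep : representation rho.
Hypothesis hs : shadow_coloring rho a s.
Hypothesis hp : generic_vector a s p.
Local Notation prv := (prv inj).
Local Notation ov := (over_color a).
Local Notation un := (under_color a).
Local Notation un' := (under_color' a).
Local Notation S := (corner_color s).

Definition wreg (k : region D) : C := det2 p (s k).
Definition wcorner : crossing D -> bool -> bool -> C :=
  locked (fun x ro ru => wreg (reg (@crn D x ro ru))).

Lemma wcornerE x ro ru : wcorner x ro ru = wreg (reg (@crn D x ro ru)).
Proof. by rewrite /wcorner -lock. Qed.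

Lemma wcorner_color x ro ru : wcorner x ro ru = det2 p (S x ro ru).
Proof. by rewrite wcornerE corner_colorE. Qed.

Lemma wreg_neq0 k : wreg k != 0.
Proof. exact: (det_p_region hs hp). Qed.

Lemma det_under' x : det2 (un' x) (S x false true) = det2 (un x) (S x true true).
Proof. by rewrite (color_over inj hrep hs) under_colorE' det2_star. Qed.

Lemma wcorner_over x ru :
  wcorner x true ru - wcorner x false ru = det2 (ov x) (S x true ru) * det2 p (ov x).
Proof. by rewrite !wcorner_color -det2_sub_star -(color_over inj hrep hs). Qed.

Lemma wcorner_right x :
  wcorner x true true - wcorner x true false = det2 (un x) (S x true true) * det2 p (un x).
Proof. by rewrite !wcorner_color -det2_sub_star -(color_under inj hrep hs). Qed.

Lemma wcorner_left x :
  wcorner x false true - wcorner x false false = det2 (un x) (S x true true) * det2 p (un' x).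
Proof. by rewrite !wcorner_color -det_under' -det2_sub_star -(color_under' inj hrep hs). Qed.

(** This is the quadratic relation at a crossing, the other ones being differences across a strand.
    Once these express all four values through one, the Pluecker relation for p, the over-color, the
    under-color and a region color turns the remaining factor into the second copy of the base of
    the square. *)
Lemma wcorner_cross x :
  wcorner x true false * wcorner x false true - wcorner x true true * wcorner x false false
  = (det2 p (ov x) * det2 (un x) (S x true true)) ^+ 2.
Proof.
have h1 := wcorner_over x true; have h3 := wcorner_right x; have h4 := wcorner_left x.
have := plucker p (ov x) (un x) (S x true true).
have hy : det2 p (un' x) = det2 p (un x) + det2 (un x) (ov x) * det2 p (ov x).
  by rewrite under_colorE' starE det2Dr det2Zr.
move: h1 h3 h4; rewrite hy -wcorner_color.
rewrite [det2 (ov x) (un x)]det2C.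
move: (wcorner x true true) (wcorner x true false) (wcorner x false true) (wcorner x false false).
move: (det2 p (ov x)) (det2 p (un x)) (det2 (un x) (ov x)) (det2 (un x) (S x true true)).
move: (det2 (ov x) (S x true true)) => x1 o y c m W1 W2 W3 W4 h1 h3 h4 h5.
have -> : W4 = W3 - m * (y + c * o) by rewrite -h4; ring.
have -> : W2 = W1 - m * y by rewrite -h3; ring.
have -> : W3 = W1 - x1 * o by rewrite -h1; ring.
transitivity (m * o * (y * x1 - W1 * - c)); first by ring.
by rewrite h5; ring.
Qed.

Definition edge_ratio (e : edge D) : C := det2 p (a e) / det2 (a e) (s (right_region e)).

Lemma pm_ratio (v v' u : V2) : pm_eq v v' -> det2 p v / det2 v u = det2 p v' / det2 v' u.
Proof. by case=> [->//|->]; rewrite det2Nl det2Nr invrN mulrNN. Qed.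

Lemma edge_ratio_over x :
  edge_ratio (x, true) = det2 p (ov x) / det2 (ov x) (S x true (positive x)).
Proof.
rewrite corner_colorE over_colorE /edge_ratio /right_region /tail_corner /half_corner /=.
by case: (positive x).
Qed.

Lemma edge_ratio_over_prv x :
  edge_ratio (prv (x, true)) = det2 p (ov x) / det2 (ov x) (S x true (~~ positive x)).
Proof.
rewrite corner_colorE; apply: (etrans (pm_ratio _ (a_over_prv inj hrep hs x))).
by rewrite right_region_prv /half_corner /=; case: (positive x).
Qed.

Lemma edge_ratio_under x :
  edge_ratio (x, false)
  = det2 p (if positive x then un' x else un x) / det2 (un x) (S x true true).
Proof.
apply: (etrans (pm_ratio _ (a_under a x))); have := det_under' x.
rewrite !corner_colorE /right_region /tail_corner /half_corner /=.
by case: (positive x) => h; [congr (_ / _); exact: h | ].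
Qed.

Lemma edge_ratio_under_prv x :
  edge_ratio (prv (x, false))
  = det2 p (if positive x then un x else un' x) / det2 (un x) (S x true true).
Proof.
apply: (etrans (pm_ratio _ (a_under_prv inj hrep hs x))); have := det_under' x.
rewrite !corner_colorE right_region_prv /half_corner /=.
by case: (positive x) => h; [ | congr (_ / _); exact: h].
Qed.

(** The ratio of an edge enters with exponent 1 for the region on its right and -1 for the region on
    its left. The same number serves at both ends of the edge. *)
Definition region_factor (k : region D) (e : edge D) : C :=
  (if right_region e == k then edge_ratio e else 1)
  / (if left_region e == k then edge_ratio e else 1).

(** Differences of w across a strand factor into two determinants and w_a w_c - w_b w_d is a square,
    so the factor of a corner reduces to the ratios, or their inverses, of the two half-edges that
    bound it. *)
Lemma expC_wdiff_at (B : crossing D -> branches R) k x :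
  branches_at (B x) (wreg (reg (corner_a x))) (wreg (reg (corner_b x)))
       (wreg (reg (corner_c x))) (wreg (reg (corner_d x))) ->
  expC (wdiff_at wreg B k x) =
    region_factor k (x, true) / region_factor k (prv (x, true))
    * (region_factor k (x, false) / region_factor k (prv (x, false))).
Proof.
move=> hB.
have [] := expC_pot (wreg_neq0 _) (wreg_neq0 _) (wreg_neq0 _) (wreg_neq0 _) hB.
rewrite /wdiff_at /coef_at.
move: (pot_a _ _ _ _ _) (pot_b _ _ _ _ _) (pot_c _ _ _ _ _) (pot_d _ _ _ _ _) => ta tb tc td.
move=> e1 e2 e3 e4; rewrite expC_signed_sum {}e1 {}e2 {}e3 {}e4.
rewrite /region_factor edge_ratio_over edge_ratio_over_prv edge_ratio_under edge_ratio_under_prv.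
rewrite !left_region_prv !right_region_prv.
have h1 := wcorner_over x true; have h2 := wcorner_over x false.
have h3 := wcorner_right x; have h4 := wcorner_left x; have h5 := wcorner_cross x.
have o0 := det_p_over hs hp x; have x10 := det_over inj hrep hs x true.
have x20 := det_over inj hrep hs x false; have m0 := det_under inj hrep hs x.
have [y10 y20] := det_p_under inj hrep hs hp x.
rewrite /right_region /left_region /tail_corner /half_corner /corner_a /corner_b /corner_c /corner_d /=.
have n1 : wcorner x false true * wcorner x true false
  - wcorner x false false * wcorner x true true
  = (det2 p (ov x) * det2 (un x) (S x true true)) ^+ 2.
  by rewrite -h5 mulrC [X in _ - X]mulrC.
have n2 : wcorner x true false * wcorner x false true
  - wcorner x false false * wcorner x true true
  = (det2 p (ov x) * det2 (un x) (S x true true)) ^+ 2.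
  by rewrite -h5 [X in _ - X]mulrC.
case: (positive x) => /=; rewrite -!wcornerE ?n1 ?n2 h1 h2 h3 h4;
move: (det2 p (ov x)) (det2 (ov x) (S x true true)) (det2 (ov x) (S x true false))
  (det2 (un x) (S x true true)) (det2 p (un x)) (det2 p (un' x)) o0 x10 x20 m0 y10 y20;
move=> o x1 x2 m y1 y2 o0 x10 x20 m0 y10 y20;
rewrite ![true == _]/= ![false == _]/=;
(* The four corners are compared with k independently, which covers the coincidences between regions
   at the crossing. *)
case: (_ == k); case: (_ == k); case: (_ == k); case: (_ == k);
by field; rewrite ?o0 ?x10 ?x20 ?m0 ?y10 ?y20.
Qed.

Lemma region_factor_neq0 k e : region_factor k e != 0.
Proof.
have r0 : edge_ratio e != 0.
  by rewrite mulf_neq0 ?invr_eq0 ?(det_p_arc hs hp) ?(det_arc_region hs).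
by rewrite /region_factor mulf_neq0 ?invr_eq0 //; case: ifP => _ //; exact: oner_neq0.
Qed.

(** By the factorizations, no argument of a dilogarithm is 0 or 1. *)
Lemma branches_at_crossing x : exists B : branches R,
  branches_at B (wreg (reg (corner_a x))) (wreg (reg (corner_b x)))
     (wreg (reg (corner_c x))) (wreg (reg (corner_d x))).
Proof.
have h1 := wcorner_over x true; have h2 := wcorner_over x false.
have h3 := wcorner_right x; have h4 := wcorner_left x; have h5 := wcorner_cross x.
have o0 := det_p_over hs hp x; have x10 := det_over inj hrep hs x true.
have x20 := det_over inj hrep hs x false; have m0 := det_under inj hrep hs x.
have [y10 y20] := det_p_under inj hrep hs hp x.
have n1 : wcorner x true true != wcorner x false true by rewrite -subr_eq0 h1; exact: mulf_neq0 x10 o0.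
have n2 : wcorner x true false != wcorner x false false by rewrite -subr_eq0 h2; exact: mulf_neq0 x20 o0.
have n3 : wcorner x true true != wcorner x true false by rewrite -subr_eq0 h3; exact: mulf_neq0 m0 y10.
have n4 : wcorner x false true != wcorner x false false by rewrite -subr_eq0 h4; exact: mulf_neq0 m0 y20.
have n5 : wcorner x true false * wcorner x false true
  != wcorner x true true * wcorner x false false.
  by rewrite -subr_eq0 h5; apply: expf_neq0; exact: mulf_neq0 o0 m0.
have n5' : wcorner x true false * wcorner x false true
  != wcorner x false false * wcorner x true true.
  by rewrite [X in _ != X]mulrC.
have n5'' : wcorner x false true * wcorner x true false
  != wcorner x false false * wcorner x true true.
  by rewrite [X in X != _]mulrC.
apply: branches_exist; try exact: wreg_neq0.
all: rewrite /corner_a /corner_b /corner_c /corner_d -!wcornerE.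
all: case: (positive x) => /=.
- exact: n2.
- exact: n4.
- exact: n3.
- exact: n1.
- exact: n5''.
- exact: n5'.
- exact: n4.
- exact: n2.
- exact: n1.
- exact: n3.
Qed.

Lemma wreg_solution : solution wreg.
Proof.
split.
  have [B hB] := choice branches_at_crossing.
  by exists (fun v => \sum_(x : crossing D) crossing_potential (positive x) (B x)
       (v (reg (corner_a x))) (v (reg (corner_b x)))
       (v (reg (corner_c x))) (v (reg (corner_d x)))); exists B.
move=> W [B [hB hW]] k; rewrite (wdiffE wreg_neq0 k hB hW) expC_sum.
under eq_bigr do rewrite expC_wdiff_at //.
rewrite (big_edge _ (fun e => region_factor k e / region_factor k (prv e))).
have e1 := prodf_div (index_enum (edge D)) xpredT (region_factor k) (fun e => region_factor k (prv e)).
have e2 : \prod_(e : edge D) region_factor k (prv e) = \prod_(e : edge D) region_factor k e.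
  exact: big_prv.
apply: (etrans e1); rewrite [X in _ / X]e2; apply: divff.
by apply/prodf_neq0 => e _; exact: region_factor_neq0.
Qed.

End Solution.

Lemma tet_edge_K b1 b2 : tet_edge (vK b1) (vK b2) = false.
Proof. by case: b1; case: b2. Qed.

Lemma tet_edge_P b1 b2 : tet_edge (vP b1) (vP b2) -> b2 = ~~ b1.
Proof. by case: b1; case: b2. Qed.

Lemma tet_edge_S b1 b2 : tet_edge (vS b1) (vS b2) -> b2 = ~~ b1.
Proof. by case: b1; case: b2. Qed.

(** * The developing map *)

Section DevelopingMap.
Variables (R : realType) (D : diagram).
Local Notation C := (Cplx R).
Local Notation M2 := 'M[C]_2.
Local Notation V2 := 'cV[C]_2.
Hypothesis inj : injective (@nxt D).
Variables (rho : edge D -> M2) (a : edge D -> V2) (s : region D -> V2) (p : V2).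
Hypothesis hrep : representation rho.
Hypothesis hs : shadow_coloring rho a s.
Hypothesis hp : generic_vector a s p.
Local Notation prv := (prv inj).
Local Notation ov := (over_color a).
Local Notation un := (under_color a).
Local Notation un' := (under_color' a).
Local Notation S := (corner_color s).
Local Notation wcorner := (wcorner s p).

Definition p_prime : crossing D -> V2 := locked (fun x => invmx (pmat (ov x)) *m p).

Lemma star_p_prime x : star (p_prime x) (ov x) = p.
Proof. by rewrite /p_prime -lock /star (mulKVmx (pmat_unit _)). Qed.

Definition dev (x : crossing D) (nu : octv) : V2 :=
  match nu with
  | inl b => if b then ov x else un x
  | inr (inl ro) => if ro then p else p_prime x
  | inr (inr ru) => S x true ru
  end.

Let hcol e : a e != 0 /\ pm_eq (rho e) (pmat (a e)).
Proof. by case: hs. Qed.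

Lemma chartE x ro ru u : pm_eq (chart rho (@crn D x ro ru) u) (if ro then u else star u (ov x)).
Proof.
rewrite /chart /crn; case: ro; first exact: pm_refl.
by apply: pm_mulmx (pm_refl _); rewrite over_colorE; case: (hcol (x, true)).
Qed.

Lemma chart_over x ro ru : pm_eq (chart rho (crn x ro ru) (dev x (vK true))) (a (x, true)).
Proof.
apply: pm_trans (chartE _ _ _ _) _; rewrite /= -over_colorE star_id.
by case: ro; exact: pm_refl.
Qed.

Lemma chart_under x ro ru :
  pm_eq (chart rho (crn x ro ru) (dev x (vK false))) (if ro then un x else un' x).
Proof. by apply: pm_trans (chartE _ _ _ _) _; rewrite under_colorE'; exact: pm_refl. Qed.

Lemma chart_P x ro ru : pm_eq (chart rho (crn x ro ru) (dev x (vP ro))) p.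
Proof.
apply: pm_trans (chartE _ _ _ _) _; rewrite /=.
by case: ro; rewrite ?star_p_prime; exact: pm_refl.
Qed.

Lemma chart_S x ro ru :
  pm_eq (chart rho (crn x ro ru) (dev x (vS ru))) (s (reg (crn x ro ru))).
Proof.
apply: pm_trans (chartE _ _ _ _) _; rewrite /= -(color_over inj hrep hs) -corner_colorE.
by case: ro; exact: pm_refl.
Qed.

Lemma chart_K_out x o l :
  pm_eq (chart rho (@half_corner D x o true l) (dev x (vK o))) (a (x, o)).
Proof.
case: o; rewrite /half_corner; first exact: chart_over.
apply: pm_trans (chart_under _ _ _) _; apply: pm_trans _ (pm_sym (a_under a x)).
by case: (positive x); exact: pm_refl.
Qed.

Lemma chart_K_in x o l :
  pm_eq (chart rho (@half_corner D x o false l) (dev x (vK o))) (a (prv (x, o))).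
Proof.
case: o; rewrite /half_corner.
  apply: pm_trans (chart_over _ _ _) _; rewrite -over_colorE; apply: pm_sym.
  exact: (a_over_prv inj hrep hs).
apply: pm_trans (chart_under _ _ _) _.
apply: pm_trans _ (pm_sym (a_under_prv inj hrep hs x)).
by case: (positive x); exact: pm_refl.
Qed.

Lemma half_cornerE x o out l :
  exists ro ru, @half_corner D x o out l = crn x ro ru.
Proof.
by rewrite /half_corner; case: o; [exists (~~ l), (out == positive x) | exists (out != positive x), (~~ l)].
Qed.

(** In the chart, the vectors at the three vertices of a face are, up to sign, the arc color of e,
    p, and the color of the region beside e. None of them refers to the end of the edge at which the
    face lies. *)
Lemma dev_glue (e : edge D) l nu nu' : (nu, nu') \in face_gluing e l ->
  pm_eq (chart rho (tail_corner e l) (dev e.1 nu))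
        (chart rho (head_corner e l) (dev (nxt e).1 nu')).
Proof.
have hK1 := chart_K_out e.1 e.2 l; have hK2 := chart_K_in (nxt e).1 (nxt e).2 l.
have hr := reg_tail_head e l.
rewrite /face_gluing; rewrite /tail_corner /head_corner in hr *.
have [ro [ru e1]] := half_cornerE e.1 e.2 true l.
have [ro' [ru' e2]] := half_cornerE (nxt e).1 (nxt e).2 false l.
rewrite e1 e2 in hr hK1 hK2 *.
rewrite /crn -/(crn _ _ _) !inE => /or3P[] /eqP[-> ->].
- apply: pm_trans hK1 _; apply: pm_trans _ (pm_sym hK2).
  by rewrite -!surjective_pairing prv_nxt; exact: pm_refl.
- exact: pm_trans (chart_P _ _ _) (pm_sym (chart_P _ _ _)).
- apply: pm_trans (chart_S _ _ _) _; apply: pm_trans _ (pm_sym (chart_S _ _ _)).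
  by rewrite hr; exact: pm_refl.
Qed.

(** For P', applying the over-color to both vectors moves P' to p and the region color across the
    over-strand, without changing the determinant. *)
Lemma det_dev_PS x ro ru : det2 (dev x (vP ro)) (dev x (vS ru)) = wcorner x ro ru.
Proof.
rewrite wcorner_color /=; case: ro => //.
by rewrite (color_over inj hrep hs) -[X in det2 X (star _ _)](star_p_prime x) det2_star.
Qed.

Lemma det_dev_OP x ro : det2 (dev x (vK true)) (dev x (vP ro)) = det2 (ov x) p.
Proof. by case: ro => //=; rewrite -(det2_star _ _ (ov x)) star_id star_p_prime. Qed.

Lemma det_dev_UP x ro :
  det2 (dev x (vK false)) (dev x (vP ro)) = det2 (if ro then un x else un' x) p.
Proof. by case: ro => //=; rewrite -(det2_star _ _ (ov x)) star_p_prime under_colorE'. Qed.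

Lemma det_dev_OS x ru : det2 (dev x (vK true)) (dev x (vS ru)) = det2 (ov x) (S x true ru).
Proof. by []. Qed.

Lemma det_dev_US x ru : det2 (dev x (vK false)) (dev x (vS ru)) = det2 (un x) (S x true true).
Proof.
case: ru => //=; rewrite (color_under inj hrep hs).
by rewrite -{1}(star_id (un x)) det2_star.
Qed.

Lemma det_dev_PP x : det2 (dev x (vP true)) (dev x (vP false)) = - det2 (ov x) p ^+ 2.
Proof.
rewrite /= -{1}(star_p_prime x) starE det2C det2Dr det2vv add0r det2Zr.
have h : det2 (p_prime x) (ov x) = det2 p (ov x).
  by rewrite -(det2_star _ _ (ov x)) star_id star_p_prime.
by rewrite h [det2 p _]det2C mulrNN expr2.
Qed.

Lemma det_dev_SS x :
  det2 (dev x (vS true)) (dev x (vS false)) = det2 (un x) (S x true true) ^+ 2.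
Proof.
rewrite /= (color_under inj hrep hs) starE det2Dr det2vv add0r det2Zr.
by rewrite [det2 (S _ _ _) _]det2C mulrNN expr2.
Qed.

Lemma det_dev_neq0 x nu mu : tet_edge nu mu -> det2 (dev x nu) (dev x mu) != 0.
Proof.
have o0 : det2 (ov x) p != 0 by rewrite det2C oppr_eq0; exact: (det_p_over hs hp).
have [y0 y0'] := det_p_under inj hrep hs hp x.
have m0 := det_under inj hrep hs x; have x0 := det_over inj hrep hs x.
have w0 ro ru : wcorner x ro ru != 0 by rewrite wcornerE; exact: (wreg_neq0 hs hp).
have sym u v : det2 u v != 0 -> det2 v u != 0 by rewrite [det2 v u]det2C oppr_eq0.
have PS ro ru : det2 (dev x (vP ro)) (dev x (vS ru)) != 0 by rewrite det_dev_PS; exact: w0.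
have OP ro : det2 (dev x (vK true)) (dev x (vP ro)) != 0 by rewrite det_dev_OP; exact: o0.
have UP ro : det2 (dev x (vK false)) (dev x (vP ro)) != 0.
  by rewrite det_dev_UP; case: ro; apply: sym; [exact: y0 | exact: y0'].
have OS ru : det2 (dev x (vK true)) (dev x (vS ru)) != 0 by rewrite det_dev_OS; exact: x0.
have US ru : det2 (dev x (vK false)) (dev x (vS ru)) != 0 by rewrite det_dev_US; exact: m0.
have PP : det2 (dev x (vP true)) (dev x (vP false)) != 0.
  by rewrite det_dev_PP oppr_eq0; apply: expf_neq0; exact: o0.
have SS : det2 (dev x (vS true)) (dev x (vS false)) != 0.
  by rewrite det_dev_SS; apply: expf_neq0; exact: m0.
case: nu => [b1 | [ro | ru]]; case: mu => [b2 | [rb | sb]].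
- by move=> h; exfalso; exact: (elimT negP (negbT (tet_edge_K b1 b2)) h).
- by move=> _; case: b1; [exact: OP | exact: UP].
- by move=> _; case: b1; [exact: OS | exact: US].
- by move=> _; apply: sym; case: b2; [exact: OP | exact: UP].
- by move=> /tet_edge_P ->; case: ro; [exact: PP | apply: sym; exact: PP].
- by move=> _; exact: PS.
- by move=> _; apply: sym; case: b2; [exact: OS | exact: US].
- by move=> _; apply: sym; exact: PS.
- by move=> /tet_edge_S ->; case: ru; [exact: SS | apply: sym; exact: SS].
Qed.

Lemma dev_neq0 x nu : dev x nu != 0.
Proof.
have nz (u v : V2) : det2 u v != 0 -> u != 0.
  by apply: contraNneq => ->; rewrite det2E !mxE !mul0r subrr.
have ex : exists mu, tet_edge nu mu.
  by case: nu => [b1 | [ro | ru]]; [exists (vP true)|exists (vS true)|exists (vP true)]; [case: b1|case: ro|case: ru].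
by have [mu /(det_dev_neq0 x) h] := ex; exact: nz h.
Qed.

Lemma pm_hopf (u v : V2) : pm_eq u v -> hopf u = hopf v.
Proof.
by case=> [->//|->]; rewrite /hopf !mxE oppr_eq0; case: eqP => // _; rewrite invrN mulrNN.
Qed.

Lemma holonomy_shadow : holonomy (wreg s p) rho.
Proof.
split; first exact: hrep.
exists dev; split.
- exact: dev_neq0.
- by move=> x nu mu h; rewrite hopf_neq ?dev_neq0 //; exact: det_dev_neq0.
- by move=> e l nu nu' h; apply: pm_hopf; exact: dev_glue.
move=> x; rewrite /cross_ratio -!wcornerE.
have SP ro ru : det2 (dev x (vS ru)) (dev x (vP ro)) = - wcorner x ro ru.
  by rewrite det2C det_dev_PS.
have PO ro : det2 (dev x (vP ro)) (dev x (vK true)) = - det2 (ov x) p.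
  by rewrite det2C det_dev_OP.
have SU ru : det2 (dev x (vS ru)) (dev x (vK false)) = - det2 (un x) (S x true true).
  by rewrite det2C det_dev_US.
have o0 : - det2 (ov x) p != 0 by rewrite -det2C; exact: (det_p_over hs hp).
have m0 : - det2 (un x) (S x true true) != 0 by rewrite oppr_eq0; exact: (det_under inj hrep hs x).
have cancel (u v z : C) : z != 0 -> u * z / (z * v) = u / v.
  by move=> z0; rewrite [u * z]mulrC -mulf_div divff // mul1r.
rewrite !det_dev_PS !SP !PO !SU; split.
- by [].
- exact: cancel.
- exact: cancel.
- by rewrite (cancel _ _ _ m0) invrN mulrNN.
- by rewrite (cancel _ _ _ m0) invrN mulrNN.
Qed.

End DevelopingMap.

(** * Congruences modulo pi^2 and changes of branch *)

Section Congruences.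
Variable R : realType.
Local Notation C := (Cplx R).
Implicit Types z : C.

Lemma congr_refl z : congr_pi2 z z.
Proof. by exists 0; rewrite subrr mul0r. Qed.

Lemma congr_eq z1 z2 : z1 = z2 -> congr_pi2 z1 z2.
Proof. by move=> ->; exact: congr_refl. Qed.

Lemma congr_sym z1 z2 : congr_pi2 z1 z2 -> congr_pi2 z2 z1.
Proof. by case=> k hk; exists (- k); rewrite rmorphN mulNr -hk opprB. Qed.

Lemma congr_trans z1 z2 z3 : congr_pi2 z1 z2 -> congr_pi2 z2 z3 -> congr_pi2 z1 z3.
Proof.
move=> [k hk] [l hl]; exists (k + l).
by rewrite rmorphD mulrDl -hk -hl addrA subrK.
Qed.

Lemma congrD z1 z2 z3 z4 : congr_pi2 z1 z2 -> congr_pi2 z3 z4 -> congr_pi2 (z1 + z3) (z2 + z4).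
Proof.
by move=> [k hk] [l hl]; exists (k + l); rewrite rmorphD mulrDl -hk -hl opprD addrACA.
Qed.

Lemma congrN z1 z2 : congr_pi2 z1 z2 -> congr_pi2 (- z1) (- z2).
Proof. by case=> k hk; exists (- k); rewrite rmorphN mulNr -hk opprB opprK addrC. Qed.

Lemma congrB z1 z2 z3 z4 : congr_pi2 z1 z2 -> congr_pi2 z3 z4 -> congr_pi2 (z1 - z3) (z2 - z4).
Proof. by move=> h1 h2; apply: congrD => //; exact: congrN. Qed.

Lemma congr_sg (b : bool) z1 z2 : congr_pi2 z1 z2 -> congr_pi2 (sgC R b * z1) (sgC R b * z2).
Proof. by rewrite /sgC; case: b; rewrite ?mul1r ?mulN1r //; exact: congrN. Qed.

Lemma congr_sum (I : Type) (r : seq I) (F G : I -> C) :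
  (forall i, congr_pi2 (F i) (G i)) ->
  congr_pi2 (\sum_(i <- r) F i) (\sum_(i <- r) G i).
Proof.
move=> H; elim: r => [|i r IH]; first by rewrite !big_nil; exact: congr_refl.
by rewrite !big_cons; exact: congrD.
Qed.

Lemma congr_sum_addl (I : Type) (r : seq I) (A E V : I -> C) :
  \sum_(i <- r) E i = 0 -> (forall i, congr_pi2 (A i + E i) (V i)) ->
  congr_pi2 (\sum_(i <- r) A i) (\sum_(i <- r) V i).
Proof. by move=> hE H; have := congr_sum r H; rewrite big_split /= hE addr0. Qed.

Lemma Ci2 : Ci R * Ci R = -1.
Proof. by rewrite /Ci mulCE /= -[RHS]/(Complex (-1 : R) (- 0)); congr Complex; ring. Qed.

Lemma periods_product (k l : int) :
  (2%:R * piC R * Ci R * k%:~R) * (2%:R * piC R * Ci R * l%:~R)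
  = (- 4 * k * l)%:~R * piC R ^+ 2.
Proof.
rewrite !rmorphM rmorphN /= -[4%:~R]/(4%:R : C).
transitivity (4%:R * piC R ^+ 2 * k%:~R * l%:~R * (Ci R * Ci R)); first by ring.
by rewrite Ci2; ring.
Qed.

Lemma congr_periods z (k l : int) :
  congr_pi2 (z + (2%:R * piC R * Ci R * k%:~R) * (2%:R * piC R * Ci R * l%:~R)) z.
Proof. by exists (- 4 * k * l); rewrite addrAC subrr add0r periods_product. Qed.

Lemma congr_4pi2 z (m : int) : congr_pi2 (z + 4%:R * piC R ^+ 2 * m%:~R) z.
Proof.
exists (4 * m); rewrite addrAC subrr add0r rmorphM /= -[4%:~R]/(4%:R : C); ring.
Qed.

(** The branch adds 2 pi i n log z + 4 pi^2 m to the value and subtracts 2 pi i n from the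
    logarithm. As Zt differs from log z by a period, what survives is a product of two periods and a
    multiple of 4 pi^2. *)
Lemma Li2_branch_congr (z Zt : C) g : Li2_branch z g -> expC Zt = z ->
  congr_pi2 (g z + Li2_log z g * Zt) (Li2 z + logC (1 - z) * Zt).
Proof.
move=> /Li2_branchP[z0 _ _ _ [n [m [-> ->]]]] e.
have [k hk] : exists k : int, Zt = logC z + 2%:R * piC R * Ci R * k%:~R.
  by apply: expC_inj; rewrite e expC_logC.
rewrite hk; apply: congr_trans (congr_4pi2 _ m); apply: congr_trans (congr_periods _ n (- k)).
apply: congr_eq; rewrite rmorphN /=; ring.
Qed.

(** The left side is (A - A')(B - B') - A' B', and the first product is one of two periods. *)
Lemma log_branch_congr (A A' B B' : C) : expC A = expC A' -> expC B = expC B' ->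
  congr_pi2 (A * B - A * B' - B * A') (- (A' * B')).
Proof.
move=> /expC_inj[k ->] /expC_inj[l ->]; apply: congr_trans (congr_periods _ k l).
by apply: congr_eq; ring.
Qed.

(* Both Zt and log z are logarithms of z, so u is even and u q pi^2 / 2 is a
   multiple of pi^2. *)
Lemma rogers_congr (z Zt Y : C) (u q : int) : z != 0 -> expC Zt = z ->
  Zt = logC z + u%:~R * piC R * Ci R -> Y = - logC (1 - z) + q%:~R * piC R * Ci R ->
  congr_pi2 (extended_rogers z u q)
    (Li2 z + logC (1 - z) * Zt + Zt * Y / 2%:R - piC R ^+ 2 / 6%:R).
Proof.
move=> z0 e hu hq.
have [k hk] : exists k : int, u = 2 * k.
  have [k hk] : exists k : int, Zt = logC z + 2%:R * piC R * Ci R * k%:~R.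
    by apply: expC_inj; rewrite e expC_logC.
  exists k; have : (u%:~R : C) * (piC R * Ci R) = (2 * k)%:~R * (piC R * Ci R).
    rewrite mulrA; apply: (addrI (logC z)); rewrite -hu hk; congr (_ + _).
    by rewrite rmorphM /= -[2%:~R]/(2%:R : C); ring.
  have pc0 : piC R * Ci R != 0.
    rewrite /piC /ofR /Ci mulCE; apply/eqP => -[_ /eqP].
    by rewrite mul0r addr0 mulr1 gt_eqF // pi_gt0.
  by move/(mulIf pc0)/eqP; rewrite eqr_int => /eqP.
exists (q * k).
have c2 := Ci2.
rewrite /extended_rogers hq hu hk !rmorphM /= -[2%:~R]/(2%:R : C).
move: (Ci R) c2 (piC R) (logC z) (logC (1 - z)) => I I2 P a b.
move: (k%:~R : C) (q%:~R : C) (Li2 z) => K Q L.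
transitivity (- (K * Q * P ^+ 2) * (I * I)); first by field.
by rewrite I2; ring.
Qed.

End Congruences.

(** * Orderings of the five tetrahedra *)

Definition tet0 : seq octv := [:: vP true; vP false; vS true; vS false].
Definition tetO (ru : bool) : seq octv := [:: vK true; vP true; vP false; vS ru].
Definition tetU (ro : bool) : seq octv := [:: vK false; vP ro; vS true; vS false].

Lemma tetrahedraE : tetrahedra = [:: tet0; tetO true; tetO false; tetU true; tetU false].
Proof. by []. Qed.

Lemma tetrahedra_ind (Q : seq octv -> Prop) :
  Q tet0 -> (forall ru, Q (tetO ru)) -> (forall ro, Q (tetU ro)) ->
  forall t, t \in tetrahedra -> Q t.
Proof.
move=> h0 hO hU t; rewrite tetrahedraE !inE.
by case/or4P => [|||/orP[]] /eqP ->.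
Qed.

(* In this order the Zickert shapes of the tetrahedra are exactly the arguments of
   the dilogarithms in W_j, so no functional equation of Li_2 is needed. *)
Definition vertex_rank (b : bool) (nu : octv) : nat :=
  match nu with
  | inl _ => 2
  | inr (inl ro) => if ro == b then 0 else 1
  | inr (inr ru) => if ru == b then 3 else 4
  end.

(** The list that is filtered is sorted by [vertex_rank], in which O and U may tie since no
    tetrahedron contains both. *)
Definition vertex_order (b : bool) (t : seq octv) : seq octv :=
  [seq nu <- [:: vP b; vP (~~ b); vK true; vK false; vS b; vS (~~ b)] | nu \in t].

Lemma vertex_order0 b : vertex_order b tet0 = [:: vP b; vP (~~ b); vS b; vS (~~ b)].
Proof. by case: b. Qed.

Lemma vertex_orderO b ru : vertex_order b (tetO ru) = [:: vP b; vP (~~ b); vK true; vS ru].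
Proof. by case: b; case: ru. Qed.

Lemma vertex_orderU b ro : vertex_order b (tetU ro) = [:: vP ro; vK false; vS b; vS (~~ b)].
Proof. by case: b; case: ro. Qed.

Lemma orientation0 b : orientation b (vertex_order b tet0) = if b then 1 else -1.
Proof. by case: b; vm_compute. Qed.

Lemma orientationO b ru : orientation b (vertex_order b (tetO ru)) = if ru then 1 else -1.
Proof. by case: b; case: ru; vm_compute. Qed.

Lemma orientationU b ro : orientation b (vertex_order b (tetU ro)) = if ro then -1 else 1.
Proof. by case: b; case: ro; vm_compute. Qed.

Lemma vertex_order_sorted b t : t \in tetrahedra ->
  perm_eq (vertex_order b t) t
  && pairwise (fun nu mu => (vertex_rank b nu < vertex_rank b mu)%N) (vertex_order b t).
Proof.
by move: t; apply: tetrahedra_ind => [|c|c]; case: b => //; case: c.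
Qed.

Lemma vertex_order_edges b t : t \in tetrahedra ->
  exists v0 v1 v2 v3, vertex_order b t = [:: v0; v1; v2; v3] /\
    [/\ tet_edge v0 v1, tet_edge v0 v2 & tet_edge v0 v3] /\
    [/\ tet_edge v1 v2, tet_edge v1 v3 & tet_edge v2 v3].
Proof.
move: t; apply: tetrahedra_ind => [|c|c].
- rewrite vertex_order0; exists (vP b), (vP (~~ b)), (vS b), (vS (~~ b)).
  by split=> //; case: b.
- rewrite vertex_orderO; exists (vP b), (vP (~~ b)), (vK true), (vS c).
  by split=> //; case: b; case: c.
- rewrite vertex_orderU; exists (vP c), (vK false), (vS b), (vS (~~ b)).
  by split=> //; case: b; case: c.
Qed.

Section SquareLogarithm.
Variable R : realType.
Local Notation C := (Cplx R).
Local Notation V2 := 'cV[C]_2.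

(** It depends on the determinant only through its square, hence is defined for vectors up to sign
    and is symmetric. *)
Definition sqlog (u v : V2) : C := logC (det2 u v ^+ 2) / 2%:R.

Lemma expC_sqlog u v : det2 u v != 0 -> expC (2%:R * sqlog u v) = det2 u v ^+ 2.
Proof.
move=> h; rewrite /sqlog mulrC divfK ?pnatr_eq0 // expC_logC //.
exact: expf_neq0.
Qed.

Lemma sqlog_eq u v u' v' : det2 u v ^+ 2 = det2 u' v' ^+ 2 -> sqlog u v = sqlog u' v'.
Proof. by rewrite /sqlog => ->. Qed.

Lemma sqlogC u v : sqlog u v = sqlog v u.
Proof. by apply: sqlog_eq; rewrite det2C sqrrN. Qed.

Lemma sqlog_pm u v u' v' : pm_eq u u' -> pm_eq v v' -> sqlog u v = sqlog u' v'.
Proof. by move=> h1 h2; apply: sqlog_eq; exact: pm_det2_sqr. Qed.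

End SquareLogarithm.

(** * Zickert's formula *)

Section ZickertData.
Variables (R : realType) (D : diagram).
Local Notation C := (Cplx R).
Local Notation M2 := 'M[C]_2.
Local Notation V2 := 'cV[C]_2.
Hypothesis inj : injective (@nxt D).
Variables (rho : edge D -> M2) (a : edge D -> V2) (s : region D -> V2) (p : V2).
Hypothesis hrep : representation rho.
Hypothesis hs : shadow_coloring rho a s.
Hypothesis hp : generic_vector a s p.
Local Notation ov := (over_color a).
Local Notation un := (under_color a).
Local Notation un' := (under_color' a).
Local Notation S := (corner_color s).
Local Notation wcorner := (wcorner s p).
Local Notation dev := (dev a s p).

Definition wlog (k : region D) : C := logC (wreg s p k).
Definition clog : crossing D -> bool -> bool -> C :=
  locked (fun x ro ru => wlog (reg (@crn D x ro ru))).

Lemma clogE x ro ru : clog x ro ru = wlog (reg (@crn D x ro ru)).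
Proof. by rewrite /clog -lock. Qed.

Lemma wcorner_neq0 x ro ru : wcorner x ro ru != 0.
Proof. by rewrite wcornerE; exact: (wreg_neq0 hs hp). Qed.

Lemma expC_clog x ro ru : expC (clog x ro ru) = wcorner x ro ru.
Proof. by rewrite clogE wcornerE; apply: expC_logC; exact: (wreg_neq0 hs hp). Qed.

(** The edges between P, P' and S, S' receive the logarithm of w at the corner, which is an
    admissible half of log(w^2); all others receive [sqlog]. This makes the logarithms in Zickert's
    sum those of W_0. *)
Definition dlog (x : crossing D) (nu mu : octv) : C :=
  match nu, mu with
  | inr (inl ro), inr (inr ru) => clog x ro ru
  | inr (inr ru), inr (inl ro) => clog x ro ru
  | _, _ => sqlog (dev x nu) (dev x mu)
  end.

Lemma dlog_sym x nu mu : dlog x nu mu = dlog x mu nu.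
Proof.
by case: nu => [b1 | [r1 | s1]]; case: mu => [b2 | [r2 | s2]];
  [exact: sqlogC | exact: sqlogC | exact: sqlogC | exact: sqlogC | exact: sqlogC
  | exact: erefl | exact: sqlogC | exact: erefl | exact: sqlogC].
Qed.

Lemma expC_dlog x nu mu : tet_edge nu mu ->
  expC (2%:R * dlog x nu mu) = det2 (dev x nu) (dev x mu) ^+ 2.
Proof.
move=> /(det_dev_neq0 inj hrep hs hp x) h0.
have E := expC_sqlog h0.
have PS ro ru : expC (2%:R * clog x ro ru) = det2 (dev x (vP ro)) (dev x (vS ru)) ^+ 2.
  by rewrite (det_dev_PS inj p hrep hs) mulr_natl mulr2n expCD expC_clog expr2.
have SP ro ru : expC (2%:R * clog x ro ru) = det2 (dev x (vS ru)) (dev x (vP ro)) ^+ 2.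
  by rewrite det2C sqrrN PS.
by move: E; case: nu h0 => [b1 | [r1 | s1]]; case: mu => [b2 | [r2 | s2]] => h0 E;
  [exact: E | exact: E | exact: E | exact: E | exact: E | exact: PS | exact: E | exact: SP | exact: E].
Qed.

Definition dshape (x : crossing D) (t : seq octv) : C :=
  let c i j := det2 (dev x (nth (vK true) t i)) (dev x (nth (vK true) t j)) in
  (c 0%N 3%N * c 1%N 2%N) / (c 0%N 2%N * c 1%N 3%N).
(** The left side of [zuE], as [dlogY] is that of [zqE]. *)
Definition dlogZ (x : crossing D) (t : seq octv) : C :=
  let l i j := dlog x (nth (vK true) t i) (nth (vK true) t j) in
  l 0%N 3%N + l 1%N 2%N - l 0%N 2%N - l 1%N 3%N.
Definition dlogY (x : crossing D) (t : seq octv) : C :=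
  let l i j := dlog x (nth (vK true) t i) (nth (vK true) t j) in
  l 0%N 2%N + l 1%N 3%N - l 0%N 1%N - l 2%N 3%N.

Lemma dshape4 x v0 v1 v2 v3 : dshape x [:: v0; v1; v2; v3] =
  (det2 (dev x v0) (dev x v3) * det2 (dev x v1) (dev x v2))
  / (det2 (dev x v0) (dev x v2) * det2 (dev x v1) (dev x v3)).
Proof. by []. Qed.

Lemma dlogZ4 x v0 v1 v2 v3 : dlogZ x [:: v0; v1; v2; v3] =
  dlog x v0 v3 + dlog x v1 v2 - dlog x v0 v2 - dlog x v1 v3.
Proof. by []. Qed.

Lemma dlogY4 x v0 v1 v2 v3 : dlogY x [:: v0; v1; v2; v3] =
  dlog x v0 v2 + dlog x v1 v3 - dlog x v0 v1 - dlog x v2 v3.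
Proof. by []. Qed.

Definition olog x : C := sqlog (ov x) p.
Definition xlog x ru : C := sqlog (ov x) (S x true ru).
Definition mlog x : C := sqlog (un x) (S x true true).
Definition ylog x (ro : bool) : C := sqlog (if ro then un x else un' x) p.
Definition plog x : C := sqlog (dev x (vP true)) (dev x (vP false)).
Definition slog x : C := sqlog (dev x (vS true)) (dev x (vS false)).

Lemma dlog_PO x ro : dlog x (vP ro) (vK true) = olog x.
Proof. by rewrite /dlog sqlogC; apply: sqlog_eq; rewrite (det_dev_OP a s p x ro). Qed.

Lemma dlog_OS x ru : dlog x (vK true) (vS ru) = xlog x ru.
Proof. by []. Qed.

Lemma dlog_PU x ro : dlog x (vP ro) (vK false) = ylog x ro.
Proof. by rewrite /dlog sqlogC; apply: sqlog_eq; rewrite (det_dev_UP a s p x ro). Qed.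

Lemma dlog_US x ru : dlog x (vK false) (vS ru) = mlog x.
Proof. by rewrite /dlog; apply: sqlog_eq; rewrite (det_dev_US inj p hrep hs x ru). Qed.

Lemma dlog_PP x b : dlog x (vP b) (vP (~~ b)) = plog x.
Proof. by case: b; rewrite /dlog; [exact: erefl | exact: sqlogC]. Qed.

Lemma dlog_SS x b : dlog x (vS b) (vS (~~ b)) = slog x.
Proof. by case: b; rewrite /dlog; [exact: erefl | exact: sqlogC]. Qed.

Lemma dlog_PS x ro ru : dlog x (vP ro) (vS ru) = clog x ro ru.
Proof. by []. Qed.

Section Signs.
Variables (x : crossing D) (b : bool).
Local Notation w := (wcorner x).
Local Notation l := (clog x).

Lemma dlogZ0 : dlogZ x (vertex_order b tet0) =
  l b (~~ b) + l (~~ b) b - l b b - l (~~ b) (~~ b).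
Proof. by rewrite vertex_order0 dlogZ4 !dlog_PS. Qed.

Lemma dlogY0 : dlogY x (vertex_order b tet0) = l b b + l (~~ b) (~~ b) - plog x - slog x.
Proof. by rewrite vertex_order0 dlogY4 dlog_PP dlog_SS. Qed.

Lemma dshape0 : dshape x (vertex_order b tet0) =
  (w b (~~ b) * w (~~ b) b) / (w b b * w (~~ b) (~~ b)).
Proof. by rewrite vertex_order0 dshape4 !(det_dev_PS inj p hrep hs). Qed.

Lemma dlogZO ru : dlogZ x (vertex_order b (tetO ru)) = l b ru - l (~~ b) ru.
Proof.
by rewrite vertex_orderO dlogZ4 !dlog_PO !dlog_PS addrK.
Qed.

Lemma dlogYO ru : dlogY x (vertex_order b (tetO ru)) = olog x + l (~~ b) ru - plog x - xlog x ru.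
Proof. by rewrite vertex_orderO dlogY4 dlog_PO dlog_PS dlog_PP dlog_OS. Qed.

Let cancel (u v z : C) : z != 0 -> u * z / (z * v) = u / v.
Proof. by move=> z0; rewrite [u * z]mulrC -mulf_div divff // mul1r. Qed.

Lemma dshapeO ru : dshape x (vertex_order b (tetO ru)) = w b ru / w (~~ b) ru.
Proof.
rewrite vertex_orderO dshape4 !(det_dev_PS inj p hrep hs).
rewrite ![det2 (dev x (vP _)) (dev x (vK true))]det2C !det_dev_OP; apply: cancel.
by rewrite -det2C; exact: (det_p_over hs hp).
Qed.

Lemma dlogZU ro : dlogZ x (vertex_order b (tetU ro)) = l ro (~~ b) - l ro b.
Proof.
by rewrite vertex_orderU dlogZ4 !dlog_US !dlog_PS [_ + mlog x - _]addrAC addrK.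
Qed.

Lemma dlogYU ro : dlogY x (vertex_order b (tetU ro)) = l ro b + mlog x - ylog x ro - slog x.
Proof. by rewrite vertex_orderU dlogY4 dlog_PU dlog_PS dlog_SS dlog_US. Qed.

Lemma dshapeU ro : dshape x (vertex_order b (tetU ro)) = w ro (~~ b) / w ro b.
Proof.
rewrite vertex_orderU dshape4 !(det_dev_PS inj p hrep hs) !(det_dev_US inj p hrep hs).
rewrite [X in _ / X]mulrC; apply: cancel; exact: (det_under inj hrep hs).
Qed.

(** The logarithms of the edges at O or U cancel in pairs, and only logarithms of w remain. Hence
    the exponential is the shape itself, with no ambiguity of sign, as [rogers_congr] requires. *)
Lemma expC_dlogZ t : t \in tetrahedra ->
  dshape x (vertex_order b t) != 0
  /\ expC (dlogZ x (vertex_order b t)) = dshape x (vertex_order b t).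
Proof.
move: t; apply: tetrahedra_ind => [|ru|ro].
- rewrite dshape0 dlogZ0 !(expCD, expCN) !expC_clog; split.
    by rewrite !mulf_neq0 // ?invr_eq0 ?mulf_neq0 //; exact: wcorner_neq0.
  by rewrite invfM mulrA.
- rewrite dshapeO dlogZO expCB !expC_clog; split=> //.
  by rewrite mulf_neq0 ?invr_eq0 //; exact: wcorner_neq0.
- rewrite dshapeU dlogZU expCB !expC_clog; split=> //.
  by rewrite mulf_neq0 ?invr_eq0 //; exact: wcorner_neq0.
Qed.

Lemma dlogZ_ex t : t \in tetrahedra -> exists u : int,
  dlogZ x (vertex_order b t)
  = logC (dshape x (vertex_order b t)) + u%:~R * piC R * Ci R.
Proof.
move=> /expC_dlogZ[h0 h1].
have [k ->] : exists k : int, dlogZ x (vertex_order b t)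
    = logC (dshape x (vertex_order b t)) + 2%:R * piC R * Ci R * k%:~R.
  by apply: expC_inj; rewrite h1 expC_logC.
by exists (2 * k); rewrite rmorphM /= -[2%:~R]/(2%:R : C); congr (_ + _); ring.
Qed.

Lemma dlogY_ex t : t \in tetrahedra -> exists q : int,
  dlogY x (vertex_order b t)
  = - logC (1 - dshape x (vertex_order b t)) + q%:~R * piC R * Ci R.
Proof.
move=> /(vertex_order_edges b)[v0 [v1 [v2 [v3 [-> [[h01 h02 h03] [h12 h13 h23]]]]]]].
have n01 := det_dev_neq0 inj hrep hs hp x h01.
have n02 := det_dev_neq0 inj hrep hs hp x h02.
have n13 := det_dev_neq0 inj hrep hs hp x h13.
have n23 := det_dev_neq0 inj hrep hs hp x h23.
have e01 := expC_dlog x h01; have e02 := expC_dlog x h02.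
have e13 := expC_dlog x h13; have e23 := expC_dlog x h23.
have pl := plucker (dev x v0) (dev x v1) (dev x v2) (dev x v3).
rewrite dlogY4 dshape4.
move: (dlog x v0 v1) (dlog x v0 v2) (dlog x v1 v3) (dlog x v2 v3) e01 e02 e13 e23.
move: (det2 (dev x v0) (dev x v1)) (det2 (dev x v0) (dev x v2)) (det2 (dev x v1) (dev x v3))
  (det2 (dev x v2) (dev x v3)) (det2 (dev x v0) (dev x v3)) (det2 (dev x v1) (dev x v2))
  n01 n02 n13 n23 pl => c01 c02 c13 c23 c03 c12 n01 n02 n13 n23 pl l01 l02 l13 l23 e01 e02 e13 e23.
have hz : 1 - c03 * c12 / (c02 * c13) = c01 * c23 / (c02 * c13).
  by rewrite -pl; field; rewrite ?n02 ?n13.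
have z0 : c01 * c23 / (c02 * c13) != 0.
  by rewrite mulf_neq0 ?invr_eq0 ?mulf_neq0.
rewrite hz.
(* Halves of logarithms of squares occur here, so only the doubled combination can be exponentiated.
   It is a multiple of 2 pi i, and q may therefore be odd. *)
have [k hk] : exists k : int, 2%:R * (l02 + l13 - l01 - l23 + logC (c01 * c23 / (c02 * c13)))
    = 2%:R * piC R * Ci R * k%:~R.
  apply: expC_eq1.
  rewrite !(mulrDr, mulrN) !(expCD, expCN) e01 e02 e13 e23.
  rewrite [2%:R * logC _]mulr_natl mulr2n expCD expC_logC //.
  by field; rewrite n01 n02 n13 n23.
exists k; have two : (2%:R : C) != 0 by rewrite pnatr_eq0.
apply: (mulfI two); apply: (addIr (2%:R * logC (c01 * c23 / (c02 * c13)))).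
by rewrite -mulrDr hk; ring.
Qed.

End Signs.

Variables (rho0 : edge D -> M2) (h : M2).
Hypothesis det_h : \det h = 1.
Hypothesis rho0E : forall e, pm_eq (rho0 e) (h *m rho e *m invmx h).

Lemma chart_conj c (u : V2) : pm_eq (chart rho0 c (h *m u)) (h *m chart rho c u).
Proof.
have hu : h \in unitmx by rewrite unitmxE det_h unitr1.
case: c => [[x ro] ru]; rewrite /chart; case: ro; first exact: pm_refl.
have := pm_mulmx (rho0E (x, true)) (pm_refl (h *m u)).
by rewrite -!mulmxA (mulKmx hu).
Qed.

Lemma face_gluingE (e : edge D) l : exists ro ru ro' ru',
  [/\ tail_corner e l = crn e.1 ro ru, head_corner e l = crn (nxt e).1 ro' ru'
    & face_gluing e l = [:: (vK e.2, vK (nxt e).2); (vP ro, vP ro'); (vS ru, vS ru')]].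
Proof.
rewrite /face_gluing /tail_corner /head_corner.
have [ro [ru ->]] := half_cornerE e.1 e.2 true l.
have [ro' [ru' ->]] := half_cornerE (nxt e).1 (nxt e).2 false l.
by exists ro, ru, ro', ru'.
Qed.

(** A face has one vertex of each type, and the types are ranked P, then O or U, then S, whatever
    the sign of the crossing. The order within a pair P, P' or S, S' can thus be adapted to each
    crossing. *)
Lemma rank_glue (e : edge D) l nu nu' mu mu' :
  (nu, nu') \in face_gluing e l -> (mu, mu') \in face_gluing e l ->
  (vertex_rank (positive e.1) nu < vertex_rank (positive e.1) mu)%N =
  (vertex_rank (positive (nxt e).1) nu' < vertex_rank (positive (nxt e).1) mu')%N.
Proof.
have [ro [ru [ro' [ru' [_ _ ->]]]]] := face_gluingE e l.
move: (positive e.1) (positive (nxt e).1) => b b'.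
rewrite !inE => /or3P[] /eqP[-> ->] /or3P[] /eqP[-> ->];
by case: ro; case: ru; case: ro'; case: ru'; case: b; case: b'.
Qed.

Lemma dev_det_glue (e : edge D) l nu nu' mu mu' :
  (nu, nu') \in face_gluing e l -> (mu, mu') \in face_gluing e l ->
  det2 (dev e.1 nu) (dev e.1 mu) ^+ 2 = det2 (dev (nxt e).1 nu') (dev (nxt e).1 mu') ^+ 2.
Proof.
move=> /(dev_glue inj p hrep hs) h1 /(dev_glue inj p hrep hs) h2.
have dc c (u v : V2) : det2 (chart rho c u) (chart rho c v) = det2 u v.
  case: c => [[x ro] ru]; rewrite /chart; case: ro => //.
  by apply: det2_mul; case: hrep.
by have := pm_det2_sqr h1 h2; rewrite !dc.
Qed.

Lemma dlog_glue (e : edge D) l nu nu' mu mu' :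
  (nu, nu') \in face_gluing e l -> (mu, mu') \in face_gluing e l -> nu != mu ->
  dlog e.1 nu mu = dlog (nxt e).1 nu' mu'.
Proof.
move=> h1 h2; have sq := sqlog_eq (dev_det_glue h1 h2).
have hr := reg_tail_head e l; move: h1 h2 sq.
have [ro [ru [ro' [ru' [e1 e2 ->]]]]] := face_gluingE e l.
rewrite e1 e2 in hr.
have PS : clog e.1 ro ru = clog (nxt e).1 ro' ru' by rewrite !clogE hr.
rewrite !inE => /or3P[] /eqP[-> ->] /or3P[] /eqP[-> ->] sq ne;
  [ by rewrite eqxx in ne | exact: sq | exact: sq
  | exact: sq | by rewrite eqxx in ne | exact: PS
  | exact: sq | exact: PS | by rewrite eqxx in ne].
Qed.

(** The coloring belongs to rho, a conjugate of the representation rho0 under study. Moving all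
    vectors by h makes the assignment equivariant for rho0 and keeps all determinants. *)
Lemma zickert_data_exists : exists Z : zickert_data rho0,
  [/\ forall x t, zord Z x t = vertex_order (positive x) t,
      forall x nu, zvec Z x nu = h *m dev x nu
    & forall x nu mu, zlog Z x nu mu = dlog x nu mu].
Proof.
have H (xt : crossing D * seq octv) : exists uq : int * int,
    xt.2 \in tetrahedra ->
    dlogZ xt.1 (vertex_order (positive xt.1) xt.2)
      = logC (dshape xt.1 (vertex_order (positive xt.1) xt.2)) + uq.1%:~R * piC R * Ci R /\
    dlogY xt.1 (vertex_order (positive xt.1) xt.2)
      = - logC (1 - dshape xt.1 (vertex_order (positive xt.1) xt.2)) + uq.2%:~R * piC R * Ci R.
  case: (boolP (xt.2 \in tetrahedra)) => ht; last by exists (0, 0).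
  have [u hu] := dlogZ_ex xt.1 (positive xt.1) ht.
  have [q hq] := dlogY_ex xt.1 (positive xt.1) ht.
  by exists (u, q).
have [f hf] := choice H.
have hu : h \in unitmx by rewrite unitmxE det_h unitr1.
have dh x nu mu : det2 (h *m dev x nu) (h *m dev x mu) = det2 (dev x nu) (dev x mu).
  exact: det2_mul.
unshelve eexists.
  apply: (@ZickertData R D rho0
    (fun x nu mu => (vertex_rank (positive x) nu < vertex_rank (positive x) mu)%N)
    (fun x t => vertex_order (positive x) t)
    (fun x nu => h *m dev x nu)
    dlog (fun x t => (f (x, t)).1) (fun x t => (f (x, t)).2)).
- by move=> x nu mu; rewrite -leqNgt; exact: ltnW.
- by move=> e l nu nu' mu mu' h1 h2; exact: rank_glue h1 h2.
- by move=> x t; exact: vertex_order_sorted.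
- move=> x nu; apply: contraNneq (dev_neq0 inj hrep hs hp x nu) => h0.
  by rewrite -(mulKmx hu (dev x nu)) h0 mulmx0.
- move=> e l nu nu' /(dev_glue inj p hrep hs) h1.
  apply: pm_trans (chart_conj _ _) _; apply: pm_trans _ (pm_sym (chart_conj _ _)).
  exact: pm_mulmx (pm_refl h) h1.
- by move=> x nu mu h1; rewrite dh; exact: (det_dev_neq0 inj hrep hs hp).
- by move=> x nu mu h1; rewrite dh; exact: expC_dlog.
- exact: dlog_sym.
- by move=> e l nu nu' mu mu' h1 h2 h3; exact: dlog_glue h1 h2 h3.
- by move=> x t ht /=; rewrite !dh; have [h1 _] := hf (x, t) ht; exact: h1.
- by move=> x t ht /=; rewrite !dh; have [_ h1] := hf (x, t) ht; exact: h1.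
by split.
Qed.

End ZickertData.

(** * The value of W_0 modulo pi^2 *)

Section PotentialValue.
Variable R : realType.
Local Notation C := (Cplx R).

(** The normal form of a dilogarithm shared by W_0 and Zickert's sum, where Zt is a chosen logarithm
    of z. *)
Definition dilog_term (z Zt : C) : C := Li2 z + logC (1 - z) * Zt.

Lemma dilog_termC1 (x y z t a b c d : C) :
  dilog_term (x * y / (z * t)) (a + b - (c + d)) = dilog_term (y * x / (z * t)) (b + a - c - d).
Proof. by rewrite [x * y]mulrC [a + b]addrC opprD addrA. Qed.

Lemma dilog_termC2 (x y z t a b c d : C) :
  dilog_term (x * y / (z * t)) (a + b - (c + d)) = dilog_term (y * x / (t * z)) (b + a - d - c).
Proof. by rewrite dilog_termC1 [z * t]mulrC [b + a - c - d]addrAC. Qed.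

(** Subtracting the logarithmic derivatives times log w attaches to each dilogarithm its own
    logarithm of 1 - z times the logarithm of its argument, as in [Li2_branch_congr]. The two
    logarithms come out in the combination of [log_branch_congr]. *)
Lemma potential_regroup (G1 G2 G3 G4 G5 F1 F2 F3 F4 F5 A B la lb lc ld sg c6 : C) :
  sg * (- G1 - G2 + G3 + G4 + G5 - c6 + A * B)
  - (sg * (- F3 + F4 + F5 - A - B) * la + sg * (- F1 + F3 - F4 + B) * lb
     + sg * (F1 + F2 - F3) * lc + sg * (- F2 + F3 - F5 + A) * ld)
  = sg * (- (G1 + F1 * (lc - lb)) - (G2 + F2 * (lc - ld)) + (G3 + F3 * (la + lc - (lb + ld)))
          + (G4 + F4 * (lb - la)) + (G5 + F5 * (ld - la)) - c6
          + (A * B - A * (ld - la) - B * (lb - la))).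
Proof. by ring. Qed.

Lemma potential_congr pos (B : branches R) (wa wb wc wd la lb lc ld : C) :
  branches_at B wa wb wc wd ->
  expC la = wa -> expC lb = wb -> expC lc = wc -> expC ld = wd ->
  congr_pi2
    (crossing_potential pos B wa wb wc wd
     - (sgC R pos * pot_a B wa wb wc wd * la + sgC R pos * pot_b B wa wb wc wd * lb
        + sgC R pos * pot_c B wa wb wc wd * lc + sgC R pos * pot_d B wa wb wc wd * ld))
    (sgC R pos * (- dilog_term (wc / wb) (lc - lb) - dilog_term (wc / wd) (lc - ld)
      + dilog_term ((wa * wc) / (wb * wd)) (la + lc - (lb + ld))
      + dilog_term (wb / wa) (lb - la) + dilog_term (wd / wa) (ld - la)
      - piC R ^+ 2 / 6%:R + - ((lb - la) * (ld - la)))).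
Proof.
move=> [[h1 h2 h3] h4 h5 h6 h7] ea eb ec ed.
apply: congr_trans (congr_eq _) _; first exact: potential_regroup.
apply: congr_sg; apply: congrD; last first.
  by apply: log_branch_congr; rewrite expCB ?ea ?eb ?ed log_branch_expC.
apply: congrB; last exact: congr_refl.
apply: congrD; last by apply: Li2_branch_congr h5 _; rewrite expCB ea ed.
apply: congrD; last by apply: Li2_branch_congr h4 _; rewrite expCB ea eb.
apply: congrD; last by apply: Li2_branch_congr h3 _; rewrite expCB !expCD ea eb ec ed.
apply: congrB; last by apply: Li2_branch_congr h2 _; rewrite expCB ec ed.
apply: congrN; by apply: Li2_branch_congr h1 _; rewrite expCB ec eb.
Qed.

Lemma complex_volume_ex (z : C) : exists vol cs : R, complex_volume vol cs = z.
Proof.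
exists (cIm z), (- cRe z); case: z => x y.
by rewrite /complex_volume /Ci /ofR !mulCE /=; congr Complex; ring.
Qed.

(** At a solution each [wdiff] is a period, so another choice of log w_k changes the value by
    products of two periods. *)
Lemma potential0_logs (D : diagram) (W : (region D -> C) -> C) (w l1 l2 : region D -> C) :
  (forall k, expC (wdiff W w k) = 1) -> (forall k, expC (l1 k) = expC (l2 k)) ->
  congr_pi2 (potential0 W w l1) (potential0 W w l2).
Proof.
move=> hw hl; rewrite /potential0; apply: congrB; first exact: congr_refl.
apply: congr_sum => k; have [m ->] := expC_eq1 (hw k); have [n ->] := expC_inj (hl k).
by rewrite mulrDr; exact: congr_periods.
Qed.

Lemma potential0_sum (D : diagram) (w l : region D -> C) W (B : crossing D -> branches R) :
  (forall k, w k != 0) ->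
  (forall x, branches_at (B x)
       (w (reg (corner_a x))) (w (reg (corner_b x)))
       (w (reg (corner_c x))) (w (reg (corner_d x)))) ->
  (forall v, W v = \sum_(x : crossing D) crossing_potential (positive x) (B x)
       (v (reg (corner_a x))) (v (reg (corner_b x)))
       (v (reg (corner_c x))) (v (reg (corner_d x)))) ->
  potential0 W w l = \sum_(x : crossing D)
    (crossing_potential (positive x) (B x)
       (w (reg (corner_a x))) (w (reg (corner_b x)))
       (w (reg (corner_c x))) (w (reg (corner_d x)))
     - (coef_at w (@pot_a R) B x * l (reg (corner_a x)) + coef_at w (@pot_b R) B x * l (reg (corner_b x))
        + coef_at w (@pot_c R) B x * l (reg (corner_c x)) + coef_at w (@pot_d R) B x * l (reg (corner_d x)))).
Proof.
move=> w0 hB hW; rewrite /potential0 hW sumrB; congr (_ - _).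
under eq_bigr => k _ do rewrite (wdiffE w0 k hB hW) mulr_suml.
rewrite exchange_big; apply: eq_bigr => x _.
have one (c : C) (r : region D) : \sum_(k : region D) c * (r == k)%:R * l k = c * l r.
  rewrite (bigD1 r) //= eqxx mulr1 big1 ?addr0 // => k /negPf kr.
  by rewrite eq_sym kr mulr0 mul0r.
rewrite /wdiff_at.
under eq_bigr => k _ do rewrite !mulrDl.
rewrite 3!big_split /=.
by congr (_ + _ + _ + _); exact: one.
Qed.

End PotentialValue.

Section ZickertSum.
Variables (R : realType) (D : diagram).
Local Notation C := (Cplx R).
Local Notation M2 := 'M[C]_2.
Local Notation V2 := 'cV[C]_2.
Hypothesis inj : injective (@nxt D).
Variables (rho : edge D -> M2) (a : edge D -> V2) (s : region D -> V2) (p : V2).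
Hypothesis hrep : representation rho.
Hypothesis hs : shadow_coloring rho a s.
Hypothesis hp : generic_vector a s p.
Local Notation prv := (prv inj).
Local Notation wcorner := (wcorner s p).
Local Notation clog := (clog s p).
Local Notation olog := (olog a p).
Local Notation xlog := (xlog a s).
Local Notation mlog := (mlog a s).
Local Notation ylog := (ylog a p).

(* The terms of the sum of [dlogZ * dlogY] which do not come from the regions
   alone are a coboundary along the knot. *)
Definition edge_term (e : edge D) : C :=
  (sqlog (a e) p - sqlog (a e) (s (right_region e)))
  * (wlog s p (right_region e) - wlog s p (left_region e)).

Lemma edge_term_over x : edge_term (x, true) =
  (olog x - xlog x (positive x)) * (clog x true (positive x) - clog x false (positive x)).
Proof.
rewrite /edge_term /olog /xlog !clogE corner_colorE over_colorE.
by rewrite /right_region /left_region /tail_corner /half_corner /=; case: (positive x).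
Qed.

Lemma edge_term_over_prv x : edge_term (prv (x, true)) =
  (olog x - xlog x (~~ positive x))
  * (clog x true (~~ positive x) - clog x false (~~ positive x)).
Proof.
rewrite /edge_term /olog /xlog !clogE corner_colorE.
rewrite (sqlog_pm (a_over_prv inj hrep hs x) (pm_refl p)).
rewrite (sqlog_pm (a_over_prv inj hrep hs x) (pm_refl (s _))).
rewrite right_region_prv left_region_prv /half_corner /=.
by case: (positive x).
Qed.

Lemma sqlog_under_left x :
  sqlog (under_color' a x) (corner_color s x false true) = mlog x.
Proof. by apply: sqlog_eq; rewrite (det_under' inj hrep hs). Qed.

Lemma edge_term_under x : edge_term (x, false) =
  (ylog x (~~ positive x) - mlog x)
  * (clog x (~~ positive x) true - clog x (~~ positive x) false).
Proof.
have m := sqlog_under_left x; rewrite corner_colorE in m.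
rewrite /edge_term /ylog !clogE.
rewrite (sqlog_pm (a_under a x) (pm_refl p)).
rewrite (sqlog_pm (a_under a x) (pm_refl (s _))).
rewrite /right_region /left_region /tail_corner /half_corner /=.
case: (positive x) => /=; first by rewrite m.
by rewrite /mlog corner_colorE.
Qed.

Lemma edge_term_under_prv x : edge_term (prv (x, false)) =
  (ylog x (positive x) - mlog x)
  * (clog x (positive x) true - clog x (positive x) false).
Proof.
have m := sqlog_under_left x; rewrite corner_colorE in m.
rewrite /edge_term /ylog !clogE.
rewrite (sqlog_pm (a_under_prv inj hrep hs x) (pm_refl p)).
rewrite (sqlog_pm (a_under_prv inj hrep hs x) (pm_refl (s _))).
rewrite right_region_prv left_region_prv /half_corner /=.
case: (positive x) => /=; last by rewrite m.
by rewrite /mlog corner_colorE.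
Qed.

Definition rogers_value (x : crossing D) (t : seq octv) : C :=
  dilog_term (dshape a s p x t) (dlogZ a s p x t)
  + dlogZ a s p x t * dlogY a s p x t / 2%:R - piC R ^+ 2 / 6%:R.

(** The signs are the orientations of the ordered tetrahedra, and the terms are arranged like the
    unfolded sum over [tetrahedra]. *)
Definition crossing_value (x : crossing D) : C :=
  let b := positive x in
  sgC R b * rogers_value x (vertex_order b tet0)
  + (rogers_value x (vertex_order b (tetO true))
  + (- rogers_value x (vertex_order b (tetO false))
  + (- rogers_value x (vertex_order b (tetU true))
  + (rogers_value x (vertex_order b (tetU false)) + 0)))).

Variables (rho0 : edge D -> M2) (h : M2).
Hypothesis det_h : \det h = 1.

Lemma zickert_sum_congr (Z : zickert_data rho0) :
  (forall x t, zord Z x t = vertex_order (positive x) t) ->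
  (forall x nu, zvec Z x nu = h *m dev a s p x nu) ->
  (forall x nu mu, zlog Z x nu mu = dlog a s p x nu mu) ->
  congr_pi2 (zickert_sum Z) (\sum_(x : crossing D) crossing_value x).
Proof.
move=> ho hv hl.
have sh x t : zshape Z x t = dshape a s p x (vertex_order (positive x) t).
  by rewrite /zshape /dshape /= ho !hv !(det2_mul _ _ det_h).
have rog x t : t \in tetrahedra ->
  congr_pi2 (extended_rogers (zshape Z x t) (zu Z x t) (zq Z x t))
            (rogers_value x (vertex_order (positive x) t)).
  move=> ht; have [z0 ez] := expC_dlogZ inj hrep hs hp x (positive x) ht.
  rewrite sh; apply: rogers_congr z0 ez _ _.
    have := @zuE _ _ _ Z x t ht; rewrite /= !hl ho sh; exact.
  have := @zqE _ _ _ Z x t ht; rewrite /= !hl ho sh; exact.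
apply: congr_sum => x; rewrite tetrahedraE !big_cons big_nil !ho.
have Hp (e : int) u v : e = 1 -> congr_pi2 u v -> congr_pi2 (e%:~R * u) v.
  by move=> -> ?; rewrite mul1r.
have Hn (e : int) u v : e = -1 -> congr_pi2 u v -> congr_pi2 (e%:~R * u) (- v).
  by move=> -> ?; rewrite mulN1r; exact: congrN.
have Hs (e : int) b u v : e = (if b then 1 else -1) -> congr_pi2 u v ->
    congr_pi2 (e%:~R * u) (sgC R b * v).
  case: b => he huv.
    have -> : sgC R true * v = v by exact: mul1r.
    exact: Hp he huv.
  have -> : sgC R false * v = - v by exact: mulN1r.
  exact: Hn he huv.
rewrite /crossing_value.
apply: congrD; first exact: Hs (orientation0 _) (rog x tet0 isT).
apply: congrD; first exact: Hp (orientationO _ true) (rog x (tetO true) isT).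
apply: congrD; first exact: Hn (orientationO _ false) (rog x (tetO false) isT).
apply: congrD; first exact: Hn (orientationU _ true) (rog x (tetU true) isT).
apply: congrD; first exact: Hp (orientationU _ false) (rog x (tetU false) isT).
exact: congr_refl.
Qed.

(** With the signs of the five tetrahedra the logarithms pl and sl of the central edges PP' and SS'
    cancel, and a single constant c6 is left, as in W_j. The terms in o, xt, xf, m, yt, yf are the
    values of [edge_term] on outgoing minus incoming edges. *)
Lemma crossing_value_pos (d0 d1 d2 d3 d4 ltt ltf lft lff o xt xf m yt yf pl sl c6 : C) :
  1 * (d0 + (ltf + lft - ltt - lff) * (ltt + lff - pl - sl) / 2%:R - c6)
  + ((d1 + (ltt - lft) * (o + lft - pl - xt) / 2%:R - c6)
  + (- (d2 + (ltf - lff) * (o + lff - pl - xf) / 2%:R - c6)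
  + (- (d3 + (ltf - ltt) * (ltt + m - yt - sl) / 2%:R - c6)
  + ((d4 + (lff - lft) * (lft + m - yf - sl) / 2%:R - c6) + 0))))
  = 1 * (- d2 - d3 + d0 + d4 + d1 - c6 + - ((lff - lft) * (ltt - lft)))
    + ((o - xt) * (ltt - lft) - (o - xf) * (ltf - lff)
       + ((yf - m) * (lft - lff) - (yt - m) * (ltt - ltf))) / 2%:R.
Proof. by field. Qed.

Lemma crossing_value_neg (d0 d1 d2 d3 d4 ltt ltf lft lff o xt xf m yt yf pl sl c6 : C) :
  -1 * (d0 + (lft + ltf - lff - ltt) * (lff + ltt - pl - sl) / 2%:R - c6)
  + ((d1 + (lft - ltt) * (o + ltt - pl - xt) / 2%:R - c6)
  + (- (d2 + (lff - ltf) * (o + ltf - pl - xf) / 2%:R - c6)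
  + (- (d3 + (ltt - ltf) * (ltf + m - yt - sl) / 2%:R - c6)
  + ((d4 + (lft - lff) * (lff + m - yf - sl) / 2%:R - c6) + 0))))
  = -1 * (- d4 - d1 + d0 + d2 + d3 - c6 + - ((lff - ltf) * (ltt - ltf)))
    + ((o - xf) * (ltf - lff) - (o - xt) * (ltt - lft)
       + ((yt - m) * (ltt - ltf) - (yf - m) * (lft - lff))) / 2%:R.
Proof. by field. Qed.

Lemma crossing_value_potential x (B : branches R) :
  branches_at B (wreg s p (reg (corner_a x))) (wreg s p (reg (corner_b x)))
    (wreg s p (reg (corner_c x))) (wreg s p (reg (corner_d x))) ->
  congr_pi2
   (crossing_potential (positive x) B
       (wreg s p (reg (corner_a x))) (wreg s p (reg (corner_b x)))
       (wreg s p (reg (corner_c x))) (wreg s p (reg (corner_d x)))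
     - (coef_at (wreg s p) (@pot_a R) (fun=> B) x * wlog s p (reg (corner_a x))
        + coef_at (wreg s p) (@pot_b R) (fun=> B) x * wlog s p (reg (corner_b x))
        + coef_at (wreg s p) (@pot_c R) (fun=> B) x * wlog s p (reg (corner_c x))
        + coef_at (wreg s p) (@pot_d R) (fun=> B) x * wlog s p (reg (corner_d x)))
     + (edge_term (x, true) - edge_term (prv (x, true))
        + (edge_term (x, false) - edge_term (prv (x, false)))) / 2%:R)
   (crossing_value x).
Proof.
move=> hB.
have el k : expC (wlog s p k) = wreg s p k by apply: expC_logC; exact: (wreg_neq0 hs hp).
have H := potential_congr (positive x) hB (el _) (el _) (el _) (el _).
apply: congr_trans (congrD H (congr_refl _)) _; apply: congr_eq; move=> {H hB el}.
rewrite edge_term_over edge_term_over_prv edge_term_under edge_term_under_prv.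
have V0 b : rogers_value x (vertex_order b tet0) =
    dilog_term ((wcorner x b (~~ b) * wcorner x (~~ b) b)
                / (wcorner x b b * wcorner x (~~ b) (~~ b)))
      (clog x b (~~ b) + clog x (~~ b) b - clog x b b - clog x (~~ b) (~~ b))
    + (clog x b (~~ b) + clog x (~~ b) b - clog x b b - clog x (~~ b) (~~ b))
      * (clog x b b + clog x (~~ b) (~~ b) - plog a s p x - slog a s p x) / 2%:R
    - piC R ^+ 2 / 6%:R.
  by rewrite /rogers_value (dshape0 inj p hrep hs) dlogZ0 dlogY0.
have VO b ru : rogers_value x (vertex_order b (tetO ru)) =
    dilog_term (wcorner x b ru / wcorner x (~~ b) ru) (clog x b ru - clog x (~~ b) ru)
    + (clog x b ru - clog x (~~ b) ru)
      * (olog x + clog x (~~ b) ru - plog a s p x - xlog x ru) / 2%:R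
    - piC R ^+ 2 / 6%:R.
  by rewrite /rogers_value (dshapeO inj hrep hs hp) dlogZO dlogYO.
have VU b ro : rogers_value x (vertex_order b (tetU ro)) =
    dilog_term (wcorner x ro (~~ b) / wcorner x ro b) (clog x ro (~~ b) - clog x ro b)
    + (clog x ro (~~ b) - clog x ro b)
      * (clog x ro b + mlog x - ylog x ro - slog a s p x) / 2%:R
    - piC R ^+ 2 / 6%:R.
  by rewrite /rogers_value (dshapeU inj p hrep hs) (dlogZU inj p hrep hs) (dlogYU inj p hrep hs).
rewrite /crossing_value V0 !VO !VU {V0 VO VU}.
rewrite /corner_a /corner_b /corner_c /corner_d -!wcornerE -!clogE.
move: (olog x) (xlog x) (mlog x) (ylog x) (plog a s p x) (slog a s p x) => o xl m yl pl sl.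
move: (wcorner x) (clog x) => w l.
case: (positive x); cbv beta iota delta [negb].
  rewrite (dilog_termC2 (w false true) (w true false) (w false false) (w true true)).
  exact: esym (crossing_value_pos _ _ _ _ _ _ _ _ _ _ _ _ _ _ _ _ _ _).
rewrite (dilog_termC1 (w true false) (w false true) (w false false) (w true true)).
exact: esym (crossing_value_neg _ _ _ _ _ _ _ _ _ _ _ _ _ _ _ _ _ _).
Qed.

Hypothesis rho0E : forall e, pm_eq (rho0 e) (h *m rho e *m invmx h).

Lemma complex_volume_potential : exists vol cs : R, is_vol_cs rho0 vol cs /\
  forall (W : (region D -> C) -> C) (lw : region D -> C),
    potential (wreg s p) W -> (forall k, expC (lw k) = wreg s p k) ->
    congr_pi2 (potential0 W (wreg s p) lw) (complex_volume vol cs).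
Proof.
have [Z [ho hv hl]] := zickert_data_exists inj hrep hs hp det_h rho0E.
have [vol [cs e]] := complex_volume_ex (zickert_sum Z).
exists vol, cs; split; first by exists Z; rewrite e; exact: congr_refl.
move=> W lw hW elw; rewrite e.
apply: congr_trans _ (congr_sym (zickert_sum_congr ho hv hl)).
have sol := wreg_solution inj hrep hs hp.
have el k : expC (lw k) = expC (wlog s p k).
  by rewrite elw /wlog expC_logC //; exact: (wreg_neq0 hs hp).
(* The given logarithms are replaced by the principal ones, on which the edge logarithms [dlog] are
   built. *)
apply: congr_trans (potential0_logs (sol.2 W hW) el) _.
have [B [hB hWB]] := hW.
rewrite (potential0_sum _ (wreg_neq0 hs hp) hB hWB).
have tele : \sum_(x : crossing D) (edge_term (x, true) - edge_term (prv (x, true))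
   + (edge_term (x, false) - edge_term (prv (x, false)))) / 2%:R = 0.
  rewrite -mulr_suml (big_edge _ (fun e => edge_term e - edge_term (prv e))).
  have e2 : \sum_(e : edge D) edge_term (prv e) = \sum_(e : edge D) edge_term e.
    exact: big_prv.
  have e3 := sumrB (index_enum (edge D)) xpredT edge_term (fun e => edge_term (prv e)).
  by rewrite [X in X / _](etrans e3 (congr1 (fun z => _ - z) e2)) subrr mul0r.
apply: (congr_sum_addl tele) => x; exact: (crossing_value_potential (hB x)).
Qed.

End ZickertSum.

(** * Connected sums *)

Section FaceBoundary.
Variable D : diagram.
Hypothesis inj : injective (@nxt D).

(* Every corner is at the beginning of exactly one side of an edge and at the
   end of exactly one, when the regions are on the left of the directed sides. *)
Lemma side_sum (chi : corner D -> int) :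
  \sum_(e : edge D) ((chi (head_corner e true) - chi (head_corner e false))
    + (chi (tail_corner e false) - chi (tail_corner e true))) = 0.
Proof.
pose H o2 (e : edge D) := chi (half_corner e.1 e.2 o2 true) - chi (half_corner e.1 e.2 o2 false).
have e1 : \sum_(e : edge D) (chi (head_corner e true) - chi (head_corner e false))
  = \sum_(e : edge D) H false e.
  by rewrite [RHS](reindex_inj inj).
have e2 : \sum_(e : edge D) (chi (tail_corner e false) - chi (tail_corner e true))
  = \sum_(e : edge D) - H true e.
  by apply: eq_bigr => e _; rewrite opprB.
rewrite big_split /= e1 e2 -big_split /= -(big_edge _ (fun e => H false e - H true e)).
apply: big1 => x _; rewrite /H /half_corner /=.
by case: (positive x) => /=; ring.
Qed.

Lemma corner_connect_invariant (T : Type) (f : corner D -> T) :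
  (forall e l, f (tail_corner e l) = f (head_corner e l)) ->
  forall c c', connect (@corner_adj D) c c' -> f c = f c'.
Proof.
move=> H c c' /connectP[q]; elim: q c => [|d q IH] c /= => [_ -> //|/andP[+ hq] hc'].
move=> /existsP[e /existsP[l /orP[]/andP[/eqP h1 /eqP h2]]].
  by rewrite -(IH _ hq hc') h1 h2.
by rewrite -(IH _ hq hc') h1 h2.
Qed.

End FaceBoundary.

(** * Regions of a summand; the two summands play symmetric roles, so each can take the place of
    [D1] *)

Section Summand.
Variables (D D1 D2 : diagram) (i1 : crossing D1 -> crossing D) (i2 : crossing D2 -> crossing D).
Variables (e1 : edge D1) (e2 : edge D2).
Let E1 (e : edge D1) : edge D := (i1 e.1, e.2).
Let E2 (e : edge D2) : edge D := (i2 e.1, e.2).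
Let I1 (c : corner D1) : corner D := crn (i1 c.1.1) c.1.2 c.2.
Let I2 (c : corner D2) : corner D := crn (i2 c.1.1) c.1.2 c.2.
Hypothesis pos1 : forall x, positive (i1 x) = positive x.
Hypothesis pos2 : forall x, positive (i2 x) = positive x.
Hypothesis nxt1 : forall e, e != e1 -> nxt (E1 e) = E1 (nxt e).
Hypothesis nxt2 : forall e, e != e2 -> nxt (E2 e) = E2 (nxt e).
Hypothesis nxt12 : nxt (E1 e1) = E2 (nxt e2).
Hypothesis nxt21 : nxt (E2 e2) = E1 (nxt e1).
Hypothesis inj2 : injective (@nxt D2).
Hypothesis sides : forall e : edge D, left_region e != right_region e.

Lemma half_corner1 x o out l : I1 (half_corner x o out l) = half_corner (i1 x) o out l.
Proof. by rewrite /half_corner /I1 pos1; case: o. Qed.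

Lemma half_corner2 x o out l : I2 (half_corner x o out l) = half_corner (i2 x) o out l.
Proof. by rewrite /half_corner /I2 pos2; case: o. Qed.

Let tail1 e l : I1 (tail_corner e l) = tail_corner (E1 e) l.
Proof. exact: half_corner1. Qed.

Let tail2 e l : I2 (tail_corner e l) = tail_corner (E2 e) l.
Proof. exact: half_corner2. Qed.

Let head1 e l : e != e1 -> I1 (head_corner e l) = head_corner (E1 e) l.
Proof. by move=> h; rewrite /head_corner half_corner1 nxt1. Qed.

Let head2 e l : e != e2 -> I2 (head_corner e l) = head_corner (E2 e) l.
Proof. by move=> h; rewrite /head_corner half_corner2 nxt2. Qed.

Let head12 l : I1 (head_corner e1 l) = head_corner (E2 e2) l.
Proof. by rewrite /head_corner half_corner1 nxt21. Qed.

Let head21 l : I2 (head_corner e2 l) = head_corner (E1 e1) l.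
Proof. by rewrite /head_corner half_corner2 nxt12. Qed.

(* The rest of the boundary of the region of D2 on the side l of e2 joins the
   two ends of this side, or else the two sides of the connecting arc would
   belong to the same region. *)
Lemma summand_side l : reg (I2 (head_corner e2 l)) = reg (I2 (tail_corner e2 l)).
Proof.
(* In [side_sum] on [D2], with the indicator of a region k of [D], every edge other than [e2]
   cancels, since the ends of each of its sides stay in one region of [D]. *)
have key (k : region D) : let chi c : int := (reg (I2 c) == k)%:R in
    (chi (head_corner e2 true) - chi (head_corner e2 false))
    + (chi (tail_corner e2 false) - chi (tail_corner e2 true)) = 0.
  move=> chi; rewrite -[RHS](side_sum inj2 chi) (bigD1 e2) //= big1 ?addr0 // => e he.
  have same l' : chi (head_corner e l') = chi (tail_corner e l').
    by rewrite /chi (head2 _ he) tail2 reg_tail_head.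
  by rewrite !same -[X in _ + X]opprB subrr.
case: l.
  (* The term 1 of the chosen corner must be compensated by one of the two negative terms. One of
     these is the claim; the other would put a single region on both sides of a connecting arc. *)
  have := key (reg (I2 (head_corner e2 true))); rewrite /= eqxx.
  case: (reg (I2 (tail_corner e2 true)) =P reg (I2 (head_corner e2 true))) => [-> //|_].
  case: (reg (I2 (head_corner e2 false)) =P reg (I2 (head_corner e2 true))) => [h _|_].
    have := sides (E1 e1); rewrite /left_region /right_region !reg_tail_head -!head21.
    by rewrite h eqxx.
  by case: (reg _ == _).
have := key (reg (I2 (tail_corner e2 false))); rewrite /= eqxx.
case: (reg (I2 (head_corner e2 false)) =P reg (I2 (tail_corner e2 false))) => [-> //|_].
case: (reg (I2 (tail_corner e2 true)) =P reg (I2 (tail_corner e2 false))) => [h _|_].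
  have := sides (E2 e2); rewrite /left_region /right_region -!tail2.
  by rewrite h eqxx.
by case: (reg _ == _).
Qed.

(** For the cut edge, follow one connecting arc into [D2], pass to the other end of the cut in [D2]
    by [summand_side], and come back along the other connecting arc. *)
Lemma summand_region e l : reg (I1 (tail_corner e l)) = reg (I1 (head_corner e l)).
Proof.
have [->|he] := eqVneq e e1; last by rewrite tail1 head1 // reg_tail_head.
by rewrite tail1 reg_tail_head -head21 summand_side head12 tail2 reg_tail_head.
Qed.

(** The map from regions of a summand to regions of the sum is defined on canonical corners; this
    makes it computable on every corner. *)
Lemma summand_reg c : reg (I1 (sval (reg c))) = reg (I1 c).
Proof.
apply/esym; apply: (corner_connect_invariant (f := fun c => reg (I1 c)) summand_region).
exact: reg_root.
Qed.

End Summand.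

Section Conjugation.
Variable R : realType.
Local Notation C := (Cplx R).
Local Notation M2 := 'M[C]_2.

Lemma invmx_unique (A B : M2) : A *m B = 1%:M -> invmx A = B.
Proof.
move=> h; have [uA _] := mulmx1_unit h.
by rewrite -[LHS]mulmx1 -h (mulKmx uA).
Qed.

Lemma det_inv1 (g : M2) : \det g = 1 -> \det (invmx g) = 1.
Proof. by move=> h; rewrite det_inv h invr1. Qed.

Lemma pm_det (A B : M2) : pm_eq A B -> \det A = \det B.
Proof. by case=> ->; rewrite // !det_mx2 !mxE !mulrNN. Qed.

Lemma conj_conj (g k A : M2) : \det g = 1 -> \det k = 1 ->
  g *m (k *m A *m invmx k) *m invmx g
  = (g *m k *m invmx g) *m (g *m A *m invmx g) *m invmx (g *m k *m invmx g).
Proof.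
move=> dg dk; have gu : g \in unitmx by rewrite unitmxE dg unitr1.
have ku : k \in unitmx by rewrite unitmxE dk unitr1.
have -> : invmx (g *m k *m invmx g) = g *m invmx k *m invmx g.
  by apply: invmx_unique; rewrite -!mulmxA (mulKmx gu) (mulKVmx ku) (mulmxV gu).
by rewrite -!mulmxA !(mulKmx gu).
Qed.

Lemma conjugate_sym (D : diagram) (rho rho' : edge D -> M2) :
  conjugate rho rho' -> conjugate rho' rho.
Proof.
move=> [g [dg h]]; exists (invmx g); split; first exact: det_inv1.
have gu : g \in unitmx by rewrite unitmxE dg unitr1.
move=> e; rewrite invmxK; apply: pm_sym.
have := pm_mulmx (pm_mulmx (pm_refl (invmx g)) (h e)) (pm_refl g).
by rewrite -!mulmxA (mulKmx gu) (mulVmx gu) mulmx1.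
Qed.

Lemma representation_conj (D : diagram) (rho rho' : edge D -> M2) :
  conjugate rho rho' -> representation rho -> representation rho'.
Proof.
move=> [g [dg h]] [h1 h2 h3]; split.
- by move=> e; rewrite (pm_det (h e)) !det_mulmx dg h1 (det_inv1 dg) !mulr1.
- move=> e he; apply: pm_trans (h _) _; apply: pm_trans _ (pm_sym (h _)).
  by apply: pm_mulmx (pm_refl _); apply: pm_mulmx (pm_refl _) _; exact: h2.
move=> e he k; have := h3 e he; rewrite /=.
have hk := h ((nxt e).1, true); have dk := h1 ((nxt e).1, true).
case: (positive (nxt e).1) => he'.
  apply: pm_trans (h _) _.
  apply: pm_trans (pm_mulmx (pm_mulmx (pm_refl g) he') (pm_refl (invmx g))) _.
  by rewrite (conj_conj _ dg dk); exact: pm_conj (pm_sym hk) (pm_sym (h _)).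
apply: pm_trans (h _) _.
apply: pm_trans (pm_mulmx (pm_mulmx (pm_refl g) he') (pm_refl (invmx g))) _.
by rewrite (conj_conj _ dg dk); exact: pm_conj (pm_sym hk) (pm_sym (h _)).
Qed.

(** The statement for one diagram. The coloring induces rho', while the complex volume is that of
    rho, so Zickert's vectors are conjugated back from rho' to rho. *)
Lemma shadow_theorem (D : diagram) (rho rho' : edge D -> M2) (a : edge D -> 'cV[C]_2)
    (s : region D -> 'cV[C]_2) (p : 'cV[C]_2) :
  injective (@nxt D) -> representation rho -> conjugate rho rho' ->
  shadow_coloring rho' a s -> generic_vector a s p ->
  let w k := det2 p (s k) in
  [/\ solution w,
      exists rho', holonomy w rho' /\ conjugate rho' rho
    & exists vol cs : R, is_vol_cs rho vol cs /\
       forall (W : (region D -> C) -> C) (lw : region D -> C),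
         potential w W -> (forall k, expC (lw k) = w k) ->
         congr_pi2 (potential0 W w lw) (complex_volume vol cs)].
Proof.
move=> inj hrep hc hs hp w.
have hrep' := representation_conj hc hrep; have hc' := conjugate_sym hc.
split.
- exact: (wreg_solution inj hrep' hs hp).
- by exists rho'; split=> //; exact: (holonomy_shadow inj hrep' hs hp).
have [h [dh hh]] := hc'.
exact: (complex_volume_potential inj hrep' hs hp dh hh).
Qed.

Lemma left_right_region (D : diagram) (rho : edge D -> M2) a (s : region D -> 'cV[C]_2)
    (e : edge D) :
  shadow_coloring rho a s -> left_region e != right_region e.
Proof.
move=> [_ [_ hr] h]; have := h e; rewrite -hr /= !inE !negb_or => /and3P[_ h2 _].
by apply: contraNneq h2 => ->.
Qed.

End Conjugation.

Section Restriction.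
Variables (R : realType) (D D1 : diagram) (i1 : crossing D1 -> crossing D).
Local Notation C := (Cplx R).
Local Notation M2 := 'M[C]_2.
Hypothesis pos1 : forall x, positive (i1 x) = positive x.
Variables (rho : edge D -> M2) (rho' : edge D1 -> M2).
Variables (a : edge D -> 'cV[C]_2) (s : region D -> 'cV[C]_2) (p : 'cV[C]_2).
Hypothesis hs : shadow_coloring rho a s.
Hypothesis hp : generic_vector a s p.
Let E1 (e : edge D1) : edge D := (i1 e.1, e.2).
Let I1 (c : corner D1) : corner D := crn (i1 c.1.1) c.1.2 c.2.
Hypothesis hrho : forall e, pm_eq (rho (E1 e)) (rho' e).
Hypothesis hreg : forall c, reg (I1 (sval (reg c))) = reg (I1 c).
Variable r1 : region D1 -> region D.
Hypothesis r1E : forall r, r1 r = reg (I1 (sval r)).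

Let left1 e : r1 (left_region e) = left_region (E1 e).
Proof.
rewrite r1E /left_region hreg; congr reg.
by rewrite /I1 /tail_corner /half_corner /= pos1; case: (e.2).
Qed.

Let right1 e : r1 (right_region e) = right_region (E1 e).
Proof.
rewrite r1E /right_region hreg; congr reg.
by rewrite /I1 /tail_corner /half_corner /= pos1; case: (e.2).
Qed.

Lemma shadow_restriction : shadow_coloring rho' (a \o E1) (s \o r1).
Proof.
have [h1 [h2 h3] h4] := hs; split.
- move=> e; have [h5 h6] := h1 (E1 e); split; first exact: h5.
  exact: pm_trans (pm_sym (hrho e)) h6.
- split; first by move=> r; exact: h2.
  by move=> e; rewrite /= left1 right1 h3.
- by move=> e; rewrite /= right1; exact: h4.
Qed.

Lemma generic_restriction : generic_vector (a \o E1) (s \o r1) p.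
Proof.
by have [h1 h2 h3] := hp; split=> // [e|r]; [exact: h2 | exact: h3].
Qed.

End Restriction.

Theorem lemma3p4 (R : realType) (D1 D2 : diagram)
  (hD1 : knot_diagram D1) (hD2 : knot_diagram D2)
  (rho1 : edge D1 -> 'M[Cplx R]_2) (rho2 : edge D2 -> 'M[Cplx R]_2)
  (hrho1 : boundary_parabolic rho1) (hrho2 : boundary_parabolic rho2)
  (e1 : edge D1) (e2 : edge D2)
  (rho : edge (connected_sum e1 e2) -> 'M[Cplx R]_2)
  (hrho : is_connected_sum rho1 rho2 rho)
  (a : edge (connected_sum e1 e2) -> 'cV[Cplx R]_2)
  (s : region (connected_sum e1 e2) -> 'cV[Cplx R]_2)
  (hs : shadow_coloring rho a s)
  (p : 'cV[Cplx R]_2) (hp : generic_vector a s p) :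
  let w (k : region (connected_sum e1 e2)) : Cplx R := det2 p (s k) in
  let w1 (k : region D1) : Cplx R := w (lregion e1 e2 k) in
  let w2 (k : region D2) : Cplx R := w (rregion e1 e2 k) in
  [/\ solution w1,
      solution w2,
      (exists rho', holonomy w1 rho' /\ conjugate rho' rho1) /\
      (exists rho', holonomy w2 rho' /\ conjugate rho' rho2),
      (exists vol cs : R, is_vol_cs rho1 vol cs /\
         forall (W1 : (region D1 -> Cplx R) -> Cplx R) (lw1 : region D1 -> Cplx R),
           potential w1 W1 -> (forall k, expC (lw1 k) = w1 k) ->
           congr_pi2 (potential0 W1 w1 lw1) (complex_volume vol cs))
    & (exists vol cs : R, is_vol_cs rho2 vol cs /\
         forall (W2 : (region D2 -> Cplx R) -> Cplx R) (lw2 : region D2 -> Cplx R),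
           potential w2 W2 -> (forall k, expC (lw2 k) = w2 k) ->
           congr_pi2 (potential0 W2 w2 lw2) (complex_volume vol cs))].
Proof.
move=> w w1 w2.
have inj1 := knot_nxt_inj hD1; have inj2 := knot_nxt_inj hD2.
have [rho1' [rho2' [c1 c2 _ hl hr]]] := hrho.
pose D := connected_sum e1 e2.
have sides e := left_right_region e hs.
have nxt1 (e : edge D1) : e != e1 -> @nxt D (ledge e1 e2 e) = ledge e1 e2 (nxt e).
  by move=> he; rewrite /= -surjective_pairing (negPf he).
have nxt2 (e : edge D2) : e != e2 -> @nxt D (redge e1 e2 e) = redge e1 e2 (nxt e).
  by move=> he; rewrite /= -surjective_pairing (negPf he).
have nxt12 : @nxt D (ledge e1 e2 e1) = redge e1 e2 (nxt e2) by rewrite /= -surjective_pairing eqxx.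
have nxt21 : @nxt D (redge e1 e2 e2) = ledge e1 e2 (nxt e1) by rewrite /= -surjective_pairing eqxx.
have r1 := @summand_reg D D1 D2 inl inr e1 e2 (fun=> erefl) (fun=> erefl)
  nxt1 nxt2 nxt12 nxt21 inj2 sides.
have r2 := @summand_reg D D2 D1 inr inl e2 e1 (fun=> erefl) (fun=> erefl)
  nxt2 nxt1 nxt21 nxt12 inj1 sides.
have l1 r : lregion e1 e2 r = reg (@crn D (inl (sval r).1.1) (sval r).1.2 (sval r).2).
  by rewrite /lregion; case: r => [[[x ro] ru] hr0].
have l2 r : rregion e1 e2 r = reg (@crn D (inr (sval r).1.1) (sval r).1.2 (sval r).2).
  by rewrite /rregion; case: r => [[[x ro] ru] hr0].
have s1 := @shadow_restriction R D D1 inl (fun=> erefl) rho rho1' a s hs hl r1 (lregion e1 e2) l1.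
have s2 := @shadow_restriction R D D2 inr (fun=> erefl) rho rho2' a s hs hr r2 (rregion e1 e2) l2.
have g1 := @generic_restriction R D D1 inl a s p hp (lregion e1 e2).
have g2 := @generic_restriction R D D2 inr a s p hp (rregion e1 e2).
have [A1 B1 C1] := shadow_theorem inj1 hrho1.1 c1 s1 g1.
have [A2 B2 C2] := shadow_theorem inj2 hrho2.1 c2 s2 g2.
by split; [exact: A1 | exact: A2 | split; [exact: B1 | exact: B2] | exact: C1 | exact: C2].
Qed.
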